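(* Let $\alpha\in(0,2)$, let $G$ be a countably infinite group generated by a finite symmetric set $D$ with $e\notin D$, and let $\{\phi_t\}_{t\in G}$ be a nonsingular action of $G$ on a $\sigma$-finite standard measure space $(S,\mathcal S,m)$. (Inclusions, equalities and uniqueness of subsets of $S$ are understood modulo $m$-null sets.) (i) The set $S$ can be uniquely decomposed into two disjoint $\{\phi_t\}$-invariant measurable sets $\mathcal A$ and $\mathcal B$ (i.e. $S=\mathcal A\cup\mathcal B$) such that for any $f\in\mathcal L^\alpha(S,m)$: (a) whenever $f$ is supported on $\mathcal B$, $\lim_{n\to\infty} b_n(f)/|E_n|^{1/\alpha}=0$; and (b) if the support of $f$ has nontrivial intersection with $\mathcal A$ (i.e. $m(\{f\neq 0\}\cap\mathcal A)>0$), then $\limsup_{n\to\infty} b_n(f)/|E_n|^{1/\alpha}>0$. This decomposition is the same for all ($\sigma$-finite) measures equivalent to $m$. (ii) The dissipative part satisfies $\mathcal D\subseteq\mathcal A$ and the positive part satisfies $\mathcal P\subseteq\mathcal B$. (iii) Let $\{X_t\}_{t\in G}$ be a stationary S$\alpha$S random field with integral representation $X_t\overset{\text{fdd}}{=}\int_S f_t\,dM$, $t\in G$, where $$f_t(s)=c_t(s)\Big(\tfrac{d(m\circ\phi_t)}{dm}(s)\Big)^{1/\alpha} f(\phi_t(s)),\qquad t\in G,$$ for some $f\in\mathcal L^\alpha(S,m)$ and some measurable $\{-1,+1\}$-valued cocycle $\{c_t\}$ for $\{\phi_t\}$. Then $$X_t\overset{\text{fdd}}{=}\int_{\mathcal A}f_t\,dM+\int_{\mathcal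 B}f_t\,dM=:X_t^{\mathcal A}+X_t^{\mathcal B},\quad t\in G,$$ is a sum of two independent random fields $X^{\mathcal A}$ and $X^{\mathcal B}$, and with $M_n=\max_{t\in E_n}|X_t|$ the following hold. (a) If the component $X^{\mathcal A}$ is zero, then $M_n/|E_n|^{1/\alpha}\to 0$ in probability. (b) If the component $X^{\mathcal A}$ is nonzero, then the sequence $M_n/|E_n|^{1/\alpha}$ is tight, and there exist a subsequence $(n_k)$ and a constant $c>0$ such that $M_{n_k}/|E_{n_k}|^{1/\alpha}\Rightarrow cZ_\alpha$ in distribution, where $P(Z_\alpha\le x)=e^{-x^{-\alpha}}$ for $x>0$.
   Context: Group actions: an action of $G$ (identity $e$) on $(S,\mathcal S)$ is a family of measurable maps $\phi_t:S\to S$, $t\in G$, with $\phi_e=\mathrm{id}$ and $\phi_{uv}=\phi_v\circ\phi_u$ for all $u,v\in G$. It is nonsingular if $m\circ\phi_t\sim m$ (equivalence of measures) for every $t$. A $\{-1,+1\}$-valued measurable cocycle for $\{\phi_t\}$ is a family of measurable maps $c_t:S\to\{-1,+1\}$ with $c_{uv}(s)=c_u(s)\,c_v(\phi_u(s))$ for $m$-almost all $s$, for all $u,v\in G$. Balls: $|t|$ is the word length of $t$ with respect to $D$ (graph distance from $e$ in the Cayley graph with edges $(u,v)$, $u^{-1}v\in D$), and $E_n=\{t\in G:|t|\le n\}$. $\mathcal L^\alpha(S,m)$ is the set of measurable $f:S\to\mathbb R$ with $\|f\|_\alpha=(\int|f|^\alpha dm)^{1/\alpha}<\infty$. For $f\in\mathcal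 L^\alpha(S,m)$, $$b_n(f)=\Big(\int_S\max_{t\in E_n}|f_t(s)|^\alpha\,m(ds)\Big)^{1/\alpha},\qquad |f_t(s)|^\alpha=\tfrac{d(m\circ\phi_t)}{dm}(s)\,|f(\phi_t(s))|^\alpha .$$ Hopf decomposition: a measurable set $W$ is wandering if $\{\phi_t(W):t\in G\}$ is a pairwise disjoint collection. Then $S=\mathcal C\cup\mathcal D$ with $\mathcal C,\mathcal D$ disjoint and invariant, $\mathcal D=\bigcup_{t\in G}\phi_t(W^* )$ for some wandering set $W^*$ (dissipative part), and $\mathcal C$ (conservative part) containing no wandering set of positive measure. Neveu decomposition: $S=\mathcal P\cup\mathcal N$ with invariant $\mathcal P$ (positive part), the largest (modulo $m$) invariant set on which there is a finite $\{\phi_t\}$-invariant measure equivalent to $m$ (restricted to $\mathcal P$), and $\mathcal N=S\setminus\mathcal P$ (null part). Stable fields: a random variable $X$ is S$\alpha$S with scale $\sigma$ if $E e^{i\theta X}=\exp(-\sigma^\alpha|\theta|^\alpha)$. A random field $\{X_t\}_{t\in G}$ is S$\alpha$S if all finite linear combinations are S$\alpha$S; it is stationary (i.e. left-stationary) if $\{X_{s t}\}_{t\in G}$ has the same law as $\{X_t\}_{t\in G}$ for all $s\in G$. $M$ is an S$\alpha$S random measure on $S$ with control measure $m$: it is independently scattered and $E\exp(i\theta\int h\,dM)=\exp(-|\theta|^\alpha\int|h|^\alpha dm)$ for $h\in\mathcal L^\alpha(S,m)$. $\overset{\text{fdd}}{=}$ denotes equality of finite-dimensional distributions. *)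

(* Defs.v *)
From HB Require Import structures.
From mathcomp Require Import all_boot all_order all_algebra.
From mathcomp Require Import finmap.
From mathcomp Require Import all_classical all_reals all_analysis.
From mathcomp Require Import complex.

Set Implicit Arguments.
Unset Strict Implicit.
Unset Printing Implicit Defensive.

Import Order.TTheory GRing.Theory Num.Theory.
Import numFieldNormedType.Exports.
Import HBSimple.

Local Open Scope classical_set_scope.
Local Open Scope ring_scope.

Section word_metric.
Context {G : groupType}.
Implicit Types (D : {fset G}) (t u v : G).

Definition generates D : Prop :=
  forall H : {pred G}, group_closed H -> {subset D <= H} -> forall t, t \in H.

Definition cayley_edge D : rel G := fun u v => (u^-1 * v)%g \in D.

Definition cayley_walk D t : set nat :=
  [set n | exists p : seq G,
    [/\ path (cayley_edge D) 1%g p, last 1%g p = t & size p = n]].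

(** Graph distance from the identity; the default value [0] is only used for
    elements outside the subgroup generated by [D]. *)
Definition word_length D t : nat :=
  xget 0%N [set n | cayley_walk D t n /\
                    forall k, cayley_walk D t k -> (n <= k)%N].

Definition word_ball D (n : nat) : set G :=
  [set t | (word_length D t <= n)%N].

End word_metric.

(** The sigma-algebra of [S] is, up to a bijection, the Borel sigma-algebra of a
    Polish (completely metrizable, second countable) space. *)
Definition standard_borel (R : realType) d (S : measurableType d) : Prop :=
  exists (T : completePseudoMetricType R) (g : S -> T),
    [/\ hausdorff_space T, @second_countable T, bijective g &
        forall A : set S, measurable A <-> <<s [set U : set T | open U] >> (g @` A)].

Section measures.
Context {R : realType} {d} {S : measurableType d}.
Implicit Types (m mu : {measure set S -> \bar R}) (nu : set S -> \bar R).

Definition equivalent_measures (m1 m2 : set S -> \bar R) : Prop :=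
  m1 `<< m2 /\ m2 `<< m1.

Definition ae_subset m (A B : set S) : Prop := m.-negligible (A `\` B).

Definition ae_eqset m (A B : set S) : Prop :=
  ae_subset m A B /\ ae_subset m B A.

(** A version of the Radon-Nikodym derivative; the library's ['d nu '/d mu] is
    restricted to finite [nu]. *)
Definition density nu mu : S -> R :=
  xget (cst 0) [set w : S -> R |
    [/\ measurable_fun setT w, forall s, 0 <= w s &
        forall A, measurable A -> nu A = (\int[mu]_(s in A) (w s)%:E)%E]].

End measures.

Section actions.
Context {R : realType} {G : groupType} {d} {S : measurableType d}.
Implicit Types (m : {measure set S -> \bar R}) (phi : G -> S -> S).

Definition is_action phi : Prop :=
  [/\ forall t, measurable_fun setT (phi t), phi 1%g = id &
      forall u v, phi (u * v)%g = phi v \o phi u].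

(** [m o phi_t], i.e. [A |-> m (phi_t (A))] *)
Definition translate m phi (t : G) : set S -> \bar R :=
  fun A => m (phi t @` A).

Definition nonsingular m phi : Prop :=
  forall t, equivalent_measures (translate m phi t) m.

Definition rn_deriv m phi (t : G) : S -> R := density (translate m phi t) m.

Definition cocycle m phi (c : G -> S -> R) : Prop :=
  [/\ forall t, measurable_fun setT (c t),
      forall t s, c t s = 1 \/ c t s = -1 &
      forall u v, {ae m, forall s, c (u * v)%g s = c u s * c v (phi u s)}].

(** Invariance, like disjointness and covering below, is understood modulo
    [m]-null sets. *)
Definition invariant_set m phi (A : set S) : Prop :=
  measurable A /\ forall t, ae_eqset m (phi t @^-1` A) A.

Definition invariant_partition m phi (A B : set S) : Prop :=
  [/\ invariant_set m phi A, invariant_set m phi B,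
      ae_eqset m (A `&` B) set0 & ae_eqset m (A `|` B) setT].

(** The translates of [W] are disjoint as a family indexed by [G]: in particular
    [phi_t (W)] and [phi_u (W)] are disjoint for [t <> u] even if they are equal
    as sets. *)
Definition wandering phi (W : set S) : Prop :=
  measurable W /\ trivIset setT (fun t => phi t @` W).

Definition hopf_decomposition m phi (C Di : set S) : Prop :=
  [/\ invariant_partition m phi C Di,
      (exists W, wandering phi W /\ ae_eqset m Di (\bigcup_t phi t @` W)) &
      forall W, wandering phi W -> ae_subset m W C -> m W = 0%E].

(** There is a finite invariant measure on [P] equivalent to the restriction of
    [m] to [P]; it is encoded as a measure on [S] vanishing outside [P]. *)
Definition has_finite_invariant_measure m phi (P : set S) : Prop :=
  exists mu : {finite_measure set S -> \bar R},
    (forall t A, measurable A -> mu (phi t @^-1` A) = mu A) /\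
    (forall A, measurable A -> mu A = 0%E <-> m (A `&` P) = 0%E).

Definition neveu_decomposition m phi (P N : set S) : Prop :=
  [/\ invariant_set m phi P, has_finite_invariant_measure m phi P,
      (forall P', invariant_set m phi P' ->
         has_finite_invariant_measure m phi P' -> ae_subset m P' P) &
      ae_eqset m N (~` P)].

End actions.

Section maximal_functional.
Context {R : realType} {G : groupType} {d} {S : measurableType d}.
Variables (alpha : R) (D : {fset G}).
Implicit Types (m : {measure set S -> \bar R}) (phi : G -> S -> S) (f : S -> R).

(** [|E_n| ^ (1 / alpha)], with [E_n] the word ball *)
Definition ball_norming (n : nat) : R :=
  (#|` fset_set (word_ball D n)|%:R) `^ alpha^-1.

(** Used for nonnegative [y] only, so that the initial value [0] of the maximum
    is harmless. *)
Definition ball_max (y : G -> R) (n : nat) : R :=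
  \big[Num.max/0]_(t <- fset_set (word_ball D n)) y t.

Definition b_seq m phi f (n : nat) : \bar R :=
  ((\int[m]_s (ball_max
      (fun t => rn_deriv m phi t s * `|f (phi t s)| `^ alpha) n)%:E)
    `^ alpha^-1)%E.

Definition b_ratio m phi f (n : nat) : \bar R :=
  (b_seq m phi f n * ((ball_norming n)^-1)%:E)%E.

Definition ab_decomposition m phi (A B : set S) : Prop :=
  invariant_partition m phi A B /\
  forall f, f \in Lfun m alpha%:E ->
    (ae_subset m [set s | f s != 0] B ->
       b_ratio m phi f n @[n --> \oo] --> 0%E) /\
    ((0 < m ([set s | (f s != 0)%R] `&` A))%E ->
       (0 < limn_esup (b_ratio m phi f))%E).

Definition unique_ab_decomposition m phi (A B : set S) : Prop :=
  ab_decomposition m phi A B /\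
  forall A' B', ab_decomposition m phi A' B' ->
    ae_eqset m A' A /\ ae_eqset m B' B.

Definition field_kernel m phi (c : G -> S -> R) f (t : G) : S -> R :=
  fun s => c t s * rn_deriv m phi t s `^ alpha^-1 * f (phi t s).

End maximal_functional.

Section random_variables.
Context {R : realType} {d} {Omega : measurableType d} (P : probability Omega R).
Implicit Types (Y : Omega -> R).

Definition charfun Y (theta : R) : R[i] :=
  Complex (\int[P]_w cos (theta * Y w)) (\int[P]_w sin (theta * Y w)).

Definition is_SaS (alpha : R) Y (sigma : R) : Prop :=
  forall theta, charfun Y theta =
    real_complex R (expR (- (sigma `^ alpha * `|theta| `^ alpha))).

Definition cvg_in_probability (Y_ : nat -> Omega -> R) Y : Prop :=
  forall eps : R, 0 < eps ->
    P [set w | eps < `|Y_ n w - Y w|] @[n --> \oo] --> 0%E.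

Definition tight (Y_ : nat -> Omega -> R) : Prop :=
  forall eps : R, 0 < eps -> exists K : R,
    forall n, (P [set w | (K < `|Y_ n w|)%R] <= eps%:E)%E.

(** [F] is the distribution function of the limit law. *)
Definition cvg_in_distribution (Y_ : nat -> Omega -> R) (F : R -> R) : Prop :=
  forall x, {for x, continuous F} ->
    P [set w | Y_ n w <= x] @[n --> \oo] --> (F x)%:E.

Context {G : groupType}.
Implicit Types X : G -> Omega -> R.

Definition SaS_field (alpha : R) X : Prop :=
  forall k (t : k.-tuple G) (a : k.-tuple R), exists2 sigma, 0 <= sigma &
    is_SaS alpha (fun w => \sum_(i < k) tnth a i * X (tnth t i) w) sigma.

Definition field_sigma X : set (set Omega) :=
  <<s [set E | exists t (B : set R), measurable B /\ E = X t @^-1` B] >>.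

Definition independent_fields X1 X2 : Prop :=
  forall E1 E2, field_sigma X1 E1 -> field_sigma X2 E2 ->
    P (E1 `&` E2) = (P E1 * P E2)%E.

Definition fdd_prob X k (t : k.-tuple G) (B : set (k.-tuple R)) : \bar R :=
  P [set w | B [tuple X (tnth t i) w | i < k]].

End random_variables.

Definition fdd_eq {R : realType} {G : groupType}
    {d1} {Omega1 : measurableType d1} (P1 : probability Omega1 R)
    (X1 : G -> Omega1 -> R)
    {d2} {Omega2 : measurableType d2} (P2 : probability Omega2 R)
    (X2 : G -> Omega2 -> R) : Prop :=
  forall k (t : k.-tuple G) (B : set (k.-tuple R)), measurable B ->
    fdd_prob P1 X1 t B = fdd_prob P2 X2 t B.

Definition left_stationary {R : realType} {G : groupType}
    {d} {Omega : measurableType d} (P : probability Omega R)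
    (X : G -> Omega -> R) : Prop :=
  forall s, fdd_eq P (fun t => X (s * t)%g) P X.

(** The value for [x <= 0] is forced by the one for [x > 0]. *)
Definition frechet_cdf {R : realType} (alpha x : R) : R :=
  if 0 < x then expR (- (x `^ (- alpha))) else 0.

Section stable_integral.
Context {R : realType} {d} {S : measurableType d} {d'} {Omega : measurableType d'}.
Variables (alpha : R) (m : {measure set S -> \bar R}) (P : probability Omega R).

(** Only the values of [M] on measurable sets of finite measure matter. *)
Implicit Type M : set S -> {RV P >-> R}.

Definition simple_integral M (h : {sfun S >-> R}) : Omega -> R :=
  fun w => \sum_(y \in range h) y * M (h @^-1` [set y]) w.

(** [Y] is a version of the integral of [h], the limit in probability of the
    integrals of simple functions converging to [h] in [L^alpha]. *)
Definition is_stable_integral M (h : S -> R) (Y : Omega -> R) : Prop :=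
  measurable_fun setT Y /\
  exists h_ : nat -> {sfun S >-> R},
    [/\ forall n, (h_ n : S -> R) \in Lfun m alpha%:E,
        Lnorm m alpha%:E (fun s => (h_ n s - h s)%:E) @[n --> \oo] --> 0%E &
        cvg_in_probability P (fun n => simple_integral M (h_ n)) Y].

Definition independently_scattered M : Prop :=
  forall k (A : 'I_k -> set S),
    (forall i, measurable (A i) /\ (m (A i) < +oo)%E) -> trivIset setT A ->
    forall B : 'I_k -> set R, (forall i, measurable (B i)) ->
      P (\bigcap_i (M (A i) @^-1` B i)) =
      (\prod_(i < k) P (M (A i) @^-1` B i))%E.

Definition as_sigma_additive M : Prop :=
  forall A : nat -> set S, (forall n, measurable (A n)) -> trivIset setT A ->
    (m (\bigcup_n A n) < +oo)%E ->
    {ae P, forall w, series (fun n => M (A n) w) @ \oo --> M (\bigcup_n A n) w}.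

Definition SaS_random_measure M : Prop :=
  [/\ independently_scattered M, as_sigma_additive M &
      forall h Y, h \in Lfun m alpha%:E -> is_stable_integral M h Y ->
        forall theta, charfun P Y theta = real_complex R
          (expR (- (`|theta| `^ alpha *
             fine (\int[m]_s (`|h s| `^ alpha)%:E)%E)))].

Definition stable_integral M (h : S -> R) : Omega -> R :=
  xget (cst 0) [set Y | is_stable_integral M h Y].

Definition stable_integral_on M (A : set S) (h : S -> R) : Omega -> R :=
  stable_integral M (h \_ A).

End stable_integral.

(* Main.v *)
Require Import Defs.
From HB Require Import structures.
From mathcomp Require Import all_boot all_order all_algebra.
From mathcomp Require Import finmap ring lra.
From mathcomp Require Import all_classical all_reals all_analysis.
From mathcomp Require Import measurable_realfun hoelder charge.

(** Write [T_t w = (d(m o phi_t)/dm) (w o phi_t)] and call an integrable weight [w >= 0]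
    sublinear when [\int max_(t in E_n) T_t w dm = o(|E_n|)]; for [w = |f|^alpha] this
    integral is [b_n(f)^alpha].  Sublinearity depends only on the support of [w], is
    stable under [T_u], and is preserved by countable unions of supports.  By
    exhaustion there is a largest set [B] supporting only sublinear weights; it is
    invariant, and [A] is its complement.  On a wandering set the maximum over [E_n] is
    a sum, whose integral grows like [|E_n|], while the density [w] of a finite invariant
    measure satisfies [T_t w = w], so its maximal integral stays bounded.

    For the maxima, put [h = max_(t in E_n) |f_t|^alpha] and [q = \int h dm].  With
    independent points [(s_j, v_j)], [s_j] of law [h dm / q] and [v_j] uniform on a long
    interval, the sums [\sum_j f_t(s_j) h(s_j)^(-1/alpha) J(v_j)],
    [J(v) = sgn v |v|^(-1/alpha)], approximate the vector [(X_t)_(t in E_n)] in law up to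
    scale.  As [max_t |f_t| = h^(1/alpha)], the largest single jump has an exact Frechet
    law.  The event that for some [t] two jumps matter, or that the small jumps add
    up, has by a union bound a probability which vanishes at the scale
    [|E_n|^(1/alpha)].  Hence
    [P (M_n <= |E_n|^(1/alpha) x)] is close to [exp (- gam_n x^(-alpha))], where [gam_n]
    is a fixed multiple of [q / |E_n|]; [gam_n] is bounded and tends to [0] exactly when
    [|f|^alpha] is sublinear. *)

Set Implicit Arguments.
Unset Strict Implicit.
Unset Printing Implicit Defensive.

Import Order.TTheory GRing.Theory Num.Theory.
Import numFieldNormedType.Exports.

Local Open Scope classical_set_scope.
Local Open Scope ring_scope.

(** * Laws determined by their cosine transforms *)

(** The laws are known only through cosine transforms of linear forms, so they are compared on
    closed boxes, whose indicators are squeezed between trigonometric polynomials. Periodicity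
    spoils the squeeze far out, hence most of the mass must also lie in a bounded window.

    The law [h dm / q] is chosen because dividing the kernels by [h^(1/alpha)] makes their largest
    modulus constant: the largest jump over [E_n] then depends on the [v_j] alone, whatever the
    action.

    The union bound over [k = |E_n|] coordinates costs a factor [k]. Two jumps above [e k^(1/alpha)]
    in one coordinate have probability of order [e^(-2 alpha) k^(-2)], in total [e^(-2 alpha) / k].
    A sum of smaller jumps exceeding [delta k^(1/alpha)] has in total a probability of order
    [e^(2 - alpha) / delta^2]; as [alpha < 2], it is made small by choosing [e] after [delta] and
    before [n].

    The factor [2 / levy_cos] in [gam_n] has two origins: the two signs of a jump, and the constant
    by which the Levy measure of the jumps differs from that of an integral of scale one. *)

Section trigonometric.
Context {R : realType} {I : eqType}.
Implicit Types (x : I -> R) (l : seq (R * I)).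

Definition linform l x : R := \sum_(p <- l) p.1 * x p.2.

(** Trigonometric polynomials in finitely many coordinates. The phase [c] admits sines, which makes
    the class an algebra; expectations of its members are determined by the cosine transforms of
    linear forms. *)
Inductive trigfun : ((I -> R) -> R) -> Prop :=
| trig_cos l c : trigfun (fun x => cos (linform l x + c))
| trig_add F G : trigfun F -> trigfun G -> trigfun (fun x => F x + G x)
| trig_scale a F : trigfun F -> trigfun (fun x => a * F x).

Lemma trig_cst a : trigfun (fun=> a).
Proof.
have -> : (fun=> a) = (fun x : I -> R => a * cos (linform [::] x + 0)).
  by apply/funext => x; rewrite /linform big_nil addr0 cos0 mulr1.
exact/trig_scale/trig_cos.
Qed.

Lemma linform_cat l l' x : linform (l ++ l') x = linform l x + linform l' x.
Proof. by rewrite /linform big_cat. Qed.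

Lemma linform_opp l x :
  linform [seq (- p.1, p.2) | p <- l] x = - linform l x.
Proof.
by rewrite /linform big_map -sumrN; apply: eq_bigr => p _; rewrite mulNr.
Qed.

(** [cos A cos B = (cos (A + B) + cos (A - B)) / 2], and concatenating coefficient lists adds the
    linear forms. *)
Lemma trig_mul F G : trigfun F -> trigfun G -> trigfun (fun x => F x * G x).
Proof.
elim=> {F} [l c|F F' _ IF _ IF' /[dup] /IF tF /IF' tF'|a F _ IF /IF tF].
- elim=> {G} [l' c'|G G' _ IG _ IG'|a G _ IG].
  + have -> : (fun x => cos (linform l x + c) * cos (linform l' x + c')) =
      (fun x => 2^-1 * (cos (linform (l ++ l') x + (c + c')) +
        cos (linform (l ++ [seq (- p.1, p.2) | p <- l']) x + (c - c')))).
      apply/funext => x; rewrite !linform_cat linform_opp.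
      have -> : linform l x + linform l' x + (c + c') =
                (linform l x + c) + (linform l' x + c') by ring.
      have -> : linform l x - linform l' x + (c - c') =
                (linform l x + c) - (linform l' x + c') by ring.
      set A := linform l x + c; set B := linform l' x + c'.
      by rewrite [cos (A + B)]cosD [cos (A - B)]cosB; field.
    by apply/trig_scale/trig_add; exact: trig_cos.
  + under eq_fun do rewrite mulrDr.
    exact: trig_add.
  + under eq_fun do rewrite mulrCA.
    exact: trig_scale.
- under eq_fun do rewrite mulrDl.
  exact: trig_add.
- under eq_fun do rewrite -mulrA.
  exact: trig_scale.
Qed.

(* The polynomial [3 y^2 - 2 y^3] pushes [0, 1/2) towards 0 and (1/2, 1] towards 1,
   so its iterates turn an affine function of a cosine into an approximate indicator. *)
Definition smoothstep (y : R) := y * (y * (3 - 2 * y)).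

Lemma trig_smoothstep k F :
  trigfun F -> trigfun (fun x => iter k smoothstep (F x)).
Proof.
move=> tF; elim: k => //= k IH.
apply: trig_mul => //; apply: trig_mul => //; apply: trig_add; first exact: trig_cst.
under eq_fun do rewrite -mulNr.
exact: trig_scale.
Qed.

Lemma smoothstep_itv y : 0 <= y <= 1 -> 0 <= smoothstep y <= 1.
Proof.
move=> /andP[y0 y1]; rewrite /smoothstep; apply/andP; split; first by nra.
rewrite -subr_ge0 (_ : _ - _ = (1 - y) ^+ 2 * (1 + 2 * y)); last by ring.
by rewrite mulr_ge0 ?sqr_ge0//; lra.
Qed.

Lemma iter_smoothstep_itv k y : 0 <= y <= 1 -> 0 <= iter k smoothstep y <= 1.
Proof. by move=> y01; elim: k => //= k; exact: smoothstep_itv. Qed.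

Lemma smoothstepB y : smoothstep (1 - y) = 1 - smoothstep y.
Proof. rewrite /smoothstep; ring. Qed.

Lemma iter_smoothstepB k y : iter k smoothstep (1 - y) = 1 - iter k smoothstep y.
Proof. by elim: k => //= k ->; exact: smoothstepB. Qed.

(** [smoothstep y] is [y] times [y (3 - 2 y)], and on [[0, u]] the latter factor is at most
    [q = u (3 - 2 u)], which is below 1 because [u < 1/2]. The decay is therefore geometric,
    uniformly in [y]. *)
Lemma iter_smoothstep_small (u e : R) : 0 <= u < 2^-1 -> 0 < e ->
  exists k, forall y, 0 <= y <= u -> iter k smoothstep y <= e.
Proof.
move=> /andP[u0 u2] e0; pose q := u * (3 - 2 * u).
have q0 : 0 <= q by rewrite /q; nra.
have q1 : q < 1 by rewrite /q; nra.
have qk : (fun k => q ^+ k) @ \oo --> 0 by apply: cvg_expr; rewrite ger0_norm.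
have [k _ /(_ k (leqnn k)) qke] := cvgr0_norm_lt _ qk _ e0.
exists k => y /andP[y0 yu].
suff: 0 <= iter k smoothstep y <= q ^+ k * y.
  move=> /andP[_ /le_trans]; apply.
  rewrite (@le_trans _ _ (q ^+ k * 1))// ?ler_wpM2l ?exprn_ge0//; first by lra.
  by rewrite mulr1 (le_trans _ (ltW qke))// ler_norm.
elim: {qke} k => [|k /andP[i0 i1]] /=; first by rewrite expr0 mul1r lexx andbT.
have q1k : q ^+ k <= 1 by rewrite exprn_ile1// ltW.
have qk0 : 0 <= q ^+ k by rewrite exprn_ge0.
have iu : iter k smoothstep y <= u by nra.
rewrite exprS; move: (iter k _ _) i0 i1 iu => z z0 z1 zu.
rewrite /smoothstep; have : z * (3 - 2 * z) <= q by rewrite /q; nra.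
have : 0 <= z * (3 - 2 * z) by nra.
move: (z * _) => s s0 sq; apply/andP; split; first exact: mulr_ge0.
by rewrite mulrC -mulrA ler_pM.
Qed.

(** The division by 4 keeps the iterated argument in [[0, 1]]. For [lam > 0] and
    [0 <= a <= pi / lam], within half a period [pi / lam] of [c] this argument exceeds [1/2] exactly
    when [|y - c| < a]. *)
Definition bump (lam c a : R) k (y : R) : R :=
  iter k smoothstep (2^-1 + (cos (lam * (y - c)) - cos (lam * a)) / 4).

Lemma trig_bump lam c a k i : trigfun (fun x => bump lam c a k (x i)).
Proof.
apply: trig_smoothstep; apply: trig_add; first exact: trig_cst.
have -> : (fun x => (cos (lam * (x i - c)) - cos (lam * a)) / 4) =
  (fun x => 4^-1 * (cos (linform [:: (lam, i)] x + (- (lam * c))) +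
                    (- cos (lam * a)))).
  by apply/funext => x; rewrite /linform big_seq1/= [in RHS]mulrC mulrBr.
by apply: trig_scale; apply: trig_add; [exact: trig_cos|exact: trig_cst].
Qed.

Lemma bump_itv lam c a k y : 0 <= bump lam c a k y <= 1.
Proof.
apply: iter_smoothstep_itv.
have := cos_le1 (lam * (y - c)); have := cos_geN1 (lam * (y - c)).
have := cos_le1 (lam * a); have := cos_geN1 (lam * a).
by move=> *; apply/andP; split; lra.
Qed.

Lemma bump_sandwich (lam c a b e : R) : 0 < lam -> 0 <= a < b ->
  lam * b < pi -> 0 < e ->
  exists k, forall y,
    (`|y - c| <= a -> 1 - e <= bump lam c ((a + b) / 2) k y) /\
    (b <= `|y - c| -> lam * `|y - c| <= pi -> bump lam c ((a + b) / 2) k y <= e).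
Proof.
move=> lam0 /andP[a0 ab] bpi e0.
pose h := (a + b) / 2.
(* With the threshold [h] strictly between [a] and [b], the argument is at least [1 - u1] inside
   radius [a] and at most [u2] beyond [b], where [u1] and [u2] are both below [1/2]. *)
have ah : a < h by rewrite /h; lra.
have hb : h < b by rewrite /h; lra.
have cmono y z : 0 <= y -> y <= z -> lam * z <= pi ->
    cos (lam * z) <= cos (lam * y).
  move=> y0 yz zpi; rewrite le_eqVlt; move: yz; rewrite le_eqVlt => /predU1P[->|yz].
    by rewrite eqxx.
  by rewrite ltr_cos ?ltr_pM2l ?yz ?orbT// in_itv/=; apply/andP; split; nra.
have ch : cos (lam * h) < cos (lam * a).
  by rewrite ltr_cos ?ltr_pM2l// in_itv/=; apply/andP; split; nra.
have cb : cos (lam * b) < cos (lam * h).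
  by rewrite ltr_cos ?ltr_pM2l// in_itv/=; apply/andP; split; nra.
pose u1 := 2^-1 - (cos (lam * a) - cos (lam * h)) / 4.
pose u2 := 2^-1 - (cos (lam * h) - cos (lam * b)) / 4.
have := cos_le1 (lam * a); have := cos_geN1 (lam * a).
have := cos_le1 (lam * h); have := cos_geN1 (lam * h).
have := cos_le1 (lam * b); have := cos_geN1 (lam * b) => *.
have ul0 : 0 <= Num.max u1 u2 by rewrite le_max; apply/orP; left; rewrite /u1; lra.
have ul1 : Num.max u1 u2 < 2^-1 by rewrite gt_max; apply/andP; split; rewrite /u1 /u2; lra.
have [|k kP] := @iter_smoothstep_small (Num.max u1 u2) e _ e0; first exact/andP.
exists k => y.
have cE : cos (lam * (y - c)) = cos (lam * `|y - c|).
  by rewrite -[LHS]cos_norm normrM (gtr0_norm lam0).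
have := cos_le1 (lam * `|y - c|); have := cos_geN1 (lam * `|y - c|) => *.
split=> [ya|by_ ypi]; rewrite /bump cE -/h.
- rewrite -[X in iter k _ X](subKr 1) iter_smoothstepB lerD2l lerN2.
  have ? : cos (lam * a) <= cos (lam * `|y - c|) by apply: cmono => //; nra.
  apply: kP; apply/andP; split; first by lra.
  by rewrite le_max; apply/orP; left; rewrite /u1; lra.
- have ? : cos (lam * `|y - c|) <= cos (lam * b) by apply: cmono => //; lra.
  apply: kP; apply/andP; split; first by lra.
  by rewrite le_max; apply/orP; right; rewrite /u2; lra.
Qed.

(** An entry [(i, (c, a))] confines coordinate [i] to the interval of center [c] and radius [a],
    enlarged by the common margin [eta]. A coordinate may occur repeatedly, so concatenating lists
    intersects boxes. *)
Definition in_boxes (J : seq (I * (R * R))) (eta : R) x : Prop :=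
  {in J, forall j, `|x j.1 - j.2.1| <= j.2.2 + eta}.

(** A product of bumps, one for each constraint. Bumps are periodic, so smallness off the box is
    claimed only within half a period of every center; mass farther out has to be controlled
    separately. *)
Lemma trig_sandwich J (eta lam e : R) : 0 < eta -> 0 < lam -> 0 < e ->
  {in J, forall j, 0 <= j.2.2 /\ lam * (j.2.2 + eta) < pi} ->
  exists F, [/\ trigfun F, (forall x, 0 <= F x <= 1),
    (forall x, in_boxes J 0 x -> 1 - e <= F x) &
    (forall x, ~ in_boxes J eta x ->
       {in J, forall j, lam * `|x j.1 - j.2.1| <= pi} -> F x <= e)].
Proof.
move=> eta0 lam0; elim: J e => [|[i [c a]] J IH] e e0 JP.
  exists (fun=> 1); split => //; first exact: trig_cst.
  - by move=> x; rewrite lexx ler01.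
  - by move=> x _; lra.
  - by move=> x [].
have [/= a0 api] := JP (i, (c, a)) (mem_head _ _).
have [|j jJ|F [tF F01 F1 F0]] := IH (e / 2); first by lra.
  by apply: JP; rewrite inE jJ orbT.
have [|||k kP] := @bump_sandwich lam c a (a + eta) (e / 2) lam0 => //; [lra|lra|].
exists (fun x => bump lam c ((a + (a + eta)) / 2) k (x i) * F x).
set b := bump _ _ _ _ in kP *.
have b01 y : 0 <= b y <= 1 by exact: bump_itv.
split.
- by apply: trig_mul => //; exact: trig_bump.
- by move=> x; have := b01 (x i); have := F01 x; move=> *; apply/andP; split; nra.
- move=> x xJ.
  have := b01 (x i); have := F01 x.
  have : 1 - e / 2 <= b (x i).
    by apply: (kP _).1; have := xJ _ (mem_head _ _); rewrite /= addr0.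
  have : 1 - e / 2 <= F x.
    by apply: F1 => j jJ; apply: xJ; rewrite inE jJ orbT.
  (* For [e <= 2] the product is at least [(1 - e / 2)^2 >= 1 - e]; for [e > 2] the claimed lower
     bound is negative. *)
  move: (b _) (F x) => p q; have [|] := leP e 2 => *; last by nra.
  nra.
- move=> x xJ xpi.
  have := b01 (x i); have := F01 x => F01x b01x.
  have [xi|xi] := leP (a + eta) `|x i - c|.
    have : b (x i) <= e / 2.
      by apply: (kP _).2 => //; exact: (xpi _ (mem_head _ _)).
    by nra.
  have : F x <= e / 2.
    apply: F0.
      apply: contra_not xJ => xJ j; rewrite inE => /predU1P[->/=|]; last exact: xJ.
      exact: ltW.
    by move=> j jJ; apply: xpi; rewrite inE jJ orbT.
  by nra.
Qed.

End trigonometric.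

(** * Expectations of bounded random variables *)

Section bounded_expectation.
Context {R : realType} {d} {Omega : measurableType d} (P : probability Omega R).

Lemma bounded_integrable (f : Omega -> R) (M : R) :
  measurable_fun setT f -> (forall w, `|f w| <= M) ->
  P.-integrable setT (EFin \o f).
Proof.
move=> mf fM; apply: measurable_bounded_integrable => //.
  exact: (le_lt_trans (probability_le1 P measurableT) (ltry _)).
by exists M; split=> [|x Mx w _ /=]; [exact: num_real|exact: le_trans (fM w) (ltW Mx)].
Qed.

Lemma fine_probE (A : set Omega) : measurable A -> (fine (P A))%:E = P A.
Proof. by move=> mA; rewrite fineK// fin_num_measure. Qed.

Lemma fine_probC (A : set Omega) : measurable A ->
  fine (P (~` A)) = 1 - fine (P A).
Proof. by move=> mA; apply: EFin_inj; rewrite EFinB !fine_probE ?probability_setC//; exact: measurableC. Qed.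

Lemma le_fine_prob (A B : set Omega) : measurable A -> measurable B ->
  A `<=` B -> fine (P A) <= fine (P B).
Proof. by move=> mA mB AB; rewrite -lee_fin !fine_probE// le_measure ?inE. Qed.

Lemma fine_probU (A B : set Omega) : measurable A -> measurable B ->
  fine (P (A `|` B)) <= fine (P A) + fine (P B).
Proof.
by move=> mA mB; rewrite -lee_fin EFinD !fine_probE ?measureU2//; exact: measurableU.
Qed.

Lemma Rintegral_indic (A : set Omega) : measurable A ->
  \int[P]_w \1_A w = fine (P A).
Proof. by move=> mA; rewrite /Rintegral integral_indic// setIT. Qed.

Lemma indic_integrable (A : set Omega) : measurable A ->
  P.-integrable setT (EFin \o (\1_A : Omega -> R)).
Proof.
move=> mA; apply: (@bounded_integrable _ 1) => // w.
by rewrite indicE; case: (_ \in _); rewrite ?normr0 ?normr1.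
Qed.

Lemma Rintegral_prob_cst (r : R) : \int[P]_w r = r.
Proof.
rewrite Rintegral_cst// -[RHS]mulr1; congr (_ * _).
exact: (congr1 fine (probability_setT P)).
Qed.

End bounded_expectation.

(** * Box probabilities and trigonometric expectations *)

Section trig_measurable.
Context {R : realType} {I : eqType} {d} {Omega : measurableType d}.
Variables (P : probability Omega R) (X : I -> Omega -> R).
Hypothesis mX : forall i, measurable_fun setT (X i).

Lemma measurable_linform (l : seq (R * I)) : measurable_fun setT (fun w => linform l (X^~ w)).
Proof. by apply: measurable_sum => p; exact: measurable_funM. Qed.

Lemma trigfun_measurable F : trigfun F -> measurable_fun setT (fun w => F (X^~ w)).
Proof.
elim=> {F} [l c|F G _ mF _ mG|a F _ mF].
- apply: (measurableT_comp (f := cos)); first exact: (continuous_measurable_fun (@continuous_cos R)).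
  by apply: measurable_funD => //; exact: measurable_linform.
- exact: measurable_funD.
- exact: measurable_funM.
Qed.

Lemma trigfun_bounded (F : (I -> R) -> R) : trigfun F -> exists M, forall x, `|F x| <= M.
Proof.
elim=> {F} [l c|F G _ [M MP] _ [N NP]|a F _ [M MP]].
- by exists 1 => x; exact: cos_max.
- by exists (M + N) => x; rewrite (le_trans (ler_normD _ _))// lerD.
- by exists (`|a| * M) => x; rewrite normrM ler_wpM2l.
Qed.

Lemma trigfun_integrable F : trigfun F ->
  P.-integrable setT (EFin \o (fun w => F (X^~ w))).
Proof.
move=> tF; have [M MP] := trigfun_bounded tF.
by apply: (@bounded_integrable _ _ _ _ _ M) => //; exact: trigfun_measurable.
Qed.

Definition box (J : seq (I * (R * R))) (eta : R) : set Omega :=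
  [set w | in_boxes J eta (X^~ w)].

Lemma box_measurable J eta : measurable (box J eta).
Proof.
elim: J => [|j J IH].
  by rewrite (_ : box _ _ = setT)//; apply/seteqP; split.
rewrite (_ : box _ _ = [set w | `|X j.1 w - j.2.1| <= j.2.2 + eta] `&` box J eta).
  apply: measurableI => //; rewrite -[X in measurable X]setTI.
  rewrite (_ : [set _ | _] = (fun w => `|X j.1 w - j.2.1|) @^-1` `]-oo, j.2.2 + eta]); last first.
    by apply/seteqP; split => w /=; rewrite in_itv.
  have mf : measurable_fun setT (fun w => `|X j.1 w - j.2.1|).
    by apply: measurableT_comp => //; exact: measurable_funB.
  exact: mf.
apply/seteqP; split => [w Jw|w [jw Jw] i]; last first.
  by rewrite inE => /predU1P[->//|]; exact: Jw.
by split=> [|i iJ]; apply: Jw; rewrite inE ?eqxx ?iJ ?orbT.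
Qed.

(** With all radii set to 0 the margin takes over their role: [box (centers J) K] is the window of
    points within [K] of every center, where periodicity does no harm. *)
Definition centers (J : seq (I * (R * R))) := [seq (j.1, (j.2.1, 0 : R)) | j <- J].

Lemma box_centers_cvg J (e : R) : 0 < e ->
  \forall K \near +oo, 1 - e <= fine (P (box (centers J) K)).
Proof.
move=> e0; pose F n := box (centers J) n%:R.
have ndF : nondecreasing_seq F.
  move=> m n mn; apply/subsetPset => w Fw j jJ; apply: le_trans (Fw _ jJ) _.
  by rewrite lerD2l ler_nat.
have FT : \bigcup_n F n = setT.
  apply/seteqP; split => // w _; rewrite /F /box /centers.
  elim: J {F ndF} => [|j J [n _ nP]]; first by exists 0%N.
  have [m mP] : exists m : nat, `|X j.1 w - j.2.1| <= m%:R.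
    by exists (Num.truncn `|X j.1 w - j.2.1|).+1; rewrite ltW// truncnS_gt.
  exists (maxn m n) => // i; rewrite inE => /predU1P[->/=|iJ].
    by rewrite add0r (le_trans mP)// ler_nat leq_maxl.
  by rewrite (le_trans (nP i iJ))// lerD2l ler_nat leq_maxr.
have /fine_cvgP[_] : P \o F @ \oo --> 1%:E.
  rewrite -(probability_setT P) -FT; apply: nondecreasing_cvg_mu => //.
    by move=> i; exact: box_measurable.
  by apply: bigcup_measurable => i _; exact: box_measurable.
have e1 : 1 - e < 1 by lra.
move=> /cvgr_ge /(_ _ e1) [n _ nP].
near=> K; apply: le_trans (nP n (leqnn n)) _ => /=.
apply: le_fine_prob; [exact: box_measurable|exact: box_measurable|].
move=> w Fw j jJ; apply: le_trans (Fw _ jJ) _.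
by rewrite lerD2l; near: K; apply: nbhs_pinfty_ge; rewrite num_real.
Unshelve. all: by end_near. Qed.

Lemma box_eta_cvg J z : (forall eta, 0 < eta -> z <= fine (P (box J eta))) ->
  z <= fine (P (box J 0)).
Proof.
move=> zJ; pose F n := box J n.+1%:R^-1.
have niF : nonincreasing_seq F.
  move=> m n mn; apply/subsetPset => w Fw j jJ; apply: le_trans (Fw _ jJ) _.
  by rewrite lerD2l lef_pV2 ?posrE// ler_nat.
have FT : \bigcap_n F n = box J 0.
  apply/seteqP; split=> [w Fw j jJ|w Jw n _ j jJ]; last first.
    by apply: le_trans (Jw _ jJ) _; rewrite lerD2l.
  rewrite addr0; apply/ler_addgt0Pr => e e0.
  have [n ne] : exists n, n.+1%:R^-1 < e.
    exists (Num.truncn e^-1); rewrite -[ltRHS]invrK ltf_pV2 ?posrE// ?invr_gt0//.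
    exact: truncnS_gt.
  by apply: le_trans (Fw n Logic.I _ jJ) _; rewrite lerD2l ltW.
have /fine_cvgP[_] : P \o F @ \oo --> (fine (P (box J 0)))%:E.
  rewrite fine_probE; last exact: box_measurable.
  rewrite -FT; apply: nonincreasing_cvg_mu => //.
  - by rewrite (le_lt_trans (probability_le1 _ _)) ?ltry//; exact: box_measurable.
  - by move=> i; exact: box_measurable.
  - by rewrite FT; exact: box_measurable.
by move=> /cvgr_to_ge; apply; near=> n; apply: zJ.
Unshelve. all: by end_near. Qed.

Lemma trig_integral_ge J F e : trigfun F -> (forall x, 0 <= F x <= 1) -> 0 <= e ->
  (forall x, in_boxes J 0 x -> 1 - e <= F x) ->
  fine (P (box J 0)) - e <= \int[P]_w F (X^~ w).
Proof.
move=> tF F01 e0 F1; have mb := box_measurable J 0.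
rewrite -(Rintegral_indic P mb) -[X in _ - X](Rintegral_prob_cst P) -RintegralB//; last 2 first.
- exact: indic_integrable.
- by apply: (@bounded_integrable _ _ _ _ _ `|e|).
apply: le_Rintegral => //; last 2 first.
- exact: trigfun_integrable.
- move=> w _; have /andP[F0 _] := F01 (X^~ w).
  rewrite indicE; case: (boolP (w \in box J 0)) => [|_]; last by rewrite sub0r (le_trans _ F0)// oppr_le0.
  by rewrite inE => /F1.
- rewrite (_ : _ \o _ = (EFin \o (\1_(box J 0) : Omega -> R)) \- (EFin \o cst e))%E//.
  by apply: integrableB => //; [exact: indic_integrable|exact: (@bounded_integrable _ _ _ _ _ `|e|)].
Qed.

(** Three regions: on the box and outside the window [F] is at most 1, and in the window off the box
    it is at most [e]. *)
Lemma trig_integral_le J F eta K e : trigfun F -> (forall x, 0 <= F x <= 1) -> 0 <= e ->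
  (forall x, ~ in_boxes J eta x -> in_boxes (centers J) K x -> F x <= e) ->
  \int[P]_w F (X^~ w) <= fine (P (box J eta)) + e + (1 - fine (P (box (centers J) K))).
Proof.
move=> tF F01 e0 F0; have mb := box_measurable J eta.
have mc := box_measurable (centers J) K.
rewrite -(fine_probC P mc) -(Rintegral_indic P mb) -(Rintegral_indic P (measurableC mc)).
rewrite -[X in _ + X + _](Rintegral_prob_cst P).
have i1 := indic_integrable P mb; have i2 := indic_integrable P (measurableC mc).
have i3 : P.-integrable setT (EFin \o (fun=> e : R)).
  by apply: (@bounded_integrable _ _ _ _ _ `|e|).
have i12 : P.-integrable setT (EFin \o (fun w => \1_(box J eta) w + e)).
  rewrite (_ : _ \o _ = (EFin \o (\1_(box J eta) : Omega -> R)) \+ (EFin \o cst e))%E//.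
  exact: integrableD.
rewrite -RintegralD// -RintegralD//.
apply: le_Rintegral => //.
- exact: trigfun_integrable.
- rewrite (_ : _ \o _ = (EFin \o (fun w => (\1_(box J eta) w : R) + e)%R) \+
     (EFin \o (\1_(~` box (centers J) K) : Omega -> R)))%E//.
  exact: integrableD.
- move=> w _; have /andP[_ F1] := F01 (X^~ w).
  rewrite !indicE; case: (boolP (w \in box J eta)) => [_|/negP].
    by rewrite -addrA (le_trans F1)// lerDl addr_ge0.
  rewrite inE => wJ; case: (boolP (w \in ~` _)) => [_|/negP].
    by rewrite add0r (le_trans F1)// lerDr.
  rewrite inE notK => wC; rewrite add0r addr0.
  exact: F0.
Qed.

End trig_measurable.

(** * Limits of box probabilities *)

Section trig_limits.
Context {R : realType} {I : eqType} {d} {Omega : measurableType d}.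
Variables (P : probability Omega R) (X : I -> Omega -> R).
Hypothesis mX : forall i, measurable_fun setT (X i).
Variables (dn : nat -> measure_display) (On : forall n, measurableType (dn n)).
Variables (Pn : forall n, probability (On n) R) (Xn : forall n : nat, I -> On n -> R).
Arguments Xn : clear implicits.
Hypothesis mXn : forall n i, measurable_fun setT (Xn n i).
Hypothesis cosX : forall (l : seq (R * I)) c,
  \int[Pn n]_w cos (linform l (Xn n ^~ w) + c) @[n --> \oo] -->
  \int[P]_w cos (linform l (X ^~ w) + c).

Lemma trigfun_cvg F : trigfun F ->
  \int[Pn n]_w F (Xn n ^~ w) @[n --> \oo] --> \int[P]_w F (X ^~ w).
Proof.
elim=> {F} [l c|F G tF IF tG IG|a F tF IF]; first exact: cosX.
- rewrite RintegralD//; [|exact: trigfun_integrable|exact: trigfun_integrable].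
  rewrite (_ : (fun n => _) = (fun n => \int[Pn n]_w F (Xn n ^~ w)) \+
    (fun n => \int[Pn n]_w G (Xn n ^~ w))); first exact: cvgD.
  by apply/funext => n; rewrite RintegralD//; exact: trigfun_integrable.
- rewrite RintegralZl//; [|exact: trigfun_integrable].
  rewrite (_ : (fun n => _) = (fun n => a * \int[Pn n]_w F (Xn n ^~ w))).
    exact: (cvgM (cvg_cst a) IF).
  by apply/funext => n; rewrite RintegralZl//; exact: trigfun_integrable.
Qed.

Implicit Types J : seq (I * (R * R)).

Let sandwich J eta K e : 0 < eta -> 0 < K -> 0 < e ->
  {in J, forall j, 0 <= j.2.2 /\ j.2.2 + eta < K} ->
  exists F : (I -> R) -> R, [/\ trigfun F, (forall x, 0 <= F x <= 1),
    (forall x, in_boxes J 0 x -> 1 - e <= F x) &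
    (forall x, ~ in_boxes J eta x -> in_boxes (centers J) K x -> F x <= e)].
Proof.
move=> eta0 K0 e0 JP; have p0 := pi_gt0 R.
(* At frequency [pi / K] half a period is exactly the radius [K] of the window. *)
have [||j jJ|F [tF F01 F1 F0]] := @trig_sandwich R I J eta (pi / K) e eta0; rewrite ?divr_gt0//.
  by have [? jK] := JP j jJ; split=> //; rewrite mulrAC -mulrA gtr_pMr// ltr_pdivrMr ?mul1r.
exists F; split=> // x xJ xC; apply: F0 => // j jJ.
rewrite mulrAC -mulrA ger_pMr// ler_pdivrMr ?mul1r//.
have /= := xC (j.1, (j.2.1, 0)) _; rewrite add0r; apply.
by apply/mapP; exists j.
Qed.

Let large_radius J eta : exists K0 : R, 0 < K0 /\
  forall K, K0 <= K -> {in J, forall j, j.2.2 + eta < K}.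
Proof.
elim: J => [|j J [K0 [K0p IH]]]; first by exists 1; split.
exists (Num.max K0 (`|j.2.2 + eta| + 1)); split; first by rewrite lt_max K0p.
move=> K; rewrite ge_max => /andP[/IH K1 K2] i; rewrite inE => /predU1P[->|/K1//].
by rewrite (le_lt_trans (ler_norm _))// (lt_le_trans _ K2)// ltrDl.
Qed.

(** Here the window is needed for the limit law only, where continuity from below provides it; the
    laws [Pn] enter through the pointwise bound [1 - e <= F] on the box. *)
Lemma prob_box_limit_ge J eta z : 0 < eta -> {in J, forall j, 0 <= j.2.2} ->
  (\forall n \near \oo, z <= fine (Pn n (box (Xn n) J 0))) ->
  z <= fine (P (box X J eta)).
Proof.
move=> eta0 J0 zP; apply/ler_addgt0Pr => e e0.
have e3 : 0 < e / 3 by lra.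
have [K0 [K0p K0P]] := large_radius J eta.
have [K [KK0 KP]] : exists K, K0 <= K /\ 1 - e / 3 <= fine (P (box X (centers J) K)).
  near (+oo_R) => K; exists K; split.
    by near: K; apply: nbhs_pinfty_ge; rewrite num_real.
  by near: K; exact: box_centers_cvg.
have [|j jJ|F [tF F01 F1 F0]] := @sandwich J eta K (e / 3) eta0 _ e3.
- exact: lt_le_trans K0p KK0.
- by split; [exact: J0|exact: K0P].
have zF : z - e / 3 <= \int[P]_w F (X^~ w).
  apply: cvgr_to_ge (trigfun_cvg tF) _; near=> n.
  rewrite (@le_trans _ _ (fine (Pn n (box (Xn n) J 0)) - e / 3))//.
    by rewrite lerD2r; near: n.
  by apply: trig_integral_ge => //; exact: ltW.
have := @trig_integral_le _ _ _ _ P X mX J F eta K (e / 3) tF F01 (ltW e3) F0.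
by lra.
Unshelve. all: by end_near. Qed.

(** Now the window must carry most of the mass of [Xn] for all large [n], which convergence at a
    single frequency does not give; hence the tightness hypothesis. *)
Lemma prob_box_limit_le J eta z : 0 < eta -> {in J, forall j, 0 <= j.2.2} ->
  (forall e, 0 < e -> \forall K \near +oo, \forall n \near \oo,
     1 - e <= fine (Pn n (box (Xn n) (centers J) K))) ->
  (\forall n \near \oo, fine (Pn n (box (Xn n) J eta)) <= z) ->
  fine (P (box X J 0)) <= z.
Proof.
move=> eta0 J0 tightn zP; apply/ler_addgt0Pr => e e0.
have e3 : 0 < e / 3 by lra.
have [K0 [K0p K0P]] := large_radius J eta.
have [K [KK0 KP]] : exists K, K0 <= K /\ \forall n \near \oo,
     1 - e / 3 <= fine (Pn n (box (Xn n) (centers J) K)).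
  near (+oo_R) => K; exists K; split.
    by near: K; apply: nbhs_pinfty_ge; rewrite num_real.
  by near: K; exact: tightn.
have [|j jJ|F [tF F01 F1 F0]] := @sandwich J eta K (e / 3) eta0 _ e3.
- exact: lt_le_trans K0p KK0.
- by split; [exact: J0|exact: K0P].
have zF : \int[P]_w F (X^~ w) <= z + e / 3 + e / 3.
  apply: cvgr_to_le (trigfun_cvg tF) _; near=> n.
  have := @trig_integral_le _ _ _ _ (Pn n) (Xn n) (@mXn n) J F eta K (e / 3)
    tF F01 (ltW e3) F0.
  have : fine (Pn n (box (Xn n) J eta)) <= z by near: n.
  have : 1 - e / 3 <= fine (Pn n (box (Xn n) (centers J) K)) by near: n.
  by lra.
have := trig_integral_ge P mX tF F01 (ltW e3) F1.
by lra.
Unshelve. all: by end_near. Qed.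

End trig_limits.

Section trig_uniqueness.
Context {R : realType} {I : eqType}.
Implicit Types J : seq (I * (R * R)).

(** Each inequality is the lower limit bound applied to a constant sequence of laws, after which the
    margin [eta] shrinks to 0 by continuity from above. *)
Lemma prob_box_unique {d} {Omega : measurableType d} (P : probability Omega R)
    (X : I -> Omega -> R) {d'} {Omega' : measurableType d'}
    (P' : probability Omega' R) (X' : I -> Omega' -> R) J :
  (forall i, measurable_fun setT (X i)) -> (forall i, measurable_fun setT (X' i)) ->
  (forall (l : seq (R * I)) c, \int[P]_w cos (linform l (X ^~ w) + c) =
                \int[P']_w cos (linform l (X' ^~ w) + c)) ->
  {in J, forall j, 0 <= j.2.2} ->
  P (box X J 0) = P' (box X' J 0).
Proof.
have half d1 (O1 : measurableType d1) (P1 : probability O1 R) (X1 : I -> O1 -> R)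
    d2 (O2 : measurableType d2) (P2 : probability O2 R) (X2 : I -> O2 -> R) :
    (forall i, measurable_fun setT (X1 i)) -> (forall i, measurable_fun setT (X2 i)) ->
    (forall (l : seq (R * I)) c, \int[P1]_w cos (linform l (X1 ^~ w) + c) =
                  \int[P2]_w cos (linform l (X2 ^~ w) + c)) ->
    {in J, forall j, 0 <= j.2.2} ->
    fine (P1 (box X1 J 0)) <= fine (P2 (box X2 J 0)).
  move=> mX1 mX2 E J0; apply: box_eta_cvg => // eta eta0.
  have cvgE l c : \int[P1]_w cos (linform l (X1 ^~ w) + c) @[_ --> \oo] -->
      \int[P2]_w cos (linform l (X2 ^~ w) + c) by rewrite E; exact: cvg_cst.
  have H := @prob_box_limit_ge _ _ _ _ P2 X2 mX2 (fun=> d1) (fun=> O1) (fun=> P1)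
    (fun=> X1) (fun=> mX1) cvgE J eta (fine (P1 (box X1 J 0))) eta0 J0.
  by apply: H; exact: nearW.
move=> mX mX' E J0; rewrite -(fine_probE P (box_measurable mX J 0)).
rewrite -(fine_probE P' (box_measurable mX' J 0)).
by congr EFin; apply/eqP; rewrite eq_le; apply/andP; split; exact: half.
Qed.

End trig_uniqueness.

(** * Sums of heavy-tailed jumps *)

Section product_probability.
Local Open Scope ereal_scope.
Context {d1 d2} {T1 : measurableType d1} {T2 : measurableType d2} {R : realType}.
Variables (P1 : probability T1 R) (P2 : probability T2 R).

Definition product_prob : set (T1 * T2) -> \bar R := P1 \x P2.

HB.instance Definition _ := Measure.on product_prob.

Let product_prob_setT : product_prob setT = 1.
Proof.
rewrite /product_prob -setXTT product_measure1E//.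
by rewrite [X in X * _](probability_setT P1) [X in _ * X](probability_setT P2) mule1.
Qed.

HB.instance Definition _ :=
  Measure_isProbability.Build _ _ _ product_prob product_prob_setT.

Lemma product_prob_integral (f : T1 * T2 -> R) (M : R) :
  measurable_fun setT f -> (forall z, `|f z| <= M)%R ->
  (\int[product_prob]_z f z = \int[P1]_x (\int[P2]_y f (x, y)))%R.
Proof.
move=> mf fM.
have := @integral12_prod_meas1 _ _ T1 T2 R P1 P2 (EFin \o f) (bounded_integrable product_prob mf fM).
rewrite /Rintegral /product_prob => <-; congr fine; apply: eq_integral => x _.
rewrite /fubini_F fineK//=; apply: integrable_fin_num => //.
apply: (@bounded_integrable _ _ _ _ _ M) => [|y]; last exact: fM.
exact: measurableT_comp.
Qed.

Lemma product_prob_integralM (f : T1 -> R) (g : T2 -> R) (M N : R) :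
  measurable_fun setT f -> (forall x, `|f x| <= M)%R ->
  measurable_fun setT g -> (forall x, `|g x| <= N)%R ->
  (\int[product_prob]_z (f z.1 * g z.2) = \int[P1]_x f x * \int[P2]_y g y)%R.
Proof.
move=> mf fM mg gN; rewrite (@product_prob_integral _ (M * N)).
- rewrite -RintegralZr//; last exact: (bounded_integrable _ mf fM).
  apply: eq_Rintegral => x _ /=; rewrite RintegralZl//.
  exact: (bounded_integrable _ mg gN).
- by apply: measurable_funM; apply: measurableT_comp.
- by move=> z; rewrite normrM ler_pM.
Qed.

End product_probability.

(** * Independent samples as iterated products *)

Section iid_sample.
Context {R : realType} {d} {T : measurableType d} (Q : probability T R).

(* The types of the iterated products carry different displays, hence the packaging. *)
Record pspace := PSpace {
  ps_disp : measure_display;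
  ps_sort : measurableType ps_disp;
  ps_prob : probability ps_sort R }.

Fixpoint sample n : pspace :=
  if n is n'.+1 then PSpace (product_prob Q (ps_prob (sample n')))
  else PSpace (\d_ tt : probability unit R).

Fixpoint draws n : ps_sort (sample n) -> seq T :=
  if n is n'.+1 then fun w => w.1 :: draws w.2 else fun=> [::].

Local Notation "'P_ n" := (ps_prob (sample n)) (at level 0, n at level 2).

Lemma size_draws n (w : ps_sort (sample n)) : size (draws w) = n.
Proof. by elim: n w => //= n IH w; rewrite IH. Qed.

Lemma measurable_draws_sum n (h : T -> R) : measurable_fun setT h ->
  measurable_fun setT (fun w : ps_sort (sample n) => \sum_(v <- draws w) h v : R).
Proof.
move=> mh; elim: n => [|n IH] /=.
  by under eq_fun do rewrite big_nil; exact: measurable_cst.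
under eq_fun do rewrite big_cons.
apply: measurable_funD; first exact: measurableT_comp.
exact: (measurableT_comp IH).
Qed.

Lemma measurable_draws_prod n (h : T -> R) : measurable_fun setT h ->
  measurable_fun setT (fun w : ps_sort (sample n) => \prod_(v <- draws w) h v : R).
Proof.
move=> mh; elim: n => [|n IH] /=.
  by under eq_fun do rewrite big_nil; exact: measurable_cst.
under eq_fun do rewrite big_cons.
apply: measurable_funM; first exact: measurableT_comp.
exact: (measurableT_comp IH).
Qed.

Lemma draws_sum_bounded n (h : T -> R) (M : R) : (forall v, `|h v : R| <= M) ->
  forall w : ps_sort (sample n), `|\sum_(v <- draws w) h v| <= M *+ n.
Proof.
move=> hM; elim: n => [|n IH] w /=; first by rewrite big_nil normr0 mulr0n.
by rewrite big_cons mulrS (le_trans (ler_normD _ _))// lerD.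
Qed.

Lemma draws_prod_bounded n (h : T -> R) : (forall v, `|h v : R| <= 1) ->
  forall w : ps_sort (sample n), `|\prod_(v <- draws w) h v| <= 1.
Proof.
move=> hM; elim: n => [|n IH] w /=; first by rewrite big_nil normr1.
by rewrite big_cons normrM mulr_ile1.
Qed.

Lemma expectation_draws_prod n (h : T -> R) : measurable_fun setT h -> (forall v, `|h v : R| <= 1) ->
  \int['P_ n]_w \prod_(v <- draws w) h v = (\int[Q]_v h v) ^+ n.
Proof.
move=> mh h1; elim: n => [|n IH].
  by under eq_Rintegral do rewrite big_nil; rewrite Rintegral_prob_cst expr0.
under eq_Rintegral do rewrite big_cons.
rewrite (product_prob_integralM Q 'P_ n (M := 1) (N := 1) mh h1
  (@measurable_draws_prod n h mh) (@draws_prod_bounded n h h1)).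
by rewrite exprS IH.
Qed.

Lemma expectation_draws_sum n (h : T -> R) (M : R) : measurable_fun setT h -> (forall v, `|h v : R| <= M) ->
  \int['P_ n]_w \sum_(v <- draws w) h v = (\int[Q]_v h v) *+ n.
Proof.
move=> mh hM; elim: n => [|n IH].
  by under eq_Rintegral do rewrite big_nil; rewrite Rintegral_prob_cst mulr0n.
under eq_Rintegral do rewrite big_cons.
have mS := @measurable_draws_sum n h mh.
have bS := @draws_sum_bounded n h M hM.
have H1 := product_prob_integralM Q 'P_ n mh hM (measurable_cst (1 : R)) (fun=> lexx `|1|).
have H2 := product_prob_integralM Q 'P_ n (measurable_cst (1 : R)) (fun=> lexx `|1|) mS bS.
rewrite RintegralD//.
- rewrite /= in H1 H2.
  rewrite mulrS; congr (_ + _).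
    rewrite -[RHS]mulr1 -[X in _ * X](Rintegral_prob_cst 'P_ n) -[RHS]H1.
    by apply: eq_Rintegral => w _; rewrite mulr1.
  rewrite -IH -[RHS]mul1r -[X in X * _](Rintegral_prob_cst Q) -[RHS]H2.
  by apply: eq_Rintegral => w _; rewrite mul1r.
- apply: (@bounded_integrable _ _ _ _ _ M) => [|w]; last exact: hM.
  exact: measurableT_comp.
- apply: (@bounded_integrable _ _ _ _ _ (M *+ n)) => [|w]; last exact: bS.
  exact: (measurableT_comp mS).
Qed.

(** The [n] diagonal pairs give second moments; by independence each of the [n (n - 1)] off-diagonal
    pairs gives the squared mean. *)
Lemma expectation_draws_sqr n (h : T -> R) (M : R) : measurable_fun setT h -> (forall v, `|h v : R| <= M) ->
  \int['P_ n]_w (\sum_(v <- draws w) h v) ^+ 2 =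
  (\int[Q]_v (h v) ^+ 2) *+ n + (\int[Q]_v h v) ^+ 2 *+ (n * n.-1).
Proof.
move=> mh hM; elim: n => [|n IH].
  under eq_Rintegral do rewrite big_nil expr0n.
  by rewrite Rintegral_prob_cst !mulr0n addr0.
have mS := @measurable_draws_sum n h mh.
have bS := @draws_sum_bounded n h M hM.
have mh2 : measurable_fun setT (fun v => h v ^+ 2) by exact: measurable_funX.
have hM2 v : `|h v ^+ 2| <= M ^+ 2 by rewrite normrX lerXn2r// ?nnegrE// (le_trans _ (hM v)).
have mS2 : measurable_fun setT (fun w => (\sum_(v <- @draws n w) h v) ^+ 2) by exact: measurable_funX.
have bS2 (w : ps_sort (sample n)) : `|(\sum_(v <- draws w) h v) ^+ 2| <= (M *+ n) ^+ 2.
  by rewrite normrX lerXn2r// ?nnegrE// (le_trans _ (bS w)).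
have H1 := product_prob_integralM Q 'P_ n mh2 hM2 (measurable_cst (1 : R)) (fun=> lexx `|1|).
have H2 := product_prob_integralM Q 'P_ n (measurable_cst (1 : R)) (fun=> lexx `|1|) mS2 bS2.
have H3 := product_prob_integralM Q 'P_ n mh hM mS bS.
rewrite /= in H1 H2 H3.
pose S (w : ps_sort (sample n)) := \sum_(v <- draws w) h v.
transitivity (\int[product_prob Q 'P_ n]_w (h w.1 ^+ 2 * 1 + 1 * S w.2 ^+ 2 + 2 * (h w.1 * S w.2))).
  by apply: eq_Rintegral => w _; rewrite /= big_cons -/(S _); ring.
have i1 : (product_prob Q 'P_ n).-integrable setT (EFin \o (fun w => h w.1 ^+ 2 * 1)).
  apply: (@bounded_integrable _ _ _ _ _ (M ^+ 2)) => [|w]; last by rewrite mulr1 hM2.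
  by apply: measurable_funM => //; exact: measurableT_comp mh2 _.
have i2 : (product_prob Q 'P_ n).-integrable setT (EFin \o (fun w => 1 * S w.2 ^+ 2)).
  apply: (@bounded_integrable _ _ _ _ _ ((M *+ n) ^+ 2)) => [|w]; last by rewrite mul1r bS2.
  by apply: measurable_funM => //; exact: measurableT_comp mS2 _.
have i3 : (product_prob Q 'P_ n).-integrable setT (EFin \o (fun w => h w.1 * S w.2)).
  apply: (@bounded_integrable _ _ _ _ _ (M * (M *+ n))) => [|w].
    by apply: measurable_funM => //; [exact: measurableT_comp mh _|exact: measurableT_comp mS _].
  by rewrite normrM ler_pM// bS.
rewrite RintegralD//; last 2 first.
- exact: (integrableD measurableT i1 i2).
- exact: (integrableZl measurableT 2 i3).
rewrite RintegralD// [X in _ + X]RintegralZl//.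
rewrite [X in X + _ + _]H1 [X in _ + X + _]H2 [X in _ + _ * X]H3 !Rintegral_prob_cst.
rewrite IH (expectation_draws_sum _ mh hM) mulr1 mul1r.
set a := \int[Q]_v h v ^+ 2; set b := \int[Q]_v h v.
have -> : (n.+1 * n.+1.-1 = n * n.-1 + 2 * n)%N by case: (n) => // k /=; rewrite [(k.+1 * k)%N]mulnC -mulnDl addn2.
rewrite mulrnDr -(mulr_natl b n) -(mulr_natl _ (2 * n)) natrM.
by ring.
Qed.

(** A vanishing sine integral makes the characteristic function real, hence a pure power. The sine
    of the sum is carried through the induction because the addition formula for the cosine involves
    it. *)
Lemma expectation_draws_cos n (h : T -> R) : measurable_fun setT h -> \int[Q]_v sin (h v) = 0 ->
  \int['P_ n]_w cos (\sum_(v <- draws w) h v) = (\int[Q]_v cos (h v)) ^+ n /\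
  \int['P_ n]_w sin (\sum_(v <- draws w) h v) = 0.
Proof.
move=> mh h0; elim: n => [|n [IHc IHs]].
  split; under eq_Rintegral do rewrite big_nil ?cos0 ?sin0.
    by rewrite Rintegral_prob_cst expr0.
  by rewrite Rintegral_prob_cst.
have mc : measurable_fun setT (@cos R) by exact: (continuous_measurable_fun (@continuous_cos R)).
have ms : measurable_fun setT (@sin R) by exact: (continuous_measurable_fun (@continuous_sin R)).
have mS := @measurable_draws_sum n h mh.
pose S (w : ps_sort (sample n)) := \sum_(v <- draws w) h v.
have mhc := measurableT_comp mc mh; have mhs := measurableT_comp ms mh.
have mSc := measurableT_comp mc mS; have mSs := measurableT_comp ms mS.
have c1 (x : R) := cos_max x; have s1 (x : R) := sin_max x.
have int2 (f g : R -> R) (u v : ps_sort (sample n.+1) -> R) :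
    measurable_fun setT (f \o u) -> measurable_fun setT (g \o v) -> (forall x, `|f x| <= 1) -> (forall x, `|g x| <= 1) ->
    (product_prob Q 'P_ n).-integrable setT (EFin \o (fun w => f (u w) * g (v w))).
  move=> mf mg f1 g1; apply: (@bounded_integrable _ _ _ _ _ 1) => [|w].
    exact: measurable_funM.
  by rewrite normrM mulr_ile1.
have m1 (f : R -> R) : measurable_fun setT f -> measurable_fun setT (f \o (fun w : ps_sort (sample n.+1) => h w.1)).
  by move=> mf; apply: measurableT_comp => //; exact: measurableT_comp mh _.
have m2 (f : R -> R) : measurable_fun setT f -> measurable_fun setT (f \o (fun w : ps_sort (sample n.+1) => S w.2)).
  by move=> mf; apply: measurableT_comp => //; exact: measurableT_comp mS _.
split; under eq_Rintegral do rewrite /= big_cons.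
- under eq_Rintegral do rewrite cosD.
  rewrite RintegralB//; [|by apply: int2 => //; [exact: m1|exact: m2]..].
  rewrite (product_prob_integralM Q 'P_ n mhc (fun=> c1 _) mSc (fun=> c1 _)).
  rewrite (product_prob_integralM Q 'P_ n mhs (fun=> s1 _) mSs (fun=> s1 _)).
  by rewrite exprS -IHc [X in _ - X * _]h0 mul0r subr0.
- under eq_Rintegral do rewrite sinD.
  rewrite RintegralD//; [|by apply: int2 => //; [exact: m1|exact: m2]..].
  rewrite (product_prob_integralM Q 'P_ n mhs (fun=> s1 _) mSc (fun=> c1 _)).
  rewrite (product_prob_integralM Q 'P_ n mhc (fun=> c1 _) mSs (fun=> s1 _)).
  by rewrite [X in X * _]h0 mul0r add0r [X in _ * X]IHs mulr0.
Qed.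

End iid_sample.

(** * Scaling and reflection of Lebesgue measure *)

Section lebesgue_scaling.
Context {R : realType}.
Local Notation mu := (@lebesgue_measure R).
Local Open Scope ereal_scope.

Lemma lebesgue_measure_scale (a : R) (A : set R) : (0 < a)%R -> measurable A ->
  mu A = a%:E * mu ((fun v => a * v)%R @^-1` A).
Proof.
move=> a0 mA; pose f : measurableTypeR R -> measurableTypeR R := fun v => (a * v)%R.
have mf : measurable_fun setT f by exact: measurable_funM.
pose nu : {measure set (measurableTypeR R) -> \bar R} := mscale (NngNum (ltW a0))
  (measure_function_pushforward__canonical__measure_function_Measure mu mf).
apply: (@lebesgue_measure_unique R nu) => //= _ [[x y] _ <-].
rewrite /nu /mscale/= /pushforward.
rewrite (_ : f @^-1` _ = `](x / a)%R, (y / a)%R]%classic); last first.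
  apply/seteqP; split => v /=; rewrite !in_itv/= /f => /andP[xv vy];
    by rewrite ?ltr_pdivrMr ?ler_pdivlMr//; rewrite ?ltr_pdivrMr ?ler_pdivlMr// in xv vy;
       rewrite ?(mulrC v) ?xv// 1?mulrC ?xv//.
rewrite !lebesgue_measure_itv/= !lte_fin ltr_pM2r ?invr_gt0//.
case: ifPn => _; last by rewrite mule0.
by rewrite -EFinB -EFinM -mulrBl mulrC divfK// gt_eqF.
Qed.

Lemma ge0_integral_scale (a : R) (f : R -> \bar R) : (0 < a)%R ->
  measurable_fun setT f -> (forall v, 0 <= f v) ->
  \int[mu]_v f v = a%:E * \int[mu]_v f (a * v)%R.
Proof.
move=> a0 mf f0; pose g : measurableTypeR R -> measurableTypeR R := fun v => (a * v)%R.
have mg : measurable_fun setT g by exact: measurable_funM.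
have := @ge0_integral_pushforward _ _ _ _ R g mg mu setT f measurableT mf (fun y _ => f0 y).
rewrite preimage_setT => <-.
rewrite -[a]/((NngNum (ltW a0))%:num) -ge0_integral_mscale//.
by apply: eq_measure_integral => A mA _; exact: lebesgue_measure_scale.
Qed.

Lemma ge0_integral_opp (f : R -> \bar R) :
  measurable_fun setT f -> (forall v, 0 <= f v) ->
  \int[mu]_v f v = \int[mu]_v f (- v)%R.
Proof.
move=> mf f0; pose g : measurableTypeR R -> measurableTypeR R := -%R.
have mg : measurable_fun setT g by exact: measurable_funN.
have := @ge0_integral_pushforward _ _ _ _ R g mg mu setT f measurableT mf (fun y _ => f0 y).
rewrite preimage_setT => <-.
by apply: eq_measure_integral => A mA _; rewrite [RHS]lebesgue_measureN.
Qed.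

End lebesgue_scaling.

(** * The Levy measure of the jumps *)

Section levy_measure.
Context {R : realType}.
Variables (alpha : R).
Hypothesis alpha0 : 0 < alpha.
Local Notation mu := (@lebesgue_measure R).

(* The image of Lebesgue measure under [v |-> sgn v * |v|^(-1/alpha)] is a multiple of
   the Levy measure [|x|^(-1-alpha) dx] of symmetric alpha-stable laws. *)
Definition jump (v : R) : R :=
  if 0 <= v then `|v| `^ (- alpha^-1) else - `|v| `^ (- alpha^-1).

Lemma ltr_powR2 (r x y : R) : 0 < r -> 0 <= x -> 0 <= y ->
  (x `^ r < y `^ r) = (x < y).
Proof.
move=> r0 x0 y0; apply/idP/idP => [|xy]; last exact: gt0_ltr_powR.
by apply: contraTT; rewrite -!leNgt => yx; apply: ge0_ler_powR => //; exact: ltW.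
Qed.

Lemma jumpN v : jump (- v) = - jump v.
Proof.
have [->|v0] := eqVneq v 0.
  by rewrite oppr0 /jump lexx normr0 powR0 ?oppr0// oppr_eq0 invr_eq0 gt_eqF.
rewrite /jump normrN oppr_ge0; move: v0; rewrite neq_lt => /orP[v0|v0].
  by rewrite (ltW v0) [0 <= v]leNgt v0/= opprK.
by rewrite (ltW v0) [v <= 0]leNgt v0.
Qed.

Lemma normr_jump v : `|jump v| = `|v| `^ (- alpha^-1).
Proof.
by rewrite /jump; case: ifPn => _; rewrite ?normrN ger0_norm// powR_ge0.
Qed.

(** Self-similarity: scaling a jump by [a] amounts to scaling Lebesgue measure by [a^alpha]. This is
    how [|c s|^alpha] arises when a kernel [c] multiplies the jumps. *)
Lemma normr_jump_scale a v : 0 < a -> a * `|jump (a `^ alpha * v)| = `|jump v|.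
Proof.
move=> a0; rewrite !normr_jump normrM (ger0_norm (powR_ge0 _ _)) powRM ?powR_ge0//.
by rewrite -powRrM mulrN divff ?gt_eqF// powR_inv1 ?ltW// mulrA divff ?mul1r// gt_eqF.
Qed.

Lemma normr_jump_gt K v : 0 < K ->
  (K < `|jump v|) = (v != 0) && (`|v| < K `^ (- alpha)).
Proof.
move=> K0; rewrite normr_jump; have [->|v0] := eqVneq v 0.
  by rewrite normr0 powR0 ?oppr_eq0 ?invr_eq0 ?gt_eqF//= ltNge ltW.
have v1 : 0 < `|v| by rewrite normr_gt0.
rewrite -(ltr_powR2 alpha0 (ltW K0) (powR_ge0 _ _)).
rewrite -powRrM mulNr mulVf ?gt_eqF// powR_inv1// powRN.
by rewrite -[in RHS]ltf_pV2 ?posrE ?invr_gt0 ?powR_gt0// invrK.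
Qed.

Lemma measurable_jump : measurable_fun setT jump.
Proof.
have mp : measurable_fun setT (fun v : R => `|v| `^ (- alpha^-1)).
  exact: (measurableT_comp (measurable_powR _) (@normr_measurable R setT)).
apply: measurable_fun_ifT => //; last exact: measurable_funN.
exact: measurable_fun_ler.
Qed.

Definition levy (psi : R -> R) : \bar R := (\int[mu]_v (psi `|jump v|)%:E)%E.

Local Open Scope ereal_scope.

Lemma levy_scale (psi : R -> R) (c : R) : (0 < c)%R ->
  measurable_fun setT psi -> (forall x, 0 <= psi x)%R ->
  \int[mu]_v (psi (c * `|jump v|))%:E = (c `^ alpha)%:E * levy psi.
Proof.
move=> c0 mpsi psi0; rewrite (@ge0_integral_scale _ (c `^ alpha)) ?powR_gt0//.
- by congr (_ * _); apply: eq_integral => v _; rewrite normr_jump_scale.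
- apply/measurable_EFinP; apply: measurableT_comp => //.
  apply: measurable_funM => //; apply: measurableT_comp => //.
  exact: measurable_jump.
- by move=> v; rewrite lee_fin.
Qed.

(** Jumps above [K] come from the interval of half-length [K^(-alpha)] around 0. The origin itself
    is excluded because a nonzero power of 0 is 0 by convention, so that [jump 0 = 0]; this costs no
    measure. *)
Lemma levy_tail (K : R) : (0 < K)%R -> mu [set v | (K < `|jump v|)%R] = (2 * K `^ (- alpha))%:E.
Proof.
move=> K0; have Ka : (0 < K `^ (- alpha))%R by rewrite powR_gt0.
rewrite (_ : [set _ | _] = `](- K `^ (- alpha))%R, (K `^ (- alpha))%R[ `\ 0%R); last first.
  apply/seteqP; split => v /=; rewrite normr_jump_gt// in_itv/= ltr_norml.
    by move=> /andP[/eqP].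
  by move=> [-> /eqP ->].
rewrite measureD//=; last first.
  by rewrite lebesgue_measure_itv/=; case: ifPn => _; rewrite ?ltry//.
rewrite lebesgue_measure_itv/= lte_fin ifT; last by rewrite (lt_trans _ Ka)// oppr_lt0.
rewrite (_ : mu _ = 0); last first.
  apply/eqP; rewrite -measure_le0 -(lebesgue_measure_set1 (0 : R)%R).
  by rewrite le_measure ?inE//; apply: measurableI.
by rewrite sube0 -EFinB opprK; congr EFin; rewrite mulr2n mulrDl mul1r.
Qed.


Let sqr_small (x : R) := if (`|x| <= 1)%R then (x ^+ 2)%R else 0%R.

(** Jumps of modulus at most 1 are those with [|v| >= 1], apart from the origin, and there the
    square is [|v|^(-2 / alpha)]: integrable because [alpha < 2]. The half-lines are folded together
    by reflection and the integral comes from the primitive [v^(1 - p) / (1 - p)]. *)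
Lemma levy_small_lty : (alpha < 2)%R -> levy sqr_small < +oo.
Proof.
move=> alpha2; pose p := (2 * alpha^-1)%R.
have p1 : (1 < p)%R by rewrite /p ltr_pdivlMr ?mul1r.
have h (v : R) : (0 < v)%R -> (v `^ (- alpha^-1) ^+ 2 = v `^ (- p))%R.
  by move=> v0; rewrite -powR_mulrn ?powR_ge0// -powRrM /p mulrC mulrN.
pose r v : R := if (1 <= v)%R then (v `^ (- p))%R else 0%R.
have mr : measurable_fun setT r.
  by apply: measurable_fun_ifT => //; exact: measurable_fun_ler.
have r0 v : (0 <= r v)%R by rewrite /r; case: ifPn => // _; exact: powR_ge0.
have qE v : sqr_small `|jump v| = (r v + r (- v))%R.
  rewrite /sqr_small normr_id normr_jump /r; have [->|v0] := eqVneq v 0%R.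
    rewrite oppr0 normr0 powR0 ?oppr_eq0 ?invr_eq0 ?gt_eqF//.
      by rewrite powR0 ?oppr_eq0 ?invr_eq0 ?gt_eqF// expr0n/= !if_same addr0.
    by lra.
  have nv0 : (0 < `|v|)%R by rewrite normr_gt0.
  have -> : (`|v| `^ (- alpha^-1) <= 1)%R = (1 <= `|v|)%R.
    rewrite powRN invf_le1 ?powR_gt0//.
    have E : (1 `^ alpha^-1 = 1 :> R)%R by rewrite powR1.
    by rewrite -[X in (X <= _)%R]E leNgt ltr_powR2 ?invr_gt0// -leNgt.
  rewrite h//; have [v1|v1] := leP 0%R v.
    rewrite ger0_norm// [(1 <= - v)%R]leNgt (_ : (- v < 1)%R) ?addr0//; lra.
  rewrite ltr0_norm// [(1 <= v)%R]leNgt (_ : (v < 1)%R) ?add0r//; lra.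
rewrite /levy; under eq_integral do rewrite qE EFinD.
rewrite ge0_integralD//; last 4 first.
- by move=> v _; rewrite lee_fin.
- exact/measurable_EFinP.
- by move=> v _; rewrite lee_fin.
- by apply/measurable_EFinP; apply: measurableT_comp => //; exact: measurable_funN.
rewrite -(@ge0_integral_opp _ (EFin \o r)); last 2 first.
- exact/measurable_EFinP.
- by move=> v; rewrite lee_fin.
suff : \int[mu]_v (r v)%:E < +oo by move=> ?; rewrite lte_add_pinfty.
have -> : \int[mu]_v (r v)%:E = \int[mu]_(v in `[1%R, +oo[) (v `^ (- p))%:E.
  rewrite [RHS]integral_mkcond; apply: eq_integral => v _.
  by rewrite /r patchE mem_setE in_itv/= andbT; case: ifPn.
rewrite (@ge0_continuous_FTC2y _ _ (fun v => (1 - p)^-1 * v `^ (1 - p))%R _ 0%R).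
- by rewrite -EFinB ltry.
- by move=> x _; exact: powR_ge0.
- apply: derivable_within_continuous => x; rewrite in_itv/= andbT => x1.
  by apply: derivable_powR; rewrite in_itv/= andbT; lra.
- rewrite -[X in _ --> X](mulr0 ((1 - p)^-1)%R).
  apply: cvgM; first exact: cvg_cst.
  apply/cvgr0Pnorm_le => e e0; near=> v.
  have ve : (e^-1 `^ (p - 1)^-1 <= v)%R.
    by near: v; apply: nbhs_pinfty_ge; rewrite num_real.
  rewrite ger0_norm ?powR_ge0// -[(1 - p)%R]opprB powRN.
  rewrite -[leRHS]invrK lef_pV2 ?posrE ?invr_gt0//.
    apply: le_trans (ge0_ler_powR _ _ _ ve); rewrite ?nnegrE ?powR_ge0//.
      have p10 : (p - 1 != 0)%R by rewrite gt_eqF//; lra.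
      have e10 : (0 <= e^-1)%R by rewrite invr_ge0 ltW.
      by rewrite -powRrM mulVf// powRr1.
    by lra.
  apply: powR_gt0; apply: lt_le_trans ve; apply: powR_gt0.
  by rewrite invr_gt0.
- move=> x x1; apply: derivableM => //; apply: derivable_powR.
  by rewrite in_itv/= andbT; lra.
- apply: cvg_at_right_filter.
  apply: (@differentiable_continuous _ _ _ _ (fun v => (1 - p)^-1 * v `^ (1 - p))%R).
  apply/derivable1_diffP; apply: derivableM => //; apply: derivable_powR.
  by rewrite in_itv/= andbT; lra.
- move=> x; rewrite in_itv/= andbT => x1.
  have x0 : (0 < x)%R by lra.
  have := is_deriveZ (1 - p)^-1%R (is_derive1_powR (1 - p) x0) => /@derive_val.
  rewrite derive1E => ->; rewrite /GRing.scale/= mulrA mulVf ?mul1r; last by lra.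
  by congr (_ `^ _)%R; lra.
Unshelve. all: by end_near. Qed.

End levy_measure.

Section cosine_bounds.
Context {R : realType}.

Lemma normr_sin_le (x : R) : 0 <= x -> `|sin x| <= x.
Proof.
move=> x0; have [|c cx] := @MVT_segment R sin cos 0 x x0.
- by apply: continuous_subspaceT; exact: continuous_sin.
- by rewrite sin0 !subr0 => ->; rewrite normrM (ger0_norm x0) ler_piMl// cos_max.
Qed.

Lemma one_sub_cos_le (x : R) : 1 - cos x <= x ^+ 2.
Proof.
wlog x0 : x / 0 <= x.
  move=> H; have [/H//|x0] := leP 0 x.
  by rewrite -cosN -sqrrN; apply: H; lra.
have [|c] := @MVT_segment R cos (fun x => - sin x) 0 x x0.
- by apply: continuous_subspaceT; exact: continuous_cos.
- rewrite in_itv/= => /andP[c0 cx]; rewrite cos0 subr0 => H.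
have -> : 1 - cos x = sin c * x by rewrite -opprB H mulNr opprK.
rewrite expr2 ler_wpM2r// (le_trans (ler_norm _))// (le_trans (normr_sin_le c0))//.
Qed.

End cosine_bounds.

(** * Sampling kernels times jumps in a finite window *)

Section jump_sample.
Context {R : realType} {d} {T : measurableType d} (rho : probability T R).
Variable alpha : R.
Hypotheses (alpha0 : 0 < alpha) (alpha2 : alpha < 2).
Local Notation mu := (@lebesgue_measure R).
Local Notation jump := (jump alpha).
Local Notation levy := (levy alpha).

Lemma jump_window n : - (n.+1%:R / 2) < n.+1%:R / 2 :> R.
Proof. by have : 0 < n.+1%:R :> R by []; lra. Qed.

(* A sample of [n + 1] points of this law approximates a Poisson point process of intensity
   [rho \x mu]: the points fall into the window with [n + 1] times the uniform density. *)
Definition jump_law n : probability (T * measurableTypeR R)%type R :=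
  product_prob rho (uniform_prob (jump_window n)).

Let window n (v : R) : bool := `|v| <= n.+1%:R / 2.

Let mwindow n : measurable_fun setT (fun z : T * R => (window n z.2)%:R%:E : \bar R).
Proof.
apply/measurable_EFinP; apply: (measurableT_comp (f := fun b : bool => b%:R : R)) => //.
apply: measurable_fun_ler => //.
exact: (measurableT_comp (@normr_measurable R setT)).
Qed.

Lemma jump_law_integral n (F : T * R -> \bar R) : measurable_fun setT F ->
  (forall z, 0 <= F z)%E ->
  (n.+1%:R%:E * \int[jump_law n]_z F z =
   \int[(rho \x mu)%E]_z (F z * (window n z.2)%:R%:E))%E.
Proof.
move=> mF F0; have n0 : 0 < n.+1%:R :> R by [].
have mW := mwindow n.
have mFW : measurable_fun setT (fun z => F z * (window n z.2)%:R%:E)%E by exact: emeasurable_funM.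
rewrite /jump_law /product_prob fubini_tonelli1// fubini_tonelli1//; last first.
  by move=> z; rewrite mule_ge0// lee_fin.
rewrite -ge0_integralZl//; last 2 first.
- exact: measurable_fun_fubini_tonelli_F.
- by move=> x _; exact: integral_ge0.
apply: eq_integral => s _; rewrite /fubini_F integral_uniform//; last first.
  exact: measurableT_comp.
rewrite muleA -EFinM (_ : _ * _ = 1) ?mul1e; last first.
  by rewrite opprK -splitr divff// gt_eqF.
rewrite [LHS]integral_mkcond; apply: eq_integral => v _; rewrite patchE mem_setE in_itv/=.
by rewrite -ler_norml /window; case: ifPn => _; rewrite ?mule1 ?mule0.
Qed.

Variables (psi : R -> R) (c : T -> R).
Hypotheses (mpsi : measurable_fun setT psi) (psi_ge0 : forall x, 0 <= psi x) (psi0 : psi 0 = 0).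
Hypothesis mc : measurable_fun setT c.

Let F (z : T * R) := psi (`|c z.1| * `|jump z.2|).

Let mF : measurable_fun setT F.
Proof.
apply: measurableT_comp => //; apply: measurable_funM; apply: measurableT_comp => //.
  exact: measurableT_comp mc _.
exact: measurableT_comp (measurable_jump alpha) _.
Qed.

Let F0 z : (0 <= (F z)%:E)%E. Proof. exact: psi_ge0. Qed.

Let mEF : measurable_fun setT (EFin \o F).
Proof. exact/measurable_EFinP. Qed.

(** By Tonelli it suffices to fix [s], where self-similarity pulls out [|c s|^alpha]. Where
    [c s = 0], both sides vanish thanks to [psi 0 = 0]. *)
Lemma levy_integral : (\int[(rho \x mu)%E]_z (F z)%:E =
  (\int[rho]_s (`|c s| `^ alpha)%:E) * levy psi)%E.
Proof.
transitivity (\int[rho]_s fubini_F mu (EFin \o F) s)%E.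
  exact: fubini_tonelli1.
rewrite -ge0_integralZr//; last 2 first.
- apply/measurable_EFinP => /=; apply: (measurableT_comp (measurable_powR alpha)).
  exact: measurableT_comp.
- by apply: integral_ge0 => v _; rewrite lee_fin.
apply: eq_integral => s _; rewrite /fubini_F /F/=.
have [->|cs0] := eqVneq (c s) 0.
  rewrite normr0 powR0 ?gt_eqF// mul0e; under eq_integral do rewrite mul0r psi0.
  by rewrite integral0.
by rewrite levy_scale// normr_gt0.
Qed.

Lemma jump_law_le n : (n.+1%:R%:E * \int[jump_law n]_z (F z)%:E <=
  (\int[rho]_s (`|c s| `^ alpha)%:E) * levy psi)%E.
Proof.
rewrite (jump_law_integral _ mEF F0).
rewrite -levy_integral; apply: ge0_le_integral => //.
- by move=> z _; rewrite mule_ge0 ?lee_fin ?ler0n//; exact: F0.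
- exact: (emeasurable_funM mEF (mwindow n)).
- move=> z _; rewrite -EFinM lee_fin; apply: ler_piMr; first exact: psi_ge0.
  by case: window.
Qed.

(* The window of the [n]-th law eventually contains the support of a function
   vanishing on small jumps, so there the limit is attained. *)
Lemma jump_law_eventually n (K : R) :
  (forall z, psi (`|c z.1| * `|jump z.2|) != 0 -> `|z.2| <= K) ->
  2 * K <= n.+1%:R ->
  (n.+1%:R%:E * \int[jump_law n]_z (F z)%:E =
  (\int[rho]_s (`|c s| `^ alpha)%:E) * levy psi)%E.
Proof.
move=> FK Kn; rewrite (jump_law_integral _ mEF F0) -levy_integral.
apply: eq_integral => z _ /=; have [->|/FK zK] := eqVneq (F z) 0; first by rewrite mul0e.
by rewrite /window (_ : _ <= _) ?mule1//; lra.
Qed.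

(** Multiplying by [n + 1] turns the uniform law into Lebesgue measure on the window, and the
    windows increase to the line, so monotone convergence applies. *)
Lemma jump_law_cvg : (n.+1%:R%:E * \int[jump_law n]_z (F z)%:E @[n --> \oo] -->
  (\int[rho]_s (`|c s| `^ alpha)%:E) * levy psi)%E.
Proof.
under eq_fun do rewrite (jump_law_integral _ mEF F0).
rewrite -levy_integral.
have -> : (\int[(rho \x mu)%E]_z (F z)%:E =
    \int[(rho \x mu)%E]_z (lim ((F z)%:E * (window n z.2)%:R%:E @[n --> \oo])))%E.
  apply: eq_integral => z _; apply/esym/cvg_lim => //.
  apply: cvg_near_cst; near=> n.
  rewrite /window (_ : _ <= _) ?mule1// ler_pdivlMr//.
  apply: (@le_trans _ _ n%:R); last by rewrite ler_nat.
  near: n; apply: nbhs_infty_ger.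
apply: cvg_monotone_convergence => //.
- by move=> n; exact: (emeasurable_funM mEF (mwindow n)).
- by move=> n z _; rewrite mule_ge0 ?lee_fin ?ler0n//; exact: F0.
- move=> z _ m n mn; apply: lee_wpmul2l => //; rewrite lee_fin ler_nat.
  rewrite /window; case: (leP `|z.2| _) => //= zm; rewrite (le_trans zm)//.
  by rewrite ler_pM2r// ler_nat.
Unshelve. all: by end_near. Qed.

End jump_sample.

(** * The exponential limit of powers *)

Section exponential_limit.
Context {R : realType}.

Lemma ler_dist_exprn (x y : R) n : `|x| <= 1 -> `|y| <= 1 ->
  `|x ^+ n - y ^+ n| <= n%:R * `|x - y|.
Proof.
move=> x1 y1; elim: n => [|n IH]; first by rewrite !expr0 subrr normr0 mul0r.
have -> : x ^+ n.+1 - y ^+ n.+1 = x * (x ^+ n - y ^+ n) + (x - y) * y ^+ n.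
  by rewrite !exprS; ring.
have -> : n.+1%:R * `|x - y| = n%:R * `|x - y| + `|x - y| by rewrite -natr1 mulrDl mul1r.
rewrite (le_trans (ler_normD _ _))// lerD//.
  by rewrite normrM (le_trans _ IH)// ler_piMl.
by rewrite normrM normrX ler_piMr// exprn_ile1.
Qed.

Lemma expRN_le (x : R) : 0 <= x -> expR (- x) <= 1 - x + x ^+ 2.
Proof.
move=> x0; have e1 : 1 + x <= expR x by exact: expR_ge1Dx.
rewrite expRN (@le_trans _ _ (1 + x)^-1)//.
  by rewrite lef_pV2 ?posrE ?expR_gt0//; lra.
rewrite -[leLHS]mul1r ler_pdivrMr; last by lra.
by nra.
Qed.

(** With [N = n + 1], write [expR (- a)] as the [N]-th power of [expR (- a / N)]. Powers of two
    numbers in [[-1, 1]] differ by at most [N] times the difference of the bases, here at most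
    [|a_n - a| + a^2 / N]. *)
Lemma cvg_one_sub_expn (a_ : nat -> R) (a : R) : a_ @ \oo --> a -> 0 <= a ->
  (forall n, 0 <= a_ n) ->
  (1 - a_ n / n.+1%:R) ^+ n.+1 @[n --> \oo] --> expR (- a).
Proof.
move=> a_a a0 a_0.
have natinf (M : R) : \forall n \near \oo, M <= n.+1%:R.
  near=> n; apply: (@le_trans _ _ n%:R); last by rewrite ler_nat.
  by near: n; exact: nbhs_infty_ger.
apply/cvgrPdist_le => e e0; near=> n.
have n0 : 0 < n.+1%:R :> R by [].
have -> : expR (- a) = expR (- (a / n.+1%:R)) ^+ n.+1.
  by rewrite -expRM_natl mulrN mulrC divfK// gt_eqF.
have an : `|a_ n - a| <= e / 2.
  by rewrite distrC; near: n; apply: cvgr_dist_le a_a _ _; rewrite divr_gt0.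
have an1 : a_ n / n.+1%:R <= 1.
  rewrite ler_pdivrMr// mul1r; apply: (@le_trans _ _ (a + e / 2)).
    by move: an; rewrite ler_norml => /andP[_]; lra.
  by near: n; exact: natinf.
have a1 : 0 <= a / n.+1%:R by rewrite divr_ge0.
have a_1 : 0 <= a_ n / n.+1%:R by rewrite divr_ge0.
rewrite (le_trans (ler_dist_exprn _ _ _))//.
- by rewrite ger0_norm ?expR_ge0// -[leRHS]expR0 ler_expR oppr_le0.
- by rewrite ger0_norm ?subr_ge0// lerBlDr lerDl.
have : a ^+ 2 / n.+1%:R <= e / 2.
  rewrite ler_pdivrMr// -ler_pdivrMl ?divr_gt0//.
  by near: n; exact: natinf.
move=> a2e; set u := a / n.+1%:R in a1 *; set v := a_ n / n.+1%:R in an1 a_1 *.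
have l1 := expRN_le a1; have l2 : 1 - u <= expR (- u) by rewrite (le_trans _ (expR_ge1Dx _)).
have l3 : `|expR (- u) - (1 - v)| <= `|v - u| + u ^+ 2.
  have -> : expR (- u) - (1 - v) = (v - u) + (expR (- u) - (1 - u)) by ring.
  rewrite (le_trans (ler_normD _ _))// lerD2l ger0_norm; lra.
rewrite (le_trans (ler_wpM2l _ l3))// mulrDr.
have -> : n.+1%:R * `|v - u| = `|a_ n - a|.
  by rewrite /v /u -mulrBl normrM (@gtr0_norm _ _^-1) ?invr_gt0// mulrC divfK// gt_eqF.
have -> : n.+1%:R * u ^+ 2 = a ^+ 2 / n.+1%:R.
  by rewrite /u; field; rewrite gt_eqF.
by rewrite (splitr e) lerD.
Unshelve. all: by end_near. Qed.

End exponential_limit.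

(** * Constants of the Levy measure *)

Section levy_constants.
Context {R : realType}.
Variable alpha : R.
Hypotheses (alpha0 : 0 < alpha) (alpha2 : alpha < 2).
Local Notation mu := (@lebesgue_measure R).

Definition sqr_upto (K x : R) := if `|x| <= K then x ^+ 2 else 0.

(** Characteristic exponent of the jumps at frequency 1; at [theta] it is [levy_cos] times
    [|theta|^alpha] by scaling. It converts between jump sums and integrals of scale one. *)
Definition levy_cos : R := fine (levy alpha (fun x => 1 - cos x)).
Definition levy_sqr : R := fine (levy alpha (sqr_upto 1)).

Lemma measurable_sqr_upto K : measurable_fun setT (sqr_upto K).
Proof.
apply: measurable_fun_ifT => //.
by apply: measurable_fun_ler => //; exact: normr_measurable.
Qed.

Lemma sqr_upto_ge0 K x : 0 <= sqr_upto K x.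
Proof. by rewrite /sqr_upto; case: ifPn => // _; exact: sqr_ge0. Qed.

Lemma measurable_one_sub_cos : measurable_fun setT (fun x : R => 1 - cos x).
Proof. by apply: measurable_funB => //; exact: (continuous_measurable_fun (@continuous_cos R)). Qed.

Lemma one_sub_cos_ge0 (x : R) : 0 <= 1 - cos x.
Proof. by rewrite subr_ge0 cos_le1. Qed.

Local Open Scope ereal_scope.

Lemma levy_indic_tail (K : R) : (0 < K)%R ->
  levy alpha (fun x => (K < x)%R%:R)%R = (2 * K `^ (- alpha))%:E.
Proof.
move=> K0; rewrite -levy_tail//.
transitivity (mu ([set v | (K < `|jump alpha v|)%R] `&` setT)); last by rewrite setIT.
rewrite -integral_indic//.
  apply: eq_integral => v _; rewrite indicE mem_setE.
  by congr (_%:R%:E).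
rewrite -[X in measurable X]setTI.
rewrite (_ : [set _ | _] = (fun v => `|jump alpha v|%R) @^-1` `]K, +oo[); last first.
  by apply/seteqP; split => v /=; rewrite in_itv/= andbT.
have mj : measurable_fun setT (fun v => `|jump alpha v|%R).
  exact: (measurableT_comp (@normr_measurable R setT) (measurable_jump alpha)).
exact: mj.
Qed.

Lemma levy_sqrE : levy alpha (sqr_upto 1) = levy_sqr%:E.
Proof.
rewrite fineK// ge0_fin_numE; first exact: levy_small_lty.
by apply: integral_ge0 => v _; rewrite lee_fin sqr_upto_ge0.
Qed.

Lemma levy_sqr_upto (K : R) : (0 < K)%R ->
  levy alpha (sqr_upto K) = (K `^ (2 - alpha) * levy_sqr)%:E.
Proof.
move=> K0; have mj : measurable_fun setT (fun v => `|jump alpha v|%R).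
  exact: (measurableT_comp (@normr_measurable R setT) (measurable_jump alpha)).
transitivity (\int[mu]_v ((K ^+ 2)%:E * (sqr_upto 1 (K^-1 * `|jump alpha v|)%R)%:E)).
  apply: eq_integral => v _; rewrite -EFinM; congr EFin; rewrite /sqr_upto.
  rewrite normrM normr_id gtr0_norm ?invr_gt0// [X in (X <= 1)%R]mulrC ler_pdivrMr// mul1r.
  case: ifPn => _; last by rewrite mulr0.
  by rewrite exprMn exprVn mulrA divff ?mul1r// expf_neq0// gt_eqF.
rewrite ge0_integralZl//; last 3 first.
- apply/measurable_EFinP; apply: (measurableT_comp (measurable_sqr_upto 1)).
  by apply: measurable_funM.
- by move=> v _; rewrite lee_fin sqr_upto_ge0.
- by rewrite lee_fin sqr_ge0.
rewrite levy_scale ?invr_gt0//; last 2 first.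
- exact: measurable_sqr_upto.
- exact: sqr_upto_ge0.
rewrite levy_sqrE -!EFinM mulrA; congr (_ * _)%:E.
rewrite -[in LHS]powR_inv1 ?ltW// -powRrM mulN1r -powR_mulrn ?ltW// -powRD//.
by rewrite (gt_eqF K0) /= implybT.
Qed.

(** Finiteness: [1 - cos x] is at most 2, which suffices for the jumps above 1, and at most [x^2],
    which suffices for the small ones. *)
Lemma levy_cosE : levy alpha (fun x => 1 - cos x)%R = levy_cos%:E.
Proof.
have mj : measurable_fun setT (fun v => `|jump alpha v|%R).
  exact: (measurableT_comp (@normr_measurable R setT) (measurable_jump alpha)).
rewrite fineK// ge0_fin_numE; last first.
  by apply: integral_ge0 => v _; rewrite lee_fin one_sub_cos_ge0.
pose t (x : R) := (1 < x)%R%:R : R.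
have mt : measurable_fun setT (fun v => t `|jump alpha v|%R).
  apply: (measurableT_comp (f := fun b : bool => b%:R : R)) => //.
  exact: measurable_fun_ltr.
have ms : measurable_fun setT (fun v => sqr_upto 1 `|jump alpha v|%R).
  exact: (measurableT_comp (measurable_sqr_upto 1)).
apply: (@le_lt_trans _ _ (\int[mu]_v ((2%:E * (t `|jump alpha v|%R)%:E) + (sqr_upto 1 `|jump alpha v|%R)%:E))).
  apply: ge0_le_integral => //.
  - by apply/measurable_EFinP; exact: (measurableT_comp measurable_one_sub_cos).
  - by apply: emeasurable_funD; [apply: emeasurable_funM => //|]; exact/measurable_EFinP.
  - move=> v _; rewrite -EFinM -EFinD lee_fin /t /sqr_upto normr_id.
    have := cos_geN1 `|jump alpha v|%R; have := one_sub_cos_le `|jump alpha v|%R.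
    by case: (leP `|jump alpha v|%R 1%R) => _ /=; lra.
rewrite ge0_integralD//; last 4 first.
- by move=> v _; rewrite -EFinM lee_fin mulr_ge0// ler0n.
- by apply: emeasurable_funM => //; exact/measurable_EFinP.
- by move=> v _; rewrite lee_fin sqr_upto_ge0.
- exact/measurable_EFinP.
rewrite ge0_integralZl//; last 2 first.
- exact/measurable_EFinP.
- by move=> v _; rewrite lee_fin ler0n.
have := levy_indic_tail ltr01; have := levy_sqrE.
by rewrite /levy => -> ->; rewrite -EFinM -EFinD ltry.
Qed.

(** The shell of jumps with modulus in [(1, 2]] has positive measure by the tail formula, and
    [2 <= pi] gives [1 - cos x >= 1 - cos 1 > 0] on it. *)
Lemma levy_cos_gt0 : (0 < levy_cos)%R.
Proof.
have mj : measurable_fun setT (fun v => `|jump alpha v|%R).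
  exact: (measurableT_comp (@normr_measurable R setT) (measurable_jump alpha)).
rewrite -lte_fin -levy_cosE.
have c1 : (0 < 1 - cos 1 :> R)%R.
  rewrite subr_gt0 -[ltRHS]cos0 ltr_cos ?in_itv/= ?ltr01// ?lexx ?pi_ge0//.
  by rewrite ler01 (le_trans _ (pi_ge2 R))//; lra.
pose A := [set v : R | (1 < `|jump alpha v|)%R].
pose B := [set v : R | (2 < `|jump alpha v|)%R].
have mS (K : R) : measurable [set v : R | (K < `|jump alpha v|)%R].
  rewrite -[X in measurable X]setTI.
  rewrite (_ : [set _ | _] = (fun v => `|jump alpha v|%R) @^-1` `]K, +oo[); last first.
    by apply/seteqP; split => v /=; rewrite in_itv/= andbT.
  exact: mj.
have muAB : 0 < mu (A `\` B).
  rewrite measureD//=; last 3 first.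
  - exact: mS.
  - exact: mS.
  - by rewrite levy_tail// ltry.
  rewrite setIidr; last by move=> v; rewrite /A /B/=; lra.
  rewrite !levy_tail// -EFinB lte_fin subr_gt0 ltr_pM2l//.
  have E : (1 `^ alpha = 1 :> R)%R by rewrite powR1.
  rewrite !powRN E invr1 invf_lt1 ?powR_gt0// -[ltLHS]E ltr_powR2//; lra.
apply: (@lt_le_trans _ _ (\int[mu]_(v in A `\` B) (1 - cos 1)%R%:E)).
  rewrite integral_cst//; last by apply: measurableD; exact: mS.
  by rewrite mule_gt0// lte_fin.
apply: (@le_trans _ _ (\int[mu]_(v in A `\` B) (1 - cos `|jump alpha v|)%R%:E)).
  apply: ge0_le_integral => //.
  - by apply: measurableD; exact: mS.
  - by apply/measurable_EFinP/measurable_funTS; exact: (measurableT_comp measurable_one_sub_cos).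
  - move=> v [/= v1 /negP]; rewrite -leNgt => v2; rewrite lee_fin lerD2l lerN2 ltW//.
    rewrite ltr_cos ?in_itv//=.
    + by rewrite ler01 (le_trans _ (pi_ge2 R))//; lra.
    + by rewrite normr_ge0 (le_trans v2)// pi_ge2.
apply: ge0_subset_integral => //.
- by apply: measurableD; exact: mS.
- by apply/measurable_EFinP; exact: (measurableT_comp measurable_one_sub_cos).
Qed.

End levy_constants.

(** * Sums with at most one large term *)

Section one_big_jump.
Context {R : realFieldType} {T : Type}.
Implicit Types (x : T -> R) (s : seq T) (e delta m : R).

(** Large values are dropped rather than capped, so a sum is exactly its truncated part plus its
    large terms. *)
Definition truncate (e x : R) : R := if `|x| <= e then x else 0.

Lemma sum_truncate_big e x s :
  \sum_(i <- s) x i =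
  \sum_(i <- s) truncate e (x i) + \sum_(i <- [seq i <- s | e < `|x i|]) x i.
Proof.
rewrite big_filter [X in _ = _ + X]big_mkcond -big_split/=.
by apply: eq_bigr => i _; rewrite /truncate ltNge; case: leP => _ /=; rewrite ?addr0 ?add0r.
Qed.

(** With fewer than two terms above [e], what remains besides the truncated sum is a single term or
    nothing. *)
Lemma normr_sum_le_of_small_jumps e delta m x s :
  (count (fun i => (e < `|x i|)%R) s < 2)%N ->
  `|\sum_(i <- s) truncate e (x i)| <= delta -> 0 <= m ->
  all (fun i => `|x i| <= m) s -> `|\sum_(i <- s) x i| <= m + delta.
Proof.
rewrite -size_filter => sz sm m0 xm; rewrite (sum_truncate_big e).
rewrite (le_trans (ler_normD _ _))// addrC lerD//.
have : all (fun i => `|x i| <= m) [seq i <- s | e < `|x i|].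
  by rewrite all_filter; apply: sub_all xm => i /= ->; rewrite implybT.
move: sz; move: [seq _ <- _ | _] => r; case: r => [|i [|j r]]//= _.
  by rewrite big_nil normr0.
by rewrite big_seq1 andbT.
Qed.

(** The condition [e <= m + delta] puts the term exceeding [m + delta] among the large ones, where
    it is alone; the truncated sum can then cancel at most [delta] of it. *)
Lemma normr_sum_gt_of_big_jump e delta m x s :
  (count (fun i => (e < `|x i|)%R) s < 2)%N ->
  `|\sum_(i <- s) truncate e (x i)| <= delta -> e <= m + delta ->
  has (fun i => m + delta < `|x i|) s -> m < `|\sum_(i <- s) x i|.
Proof.
rewrite -size_filter => sz sm em xm; rewrite (sum_truncate_big e).
have : has (fun i => m + delta < `|x i|) [seq i <- s | e < `|x i|].
  elim: s xm {sz sm} => //= i s IH; case: ifPn => /= [ei /orP[->//|/IH ->]|].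
    by rewrite orbT.
  by rewrite -leNgt => ie /orP[/lt_le_trans/(_ ie)|//]; rewrite ltNge em.
move: sz; move: [seq _ <- _ | _] => r; case: r => [|i [|j r]]//= _; rewrite orbF big_seq1.
set y := \sum_(_ <- _) _ in sm * => xi.
have := lerB_normD (x i) y; rewrite [y + _]addrC; lra.
Qed.

End one_big_jump.

(** * Markov and union bounds *)

Section prob_bounds.
Context {R : realType} {d} {Omega : measurableType d} (P : probability Omega R).

Lemma fine_prob_le_expectation (A : set Omega) (f : Omega -> R) M :
  measurable A -> measurable_fun setT f -> (forall w, 0 <= f w <= M) ->
  (forall w, A w -> 1 <= f w) -> fine (P A) <= \int[P]_w f w.
Proof.
move=> mA mf fM f1; rewrite -(Rintegral_indic P mA); apply: le_Rintegral => //.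
- exact: indic_integrable.
- apply: (bounded_integrable P mf (M := M)) => w.
  by have /andP[f0 fMw] := fM w; rewrite ger0_norm.
- move=> w _; have /andP[f0 _] := fM w; rewrite indicE.
  by case: (boolP (w \in A)) => //; rewrite inE => /f1.
Qed.

Lemma measurable_ler_set (f : Omega -> R) c : measurable_fun setT f ->
  measurable [set w | f w <= c].
Proof.
move=> mf; rewrite -[X in measurable X]setTI.
rewrite (_ : [set _ | _] = f @^-1` `]-oo, c]); last first.
  by apply/seteqP; split => w /=; rewrite in_itv.
exact: mf.
Qed.

Lemma measurable_ge_set (f : Omega -> R) c : measurable_fun setT f ->
  measurable [set w | c <= f w].
Proof.
move=> mf; rewrite -[X in measurable X]setTI.
rewrite (_ : [set _ | _] = f @^-1` `[c, +oo[); last first.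
  by apply/seteqP; split => w /=; rewrite in_itv/= andbT.
exact: mf.
Qed.

Lemma measurable_ltr_set (f : Omega -> R) c : measurable_fun setT f ->
  measurable [set w | c < f w].
Proof.
move=> mf; rewrite (_ : [set _ | _] = ~` [set w | f w <= c]).
  by apply: measurableC; exact: measurable_ler_set.
by apply/seteqP; split => w /=; rewrite ltNge => /negP.
Qed.

Lemma measurable_exists_seq (I : eqType) (s : seq I) (A : I -> set Omega) :
  (forall i, measurable (A i)) -> measurable [set w | exists2 i, i \in s & A i w].
Proof.
move=> mA; elim: s => [|j s IH].
  by rewrite (_ : [set _ | _] = set0)//; apply/seteqP; split => // w [].
rewrite (_ : [set _ | _] = A j `|` [set w | exists2 i, i \in s & A i w]).
  exact: measurableU.
apply/seteqP; split => [w [i]|w [Aj|[i si Ai]]].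
- by rewrite inE => /predU1P[->|si] Ai; [left|right; exists i].
- by exists j => //; rewrite mem_head.
- by exists i => //; rewrite inE si orbT.
Qed.

Lemma fine_prob_exists_seq (I : eqType) (s : seq I) (A : I -> set Omega) (c : R) :
  (forall i, measurable (A i)) -> (forall i, fine (P (A i)) <= c) ->
  fine (P [set w | exists2 i, i \in s & A i w]) <= (size s)%:R * c.
Proof.
move=> mA Ac; elim: s => [|j s IH] /=.
  by rewrite (_ : [set _ | _] = set0) ?measure0 ?mul0r//; apply/seteqP; split => // w [].
rewrite (_ : [set _ | _] = A j `|` [set w | exists2 i, i \in s & A i w]).
  rewrite (le_trans (fine_probU _ _ _))//; first exact: measurable_exists_seq.
  by rewrite -natr1 mulrDl mul1r addrC lerD.
apply/seteqP; split => [w [i]|w [Aj|[i si Ai]]].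
- by rewrite inE => /predU1P[->|si] Ai; [left|right; exists i].
- by exists j => //; rewrite mem_head.
- by exists i => //; rewrite inE si orbT.
Qed.

End prob_bounds.

(** * Large jumps and truncated sums of a sample *)

Section jump_sums.
Context {R : realType} {d} {T : measurableType d} (rho : probability T R).
Variable alpha : R.
Hypotheses (alpha0 : 0 < alpha) (alpha2 : alpha < 2).
Local Notation jump := (jump alpha).
Local Notation Q n := (jump_law rho n).
Local Notation TR := (T * measurableTypeR R)%type.

(** Adding the bound [M] makes the integrand nonnegative, so that Tonelli and the reflection
    [v -> - v] apply; comparing [f + M] with [- f + M] shows that the integral equals its
    opposite. *)
Lemma jump_law_odd n (f : TR -> R) (M : R) : measurable_fun setT f ->
  (forall z, `|f z| <= M) -> (forall s v, f (s, - v) = - f (s, v)) ->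
  \int[Q n]_z f z = 0.
Proof.
move=> mf fM fN.
pose F z := (f z + M)%:E; pose F' z := (- f z + M)%:E.
have mF : measurable_fun setT F by apply/measurable_EFinP; exact: measurable_funD.
have mF' : measurable_fun setT F'.
  by apply/measurable_EFinP; apply: measurable_funD => //; exact: measurable_funN.
have F0 z : (0 <= F z)%E.
  by rewrite lee_fin; have := fM z; rewrite ler_norml => /andP[]; lra.
have F'0 z : (0 <= F' z)%E.
  by rewrite lee_fin; have := fM z; rewrite ler_norml => /andP[]; lra.
have : (\int[Q n]_z F z = \int[Q n]_z F' z)%E.
  have H G : measurable_fun setT G -> (forall z, (0 <= G z)%E) ->
    (\int[Q n]_z G z = \int[rho]_s fubini_F (uniform_prob (jump_window n)) G s)%E.
    by move=> mG G0; exact: fubini_tonelli1.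
  rewrite (H _ mF F0) (H _ mF' F'0); apply: eq_integral => s _.
  have mFs : measurable_fun setT (fun v => F (s, v)) by exact: measurableT_comp.
  have mF's : measurable_fun setT (fun v => F' (s, v)) by exact: measurableT_comp.
  rewrite /fubini_F !integral_uniform//; congr (_ * _)%E.
  rewrite [LHS]integral_mkcond [RHS]integral_mkcond.
  rewrite ge0_integral_opp; last 2 first.
  - exact/(measurable_restrictT _ _).1/measurable_funTS.
  - by move=> v; exact: erestrict_ge0.
  apply: eq_integral => v _; rewrite !patchE !mem_setE !in_itv/= -!ler_norml normrN.
  by rewrite /F /F' fN.
have iQ (g : TR -> R) : measurable_fun setT g -> (forall z, `|g z| <= M) ->
    (Q n).-integrable setT (EFin \o g).
  by move=> mg gM; exact: (bounded_integrable _ mg gM).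
move=> /(congr1 fine).
have iM : (Q n).-integrable setT (EFin \o (fun=> M)).
  by apply: (bounded_integrable _ _ (M := `|M|)).
have mN : measurable_fun setT (fun z => - f z) by exact: measurable_funN.
have iN := iQ _ mN (fun z => eq_ind_r (fun x => x <= M) (fM z) (normrN (f z))).
rewrite -[LHS]/(\int[Q n]_z (f z + M)) -[RHS]/(\int[Q n]_z (- f z + M)).
rewrite !RintegralD//; last exact: iQ.
have -> : \int[Q n]_z (- f z) = - \int[Q n]_z f z.
  under eq_Rintegral do rewrite -mulN1r.
  by rewrite RintegralZl// ?mulN1r//; exact: iQ.
by lra.
Qed.

Lemma measurable_jump_term (c : T -> R) : measurable_fun setT c ->
  measurable_fun setT (fun z : TR => c z.1 * jump z.2).
Proof.
move=> mc; apply: measurable_funM; first exact: measurableT_comp mc _.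
exact: measurableT_comp (measurable_jump alpha) _.
Qed.

Lemma measurable_truncate e : measurable_fun setT (@truncate R e).
Proof.
by apply: measurable_fun_ifT => //; apply: measurable_fun_ler => //; exact: normr_measurable.
Qed.

Lemma normr_truncate e (x : R) : 0 <= e -> `|truncate e x| <= e.
Proof. by move=> e0; rewrite /truncate; case: ifPn => // _; rewrite normr0. Qed.

Lemma truncateN e (x : R) : truncate e (- x) = - truncate e x.
Proof. by rewrite /truncate normrN; case: ifPn => // _; rewrite oppr0. Qed.

Variables (c : T -> R) (C : R).
Hypotheses (mc : measurable_fun setT c)
  (cC : (\int[rho]_s (`|c s| `^ alpha)%:E <= C%:E)%E).

Let J (z : TR) := c z.1 * jump z.2.
Let mJ : measurable_fun setT J. Proof. exact: measurable_jump_term. Qed.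

Let C0 : 0 <= C.
Proof.
rewrite -lee_fin; apply: le_trans cC; apply: integral_ge0 => s _.
by rewrite lee_fin powR_ge0.
Qed.

Let levy_real n (psi : R -> R) (M L : R) : measurable_fun setT psi ->
  (forall x, 0 <= psi x <= M) -> psi 0 = 0 -> levy alpha psi = L%:E ->
  n.+1%:R * \int[Q n]_z psi `|J z| <= C * L.
Proof.
move=> mpsi psiM psi0 psiL; have psi_ge0 x : 0 <= psi x by have /andP[] := psiM x.
have H := jump_law_le rho alpha0 mpsi psi_ge0 psi0 mc n.
have iQ : (Q n).-integrable setT (EFin \o (fun z => psi `|J z|)).
  apply: (bounded_integrable _ _ (M := M)) => [|z]; last first.
    by have /andP[? ?] := psiM `|J z|; rewrite ger0_norm.
  apply: (measurableT_comp mpsi); exact: (measurableT_comp (@normr_measurable R setT)).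
rewrite -lee_fin EFinM fineK; last exact: integrable_fin_num.
rewrite (@le_trans _ _ (\int[rho]_s (`|c s| `^ alpha)%:E * levy alpha psi)%E)//.
  by apply: le_trans H; under eq_integral do rewrite normrM.
rewrite psiL EFinM lee_wpmul2r//.
by rewrite -psiL; apply: integral_ge0 => v _; rewrite lee_fin.
Qed.

Definition big_jumps n (e : R) (w : ps_sort (sample (Q n) n.+1)) : nat :=
  count (fun z => e < `|J z|) (draws w).

Definition small_sum n (e : R) (w : ps_sort (sample (Q n) n.+1)) : R :=
  \sum_(z <- draws w) truncate e (J z).

Local Notation PP n := (ps_prob (sample (Q n) n.+1)).

Let cntE n (e : R) (w : ps_sort (sample (Q n) n.+1)) :
  (big_jumps e w)%:R = \sum_(z <- draws w) (e < `|J z|)%R%:R :> R.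
Proof. by rewrite /big_jumps -sum1_count natr_sum big_mkcond; apply: eq_bigr => z _; case: ifP. Qed.

Let mB (e : R) : measurable_fun setT (fun z => (e < `|J z|)%R%:R : R).
Proof.
apply: (measurableT_comp (f := fun b : bool => b%:R : R)) => //.
apply: measurable_fun_ltr => //; exact: (measurableT_comp (@normr_measurable R setT)).
Qed.

Lemma measurable_big_jumps n e :
  measurable_fun setT (fun w : ps_sort (sample (Q n) n.+1) => (big_jumps e w)%:R : R).
Proof.
have -> : (fun w : ps_sort (sample (Q n) n.+1) => (big_jumps e w)%:R : R) =
    (fun w => \sum_(z <- draws w) (e < `|J z|)%R%:R) by apply/funext => w; exact: cntE.
exact: measurable_draws_sum.
Qed.

Lemma measurable_small_sum n e :
  measurable_fun setT (@small_sum n e).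
Proof. by apply: measurable_draws_sum; exact: (measurableT_comp (measurable_truncate e)). Qed.

Let tail_mean n (e : R) : 0 < e ->
  n.+1%:R * \int[Q n]_z (e < `|J z|)%R%:R <= C * (2 * e `^ (- alpha)).
Proof.
move=> e0; apply: (@levy_real n (fun x => (e < x)%R%:R) 1).
- by apply: (measurableT_comp (f := fun b : bool => b%:R : R)) => //; exact: measurable_fun_ltr.
- by move=> x; case: (e < x); rewrite lexx ler01.
- by rewrite ltNge ltW.
- exact: levy_indic_tail.
Qed.

Let B1 (e : R) z : `|(e < `|J z|)%R%:R : R| <= 1.
Proof. by case: (e < _); rewrite ?normr1 ?normr0. Qed.

Lemma prob_big_jumps_ge1 n e : 0 < e ->
  fine (PP n [set w | 1 <= (big_jumps e w)%:R :> R]) <= C * (2 * e `^ (- alpha)).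
Proof.
move=> e0; apply: le_trans (tail_mean n e0).
have E1 := expectation_draws_sum (Q n) n.+1 (mB e) (B1 e).
rewrite (eq_Rintegral _ (fun w _ => esym (cntE e w))) in E1.
rewrite mulr_natl -[leRHS]E1.
apply: (@fine_prob_le_expectation _ _ _ _ _ _ n.+1%:R) => //.
- exact: measurable_ge_set (@measurable_big_jumps n e).
- exact: measurable_big_jumps.
- move=> w; rewrite ler0n ler_nat; apply: leq_trans (count_size _ _) _.
  by rewrite size_draws.
Qed.

(** Markov's inequality for [N^2 - N], [N] the number of large jumps. An indicator equals its
    square, so the diagonal cancels and the mean is [(n + 1) n q^2]. The square gained here
    outweighs the later union bound over the coordinates. *)
Lemma prob_big_jumps_ge2 n e : 0 < e ->
  fine (PP n [set w | 2 <= (big_jumps e w)%:R :> R]) <= (C * (2 * e `^ (- alpha))) ^+ 2.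
Proof.
move=> e0; set q := \int[Q n]_z (e < `|J z|)%R%:R.
have q0 : 0 <= q by apply: Rintegral_ge0 => z _; rewrite ler0n.
have szb (w : ps_sort (sample (Q n) n.+1)) : (big_jumps e w <= n.+1)%N.
  by apply: leq_trans (count_size _ _) _; rewrite size_draws.
have E1 := expectation_draws_sum (Q n) n.+1 (mB e) (B1 e).
have E2 := expectation_draws_sqr (Q n) n.+1 (mB e) (B1 e).
have B2 z : ((e < `|J z|)%R%:R : R) ^+ 2 = (e < `|J z|)%R%:R.
  by case: (e < _); rewrite ?expr1n ?expr0n.
rewrite (eq_Rintegral _ (fun w _ => esym (cntE e w))) -/q in E1.
rewrite (eq_Rintegral _ (fun w _ => congr1 (fun x => x ^+ 2) (esym (cntE e w)))) in E2.
rewrite (eq_Rintegral _ (fun z _ => B2 z)) -/q in E2.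
have mb := @measurable_big_jumps n e.
have bb (w : ps_sort (sample (Q n) n.+1)) : `|(big_jumps e w)%:R : R| <= n.+1%:R.
  by rewrite ger0_norm// ler_nat.
have bb2 (w : ps_sort (sample (Q n) n.+1)) : `|((big_jumps e w)%:R : R) ^+ 2| <= n.+1%:R ^+ 2.
  by rewrite normrX lerXn2r ?nnegrE// bb.
apply: (@le_trans _ _ (\int[PP n]_w (((big_jumps e w)%:R) ^+ 2 - (big_jumps e w)%:R))).
  apply: (@fine_prob_le_expectation _ _ _ _ _ _ (n.+1%:R ^+ 2)) => //.
  - exact: measurable_ge_set.
  - by apply: measurable_funB => //; exact: measurable_funX.
  - move=> w; apply/andP; split; last first.
      by rewrite lerBlDr (le_trans (ler_norm _))// (le_trans (bb2 w))// lerDl.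
    by rewrite subr_ge0 -natrX ler_nat; case: (big_jumps e w) => // p; rewrite leq_pmulr.
  - by move=> w /= w2; nra.
rewrite RintegralB//; last 2 first.
- by apply: bounded_integrable bb2; exact: measurable_funX.
- exact: bounded_integrable bb.
rewrite E1 E2 addrAC subrr add0r.
have := tail_mean n e0; rewrite -/q => tq.
apply: (@le_trans _ _ ((n.+1%:R * q) ^+ 2)).
  rewrite exprMn -[leLHS]mulr_natl ler_wpM2r ?sqr_ge0// -natrX ler_nat.
  by rewrite /= leq_mul.
have nq0 : 0 <= n.+1%:R * q by rewrite mulr_ge0.
by rewrite lerXn2r ?nnegrE// (le_trans nq0 tq).
Qed.

(** Chebyshev's inequality: truncated jumps are symmetric, hence centered, and only the diagonal of
    the second moment survives. Its size [e^(2 - alpha)] is the scaling of the truncated second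
    moment of the Levy measure. *)
Lemma prob_small_sum_gt n e delta : 0 < e -> 0 < delta ->
  fine (PP n [set w | delta < `|small_sum e w|]) <=
  C * (e `^ (2 - alpha) * levy_sqr alpha) / delta ^+ 2.
Proof.
move=> e0 d0; pose h z := truncate e (J z).
have mh : measurable_fun setT h by exact: (measurableT_comp (measurable_truncate e)).
have bh z : `|h z| <= e by exact/normr_truncate/ltW.
have E2 := expectation_draws_sqr (Q n) n.+1 mh bh.
rewrite (jump_law_odd n mh bh) ?expr0n ?mul0rn ?addr0 in E2; last first.
  by move=> s v; rewrite /h /J/= jumpN// mulrN truncateN.
have ms := @measurable_small_sum n e.
have bs (w : ps_sort (sample (Q n) n.+1)) := @draws_sum_bounded _ _ _ (Q n) n.+1 h e bh w.
have bs2 (w : ps_sort (sample (Q n) n.+1)) : `|small_sum e w ^+ 2| <= (e *+ n.+1) ^+ 2.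
  have en0 : 0 <= e *+ n.+1 by rewrite mulrn_wge0// ltW.
  by rewrite normrX lerXn2r ?nnegrE//; exact: bs.
have d2 : 0 < delta ^+ 2 by rewrite exprn_gt0.
rewrite ler_pdivlMr//; apply: (@le_trans _ _ (\int[PP n]_w (small_sum e w) ^+ 2)).
  rewrite -ler_pdivlMr// mulrC -RintegralZl//; last first.
    by apply: bounded_integrable bs2; exact: measurable_funX.
  apply: (@fine_prob_le_expectation _ _ _ _ _ _ ((delta ^+ 2)^-1 * (e *+ n.+1) ^+ 2)) => //.
  - by apply: measurable_ltr_set; exact: (measurableT_comp (@normr_measurable R setT)).
  - by apply: measurable_funM => //; exact: measurable_funX.
  - move=> w; rewrite mulr_ge0 ?invr_ge0 ?sqr_ge0//=.
    by rewrite ler_pM2l ?invr_gt0// (le_trans (ler_norm _) (bs2 w)).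
  - move=> w /= w1; rewrite mulrC ler_pdivlMr// mul1r -[leRHS]real_normK ?num_real//.
    by rewrite lerXn2r ?nnegrE// ltW.
rewrite [leLHS]E2 -[leLHS]mulr_natl.
have hE z : h z ^+ 2 = sqr_upto e `|J z|.
  by rewrite /h /truncate /sqr_upto normr_id; case: ifPn => _; rewrite ?expr0n// real_normK// num_real.
rewrite (eq_Rintegral _ (fun z _ => hE z)).
apply: (@levy_real n _ (e ^+ 2)).
- exact: measurable_sqr_upto.
- move=> x; rewrite sqr_upto_ge0/= /sqr_upto; case: ifPn => [xe|_]; last exact: sqr_ge0.
  by rewrite -real_normK ?num_real// lerXn2r ?nnegrE// ltW.
- by rewrite /sqr_upto expr0n if_same.
- exact: levy_sqr_upto.
Qed.

End jump_sums.

(** * Maxima of stable vectors with bounded kernels *)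

Section stable_maxima.
Context {R : realType} {d} {T : measurableType d} (rho : probability T R).
Variable alpha : R.
Hypotheses (alpha0 : 0 < alpha) (alpha2 : alpha < 2).
Variables (k : nat) (g : 'I_k -> T -> R) (b C : R).
Hypotheses (mg : forall i, measurable_fun setT (g i)) (b0 : 0 < b).
Hypotheses (gb : forall i s, `|g i s| <= b)
  (gC : forall i, (\int[rho]_s (`|g i s| `^ alpha)%:E <= C%:E)%E).
Context {dO} {Omega : measurableType dO} (P : probability Omega R).
Variable X : 'I_k -> Omega -> R.
Hypothesis mX : forall i, measurable_fun setT (X i).
Hypothesis cosX : forall (l : seq (R * 'I_k)) c,
  \int[P]_w cos (linform l (X ^~ w) + c) = cos c *
  expR (- (levy_cos alpha * fine (\int[rho]_s (`|linform l (g ^~ s)| `^ alpha)%:E)%E)).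

Local Notation jump := (jump alpha).
Local Notation Q n := (jump_law rho n).
Local Notation TR := (T * measurableTypeR R)%type.
Local Notation PP n := (ps_prob (sample (Q n) n.+1)).

Let W n (i : 'I_k) (w : ps_sort (sample (Q n) n.+1)) : R :=
  \sum_(z <- draws w) g i z.1 * jump z.2.
Arguments W : clear implicits.

Let icst n (r : R) : (Q n).-integrable setT (EFin \o (fun=> r)).
Proof. by apply: (@bounded_integrable _ _ _ (Q n) _ `|r|). Qed.

Let mW n i : measurable_fun setT (W n i).
Proof. by apply: measurable_draws_sum; exact: measurable_jump_term. Qed.

Let mlin (l : seq (R * 'I_k)) : measurable_fun setT (fun s => linform l (g ^~ s)).
Proof. exact: (measurable_linform mg). Qed.

Let linW n l (w : ps_sort (sample (Q n) n.+1)) :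
  linform l (W n ^~ w) = \sum_(z <- draws w) linform l (g ^~ z.1) * jump z.2.
Proof.
rewrite /linform /W; under eq_bigr do rewrite mulr_sumr.
rewrite exchange_big/=; apply: eq_bigr => z _; rewrite mulr_suml.
by apply: eq_bigr => p _; rewrite mulrA.
Qed.

Let lin_bounded (l : seq (R * 'I_k)) : exists M, forall s, `|linform l (g ^~ s)| <= M.
Proof.
exists (\sum_(p <- l) `|p.1| * b) => s.
rewrite (le_trans (ler_norm_sum _ _ _))//; apply: ler_sum => p _.
by rewrite normrM ler_wpM2l.
Qed.

Let lin_fin (l : seq (R * 'I_k)) :
  (\int[rho]_s (`|linform l (g ^~ s)| `^ alpha)%:E)%E \is a fin_num.
Proof.
have [M MP] := lin_bounded l.
have M0 : 0 <= M by apply: le_trans (MP point).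
apply: (@integrable_fin_num _ _ _ rho setT measurableT).
apply: (@bounded_integrable _ _ _ rho (fun s => `|linform l (g ^~ s)| `^ alpha) (M `^ alpha)).
  apply: (measurableT_comp (measurable_powR alpha)).
  exact: (measurableT_comp (@normr_measurable R setT) (mlin l)).
by move=> s; rewrite ger0_norm ?powR_ge0// ge0_ler_powR ?nnegrE// ltW.
Qed.

(** A linear form of the sums is again a jump sum, with kernel [linform l g]. Oddness kills the sine
    and leaves [cos c] times a power of [1 - a_n / (n + 1)], where [a_n] converges to the
    characteristic exponent. *)
Lemma jump_sums_cos_cvg (l : seq (R * 'I_k)) c :
  \int[PP n]_w cos (linform l (W n ^~ w) + c) @[n --> \oo] -->
  \int[P]_w cos (linform l (X ^~ w) + c).
Proof.
rewrite cosX; set A := fine _.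
pose h (z : TR) := linform l (g ^~ z.1) * jump z.2.
have mh : measurable_fun setT h by exact: (measurable_jump_term alpha (mlin l)).
have mcos : measurable_fun setT (@cos R) by exact: (continuous_measurable_fun (@continuous_cos R)).
have msin : measurable_fun setT (@sin R) by exact: (continuous_measurable_fun (@continuous_sin R)).
have sin0' n : \int[Q n]_z sin (h z) = 0.
  apply: (@jump_law_odd _ _ _ _ n _ 1).
  - exact: (measurableT_comp msin).
  - by move=> z; exact: sin_max.
  - by move=> s v; rewrite /h/= jumpN// mulrN sinN.
pose a_ n := n.+1%:R * \int[Q n]_z (1 - cos (h z)).
have i1 n : (Q n).-integrable setT (EFin \o (fun z => cos (h z))).
  apply: (@bounded_integrable _ _ _ (Q n) _ 1) => [|z]; last exact: cos_max.
  exact: (measurableT_comp mcos).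
have i2 n : (Q n).-integrable setT (EFin \o (fun z => 1 - cos (h z))).
  apply: (@bounded_integrable _ _ _ (Q n) _ (1 + 1)) => [|z].
    by apply: measurable_funB => //; exact: (measurableT_comp mcos).
  by rewrite (le_trans (ler_normB _ _))// normr1 lerD2l cos_max.
have E n : \int[PP n]_w cos (linform l (W n ^~ w) + c) =
    cos c * (1 - a_ n / n.+1%:R) ^+ n.+1.
  have [Ec Es] := expectation_draws_cos n.+1 mh (sin0' n).
  have mS := @measurable_draws_sum _ _ _ (Q n) n.+1 h mh.
  have j1 : (PP n).-integrable setT (EFin \o (fun w => cos (\sum_(z <- draws w) h z))).
    apply: (@bounded_integrable _ _ _ (PP n) _ 1) => [|w]; last exact: cos_max.
    exact: (measurableT_comp mcos).
  have j2 : (PP n).-integrable setT (EFin \o (fun w => sin (\sum_(z <- draws w) h z))).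
    apply: (@bounded_integrable _ _ _ (PP n) _ 1) => [|w]; last exact: sin_max.
    exact: (measurableT_comp msin).
  transitivity (\int[PP n]_w (cos c * cos (\sum_(z <- draws w) h z) -
      sin c * sin (\sum_(z <- draws w) h z))).
    by apply: eq_Rintegral => w _; rewrite linW cosD -/(h _) [cos c * _]mulrC [sin c * _]mulrC.
  rewrite RintegralB//; last 2 first.
  - exact: (integrableZl measurableT (cos c) j1).
  - exact: (integrableZl measurableT (sin c) j2).
  rewrite !RintegralZl// Ec Es mulr0 subr0; congr (_ * _ ^+ _).
  rewrite /a_ mulrAC divff ?mul1r ?gt_eqF// RintegralB//; last 2 first.
  - exact: icst.
  - exact: i1.
  by rewrite Rintegral_prob_cst opprB addrC subrK.
under eq_fun do rewrite E.
apply: cvgM; first exact: cvg_cst.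
apply: cvg_one_sub_expn.
- have psi0 : 1 - cos 0 = 0 :> R by rewrite cos0 subrr.
  have := @jump_law_cvg _ _ _ rho alpha alpha0 (fun x => 1 - cos x) _
    measurable_one_sub_cos (@one_sub_cos_ge0 R) psi0 (mlin l).
  rewrite levy_cosE// -(fineK (lin_fin l)) -EFinM -/A mulrC => /fine_cvgP[_ +].
  rewrite (_ : fine \o _ = a_)//; apply/funext => n /=; rewrite /a_.
  rewrite fineM//; last first.
    rewrite (eq_integral (fun z => (1 - cos (h z))%:E)); last first.
      by move=> z _; rewrite -normrM cos_norm.
    exact: (integrable_fin_num _ (i2 n)).
  congr (_ * _); apply: eq_Rintegral => z _.
  by rewrite -normrM cos_norm.
- apply: mulr_ge0; first exact/ltW/levy_cos_gt0.
  by apply: fine_ge0; apply: integral_ge0 => s _; rewrite lee_fin powR_ge0.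
- by move=> n; rewrite mulr_ge0// Rintegral_ge0// => z _; exact: one_sub_cos_ge0.
Qed.

Let mall n m : measurable_fun setT (fun w : ps_sort (sample (Q n) n.+1) =>
  \prod_(z <- draws w) (b * `|jump z.2| <= m)%R%:R : R).
Proof.
apply: measurable_draws_prod.
apply: (measurableT_comp (f := fun b : bool => b%:R : R)) => //.
apply: measurable_fun_ler => //; apply: measurable_funM => //.
apply: (measurableT_comp (@normr_measurable R setT)).
exact: (measurableT_comp (measurable_jump alpha)).
Qed.

(** Since [b] bounds all kernels, the number [b |jump v|] bounds the jump in every coordinate at
    once. The event ignores the component in [T], so its probability is explicit. *)
Definition no_jump_above n m : set (ps_sort (sample (Q n) n.+1)) :=
  [set w : ps_sort (sample (Q n) n.+1) |
    all (fun z : TR => (b * `|jump z.2| <= m)%R) (draws w)].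

Let prodE n m (w : ps_sort (sample (Q n) n.+1)) :
  \prod_(z <- draws w) (b * `|jump z.2| <= m)%R%:R = \1_(no_jump_above m) w :> R.
Proof.
have H (s : seq TR) : \prod_(z <- s) (b * `|jump z.2| <= m)%R%:R =
    (all (fun z : TR => (b * `|jump z.2| <= m)%R) s)%:R :> R.
  elim: s => [|z s IH] /=; first by rewrite big_nil.
  by rewrite big_cons IH; case: (_ <= m); rewrite ?mul1r ?mul0r.
rewrite H indicE; congr ((nat_of_bool _)%:R); apply/idP/idP => [?|/set_mem//].
exact: mem_set.
Qed.

Lemma measurable_no_jump_above n m : measurable (@no_jump_above n m).
Proof.
suff -> : @no_jump_above n m = [set w : ps_sort (sample (Q n) n.+1) |
    1 <= \prod_(z <- draws w) (b * `|jump z.2| <= m)%R%:R :> R].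
  exact: measurable_ge_set (@mall n m).
apply/seteqP; split => w /=; rewrite prodE indicE.
  by move=> wm; rewrite mem_set.
by case: (boolP (w \in _)) => [/set_mem//|_]; rewrite ler10.
Qed.

(** Once the window contains all [v] with [b |jump v| > m], the expected number of such points no
    longer depends on [n]; the probability is then a power of the form [(1 - a / N)^N] with fixed
    [a]. *)
Lemma prob_no_jump_above_cvg m : 0 < m ->
  fine (PP n (@no_jump_above n m)) @[n --> \oo] --> expR (- (2 * b `^ alpha * m `^ (- alpha))).
Proof.
move=> m0.
pose q n := \int[Q n]_z (m < b * `|jump z.2|)%R%:R.
have mb : measurable_fun setT (fun z : TR => (m < b * `|jump z.2|)%R%:R : R).
  apply: (measurableT_comp (f := fun b : bool => b%:R : R)) => //.
  apply: measurable_fun_ltr => //; apply: measurable_funM => //.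
  apply: (measurableT_comp (@normr_measurable R setT)).
  exact: (measurableT_comp (measurable_jump alpha)).
have iq n : (Q n).-integrable setT (EFin \o (fun z => (m < b * `|jump z.2|)%R%:R)).
  apply: (@bounded_integrable _ _ _ (Q n) _ 1) => // z.
  by case: (m < _); rewrite ?normr1 ?normr0.
have E n : fine (PP n (@no_jump_above n m)) = (1 - (n.+1%:R * q n) / n.+1%:R) ^+ n.+1.
  rewrite -Rintegral_indic; last exact: measurable_no_jump_above.
  rewrite -(eq_Rintegral _ (fun w _ => prodE m w)).
  have mb' : measurable_fun setT (fun z : TR => (b * `|jump z.2| <= m)%R%:R : R).
    apply: (measurableT_comp (f := fun b : bool => b%:R : R)) => //.
    apply: measurable_fun_ler => //; apply: measurable_funM => //.
    apply: (measurableT_comp (@normr_measurable R setT)).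
    exact: (measurableT_comp (measurable_jump alpha)).
  rewrite (expectation_draws_prod _ n.+1 mb'); last first.
    by move=> z; case: (_ <= m); rewrite ?normr1 ?normr0.
  congr (_ ^+ _); rewrite mulrAC divff ?mul1r ?gt_eqF//.
  rewrite -[X in X - _](Rintegral_prob_cst (Q n)) -RintegralB//; last 2 first.
  - exact: icst.
  - exact: iq.
  by apply: eq_Rintegral => z _; rewrite ltNge; case: (_ <= m); rewrite ?subr0 ?subrr.
under eq_fun do rewrite E.
have ba : (0 < b `^ alpha * m `^ (- alpha)) by rewrite mulr_gt0// powR_gt0.
apply: cvg_one_sub_expn; last 2 first.
- by rewrite -mulrA mulr_ge0// ltW.
- by move=> n; rewrite mulr_ge0// Rintegral_ge0.
apply: cvg_near_cst; near=> n.
have n0 : 0 < n.+1%:R :> R by [].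
pose psi (x : R) : R := (m < x)%R%:R.
have mpsi : measurable_fun setT psi.
  by apply: (measurableT_comp (f := fun b : bool => b%:R : R)) => //; exact: measurable_fun_ltr.
have psi_ge0 x : 0 <= psi x by rewrite ler0n.
have psi0 : psi 0 = 0 by rewrite /psi ltNge ltW.
have H := @jump_law_eventually _ _ _ rho alpha alpha0 psi (cst b) mpsi psi_ge0 psi0
  (measurable_cst b) n ((m / b) `^ (- alpha)).
have : (n.+1%:R%:E * \int[Q n]_z (psi (`|cst b z.1| * `|jump z.2|))%:E =
  (\int[rho]_s (`|cst b s| `^ alpha)%:E) * levy alpha psi)%E.
  apply: H => [z|].
    rewrite /psi/= gtr0_norm// -ltr_pdivrMl// mulrC normr_jump_gt ?divr_gt0//.
    by case: (z.2 == 0) => //=; case: ltP => [/ltW//|]; rewrite eqxx.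
  apply: (@le_trans _ _ n%:R); last by rewrite ler_nat.
  by near: n; exact: nbhs_infty_ger.
have -> : (\int[rho]_s (`|cst b s| `^ alpha)%:E = (b `^ alpha)%:E)%E.
  rewrite (eq_integral (cst (b `^ alpha)%:E)); last by move=> s _; rewrite /= gtr0_norm.
  by rewrite integral_cst// [X in (_ * X)%E](probability_setT rho) mule1.
rewrite levy_indic_tail// -EFinM/= gtr0_norm//.
move=> /(congr1 fine)/=; rewrite fineM//; last first.
  exact: (integrable_fin_num _ (iq n)).
by rewrite /= mulrA [_ * 2]mulrC => <-.
Unshelve. all: by end_near. Qed.

Let bad n e delta : set (ps_sort (sample (Q n) n.+1)) :=
  [set w | exists2 i, i \in enum 'I_k &
    ([set w | 2 <= (@big_jumps _ _ _ rho alpha (g i) n e w)%:R :> R] `|`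
     [set w | delta < `|@small_sum _ _ _ rho alpha (g i) n e w|]) w].

(* Markov bound for two jumps above [e], plus Chebyshev bound for a sum of jumps
   below [e] exceeding [delta], summed over the [k] coordinates. *)
Definition bad_bound (e delta : R) : R :=
  k%:R * ((C * (2 * e `^ (- alpha))) ^+ 2 +
    C * (e `^ (2 - alpha) * levy_sqr alpha) / delta ^+ 2).

Let mbigs n e i : measurable [set w | 2 <= (@big_jumps _ _ _ rho alpha (g i) n e w)%:R :> R].
Proof. exact: measurable_ge_set (@measurable_big_jumps _ _ _ rho alpha (g i) (mg i) n e). Qed.

Let msmall n e delta i :
  measurable [set w | delta < `|@small_sum _ _ _ rho alpha (g i) n e w|].
Proof.
apply: measurable_ltr_set; apply: (measurableT_comp (@normr_measurable R setT)).
exact: (@measurable_small_sum _ _ _ rho alpha (g i) (mg i) n e).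
Qed.

Let mbad n e delta : measurable (@bad n e delta).
Proof. by apply: measurable_exists_seq => i; exact: measurableU. Qed.

Let prob_bad n e delta : 0 < e -> 0 < delta ->
  fine (PP n (bad e delta)) <= bad_bound e delta.
Proof.
move=> e0 d0; rewrite /bad_bound -[X in X%:R](size_enum_ord k).
apply: fine_prob_exists_seq => i.
  exact: measurableU.
rewrite (le_trans (fine_probU _ _ _))//.
apply: lerD.
- exact: prob_big_jumps_ge2.
- exact: prob_small_sum_gt.
Qed.

Let J (y : R) := [seq (i, (0 : R, y)) | i <- enum 'I_k].

Let in_boxJ y eta (x : 'I_k -> R) : in_boxes (J y) eta x <-> forall i, `|x i| <= y + eta.
Proof.
split=> [xJ i|xy j /mapP[i _ ->]]; last by rewrite /= subr0.
have := xJ (i, (0, y)); rewrite /= subr0; apply.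
by apply/mapP; exists i => //; rewrite mem_enum.
Qed.

(* Without jumps above [K] the sum is its truncation, so Chebyshev gives a tail
   of order [K^(-alpha)], uniformly in [n]. *)
Let W_tight (c e : R) : 0 < e ->
  \forall K \near +oo, \forall n \near \oo,
     1 - e <= fine (PP n (box (W n) (centers (J c)) K)).
Proof.
move=> e0; pose D := k%:R * (C * (2 + levy_sqr alpha)).
near=> K; near=> n.
have K0 : 0 < K by near: K; exact: nbhs_pinfty_gt.
pose A i := [set w | 1 <= (@big_jumps _ _ _ rho alpha (g i) n K w)%:R :> R] `|`
  [set w | K < `|@small_sum _ _ _ rho alpha (g i) n K w|].
have mA i : measurable (A i).
  apply: measurableU; last exact: msmall.
  exact: measurable_ge_set (@measurable_big_jumps _ _ _ rho alpha (g i) (mg i) n K).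
pose B := [set w | exists2 i, i \in enum 'I_k & A i w].
have mB : measurable B by exact: measurable_exists_seq.
have mbox := box_measurable (@mW n) (centers (J c)) K.
rewrite -[X in _ <= fine (PP n X)]setCK fine_probC; last exact: measurableC.
rewrite lerD2l lerN2; apply: (@le_trans _ _ (fine (PP n B))).
  apply: le_fine_prob => //; first exact: measurableC.
  move=> w; apply: contra_notP => nB _ /mapP[_ /mapP[i _ ->] ->] /=.
  rewrite subr0 add0r.
  have [/negP c2 /negP s2] : ~ (1 <= (@big_jumps _ _ _ rho alpha (g i) n K w)%:R :> R) /\
      ~ (K < `|@small_sum _ _ _ rho alpha (g i) n K w|).
    by split=> ?; apply: nB; exists i; rewrite ?mem_enum//; [left|right].
  rewrite -leNgt in s2; rewrite ler1n -eqn0Ngt /big_jumps -size_filter size_eq0 in c2.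
  by rewrite /W (sum_truncate_big K) (eqP c2) big_nil addr0.
apply: (@le_trans _ _ (D * K `^ (- alpha))).
  apply: (@le_trans _ _ ((size (enum 'I_k))%:R *
      (C * (2 * K `^ (- alpha)) + C * (K `^ (2 - alpha) * levy_sqr alpha) / K ^+ 2))).
    apply: fine_prob_exists_seq => // i.
    rewrite (le_trans (fine_probU _ _ _))//.
      exact: measurable_ge_set (@measurable_big_jumps _ _ _ rho alpha (g i) (mg i) n K).
    by apply: lerD; [exact: prob_big_jumps_ge1|exact: prob_small_sum_gt].
  rewrite size_enum_ord /D powRB; last by rewrite (gt_eqF K0) implybT.
  rewrite powR_mulrn ?(ltW K0)// powRN le_eqVlt; apply/orP; left; apply/eqP.
  by field; rewrite !gt_eqF// ?powR_gt0.
have [D0|D0] := leP D 0.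
  by rewrite (@le_trans _ _ 0) ?(ltW e0)// mulr_le0_ge0// powR_ge0.
rewrite powRN ler_pdivrMr ?powR_gt0// -ler_pdivrMl//.
have De : 0 <= e^-1 * D by rewrite mulr_ge0 ?invr_ge0 ?(ltW e0) ?(ltW D0).
have KD : (e^-1 * D) `^ alpha^-1 <= K by near: K; apply: nbhs_pinfty_ge; rewrite num_real.
have := ge0_ler_powR (ltW alpha0) _ _ KD; rewrite !nnegrE powR_ge0 (ltW K0).
by rewrite -powRrM mulVf ?gt_eqF// powRr1//; apply.
Unshelve. all: by end_near. Qed.

(** The margin [delta] is spent in halves. Off the bad event, jumps below [y - delta] keep every sum
    within [y - delta / 2]; the other half is the enlargement of the box in the limit. *)
Lemma prob_stable_max_ge e delta y : 0 < e -> 0 < delta < y ->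
  expR (- (2 * b `^ alpha * (y - delta) `^ (- alpha))) - bad_bound e (delta / 2) <=
  fine (P [set w | forall i, `|X i w| <= y]).
Proof.
move=> e0 /andP[d0 dy].
have -> : [set w | forall i, `|X i w| <= y] = box X (J (y - delta / 2)) (delta / 2).
  apply/seteqP; split => w /=; rewrite /box/= in_boxJ subrK//.
set z := _ - _; apply/ler_addgt0Pr => eta eta0; rewrite -lerBlDr.
apply: (prob_box_limit_ge mX mW jump_sums_cos_cvg).
- by rewrite divr_gt0.
- by move=> j /mapP[i _ ->] /=; lra.
have m0 : 0 < y - delta by lra.
near=> n.
have zn : expR (- (2 * b `^ alpha * (y - delta) `^ (- alpha))) - eta <=
    fine (PP n (@no_jump_above n (y - delta))).
  near: n; apply: (cvgr_ge _ (prob_no_jump_above_cvg m0)).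
  by rewrite ltrBlDr ltrDl.
have d20 : 0 < delta / 2 by rewrite divr_gt0.
have := prob_bad n e0 d20.
have mb := @mbad n e (delta / 2).
have mno := @measurable_no_jump_above n (y - delta).
have mbox := box_measurable (@mW n) (J (y - delta / 2)) 0.
have : fine (PP n (@no_jump_above n (y - delta))) <=
    fine (PP n (box (W n) (J (y - delta / 2)) 0)) + fine (PP n (@bad n e (delta / 2))).
  rewrite (le_trans _ (fine_probU _ mbox mb))//; apply: le_fine_prob => //.
    exact: measurableU.
  move=> w wno; have [|nbad] := pselect (@bad n e (delta / 2) w); first by right.
  left; rewrite /box/= in_boxJ addr0 => i.
  have [/negP c2 /negP s2] : ~ (2 <= (@big_jumps _ _ _ rho alpha (g i) n e w)%:R :> R) /\
      ~ (delta / 2 < `|@small_sum _ _ _ rho alpha (g i) n e w|).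
    by split=> ?; apply: nbad; exists i; rewrite ?mem_enum//; [left|right].
  rewrite -leNgt in s2; rewrite ler_nat -ltnNge in c2.
  have -> : y - delta / 2 = (y - delta) + delta / 2 by lra.
  apply: normr_sum_le_of_small_jumps c2 s2 _ _; first exact: ltW.
  apply: sub_all wno => v /=; apply: le_trans.
  by rewrite normrM ler_wpM2r.
rewrite /z; lra.
Unshelve. all: by end_near. Qed.

Hypothesis gmax : forall s, exists i, `|g i s| = b.

(** Here the bound [b] has to be attained: a point with [b |jump v| > y + delta] exceeds this level
    in a coordinate [i] with [|g i| = b], and off the bad event the remaining terms of that sum
    cannot compensate it. *)
Lemma prob_stable_max_le e delta y : 0 < delta -> 0 <= y -> 0 < e <= y + delta ->
  fine (P [set w | forall i, `|X i w| <= y]) <=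
  expR (- (2 * b `^ alpha * (y + delta) `^ (- alpha))) + bad_bound e (delta / 2).
Proof.
move=> d0 y0 /andP[e0 ey].
have -> : [set w | forall i, `|X i w| <= y] = box X (J y) 0.
  by apply/seteqP; split => w /=; rewrite /box/= in_boxJ addr0.
set z := _ + _; apply/ler_addgt0Pr => eta eta0.
have d20 : 0 < delta / 2 by rewrite divr_gt0.
apply: (prob_box_limit_le mX mW jump_sums_cos_cvg d20).
- by move=> j /mapP[i _ ->].
- exact: W_tight.
have m0 : 0 < y + delta by lra.
near=> n.
have zn : fine (PP n (@no_jump_above n (y + delta))) <=
    expR (- (2 * b `^ alpha * (y + delta) `^ (- alpha))) + eta.
  near: n; apply: (cvgr_le _ (prob_no_jump_above_cvg m0)).
  by rewrite ltrDl.
have := prob_bad n e0 d20.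
have mb := @mbad n e (delta / 2).
have mno := @measurable_no_jump_above n (y + delta).
have mbox := box_measurable (@mW n) (J y) (delta / 2).
have : fine (PP n (box (W n) (J y) (delta / 2))) <=
    fine (PP n (@no_jump_above n (y + delta))) + fine (PP n (@bad n e (delta / 2))).
  rewrite (le_trans _ (fine_probU _ mno mb))//; apply: le_fine_prob => //.
    exact: measurableU.
  rewrite /box => w /= /in_boxJ wbox.
  have [|nbad] := pselect (@bad n e (delta / 2) w); first by right.
  left; apply/negP => /negP; rewrite -has_predC => /hasP[v vw /=]; rewrite -ltNge => vy.
  have [i gi] := gmax v.1.
  have [/negP c2 /negP s2] : ~ (2 <= (@big_jumps _ _ _ rho alpha (g i) n e w)%:R :> R) /\
      ~ (delta / 2 < `|@small_sum _ _ _ rho alpha (g i) n e w|).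
    by split=> ?; apply: nbad; exists i; rewrite ?mem_enum//; [left|right].
  rewrite -leNgt in s2; rewrite ler_nat -ltnNge in c2.
  have em : e <= y + delta / 2 + delta / 2 by lra.
  have := normr_sum_gt_of_big_jump c2 s2 em.
  rewrite ltNge (wbox i) => H; suff /H : has (fun z : TR =>
      y + delta / 2 + delta / 2 < `|g i z.1 * jump z.2|) (draws w) by [].
  by apply/hasP; exists v => //; rewrite normrM gi; apply: le_lt_trans vy; lra.
rewrite /z; lra.
Unshelve. all: by end_near. Qed.

End stable_maxima.

(** * Stable integrals *)

Section power_integral.
Context {R : realType} {d} {S : measurableType d} (m : {measure set S -> \bar R}).
Variable alpha : R.
Hypothesis alpha_gt0 : 0 < alpha.
Implicit Types h : S -> R.
Local Open Scope ereal_scope.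

(** The [alpha]-th power of the norm of [L^alpha]. For [alpha < 1] that is no norm; for every
    [alpha > 0] the quasi-triangle inequality [powintD], which rests on
    [|x + y| <= 2 max (|x|, |y|)], is enough. *)
Definition powint h := \int[m]_s (`|h s| `^ alpha)%:E.

Lemma powint_ge0 h : 0 <= powint h.
Proof. by apply: integral_ge0 => s _; rewrite lee_fin powR_ge0. Qed.

Lemma measurable_absX h : measurable_fun setT h ->
  measurable_fun setT (fun s => `|h s| `^ alpha)%R.
Proof.
move=> mh; apply: (measurableT_comp (measurable_powR _)) => //.
exact: measurableT_comp.
Qed.

Lemma powint_LnormE h : Lnorm m alpha%:E (fun s => (h s)%:E) = powint h `^ alpha^-1.
Proof.
rewrite unlock; congr (_ `^ _).
Qed.

Lemma mem_LfunP h :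
  h \in Lfun m alpha%:E <-> measurable_fun setT h /\ powint h < +oo.
Proof.
have E : (Lnorm m alpha%:E (EFin \o h) < +oo) <-> (powint h < +oo).
  rewrite (_ : EFin \o h = fun s => (h s)%:E)// powint_LnormE; split.
    by apply: lty_poweRy; rewrite invr_neq0// gt_eqF.
  exact: poweR_lty.
split.
  by rewrite inE => /andP[/[!inE]/= mh /E].
by move=> [mh /E hy]; rewrite inE; apply/andP; split; rewrite inE.
Qed.

Lemma powintZ a h : measurable_fun setT h ->
  powint (fun s => a * h s)%R = (`|a| `^ alpha)%:E * powint h.
Proof.
move=> mh; rewrite /powint -ge0_integralZl//; first last.
- by apply/measurable_EFinP; exact: measurable_absX.
by apply: eq_integral => s _; rewrite normrM powRM.
Qed.

Lemma powR_add_le (x y : R) : (`|x + y| `^ alpha <=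
  2 `^ alpha * (`|x| `^ alpha + `|y| `^ alpha))%R.
Proof.
have H (a b : R) : (0 <= a <= b -> (a + b) `^ alpha <= 2 `^ alpha * (a `^ alpha + b `^ alpha))%R.
  move=> /andP[a0 ab]; have b0 := le_trans a0 ab.
  apply: (@le_trans _ _ ((2 * b) `^ alpha)%R).
    by apply: ge0_ler_powR; rewrite ?nnegrE; [exact: ltW|lra..].
  by rewrite powRM// ler_pM2l ?powR_gt0// lerDr powR_ge0.
apply: (@le_trans _ _ ((`|x| + `|y|) `^ alpha)%R).
  by apply: ge0_ler_powR; rewrite ?nnegrE ?addr_ge0 ?(ltW alpha_gt0)// ler_normD.
have [xy|/ltW yx] := leP `|x|%R `|y|%R; first by apply: H; rewrite normr_ge0.
by rewrite addrC [X in (_ <= _ * X)%R]addrC; apply: H; rewrite normr_ge0.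
Qed.

Lemma powintD h1 h2 : measurable_fun setT h1 -> measurable_fun setT h2 ->
  powint (fun s => h1 s + h2 s)%R <= (2 `^ alpha)%:E * (powint h1 + powint h2).
Proof.
move=> m1 m2; have m1' := measurable_absX m1; have m2' := measurable_absX m2.
rewrite /powint -ge0_integralD//; try by [move=> s _; rewrite lee_fin powR_ge0|exact/measurable_EFinP].
rewrite -ge0_integralZl//; first last.
- by move=> s _; rewrite adde_ge0// lee_fin powR_ge0.
- by apply: emeasurable_funD; exact/measurable_EFinP.
apply: ge0_le_integral => //.
- by apply/measurable_EFinP/measurable_absX; exact: measurable_funD.
- by apply/measurable_EFinP; apply: measurable_funM => //; exact: measurable_funD.
- by move=> s _; rewrite -EFinD -EFinM lee_fin powR_add_le.
Qed.

Lemma LfunZ a h : h \in Lfun m alpha%:E -> (fun s => a * h s)%R \in Lfun m alpha%:E.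
Proof.
move=> /mem_LfunP[mh fh]; apply/mem_LfunP; split; first exact: measurable_funM.
by rewrite powintZ// lte_mul_pinfty ?lee_fin ?powR_ge0.
Qed.

Lemma LfunD h1 h2 : h1 \in Lfun m alpha%:E -> h2 \in Lfun m alpha%:E ->
  (fun s => h1 s + h2 s)%R \in Lfun m alpha%:E.
Proof.
move=> /mem_LfunP[m1 f1] /mem_LfunP[m2 f2]; apply/mem_LfunP; split.
  exact: measurable_funD.
apply: le_lt_trans (powintD m1 m2) _.
apply: lte_mul_pinfty (lte_add_pinfty f1 f2); last exact: isT.
by rewrite lee_fin powR_ge0.
Qed.

Lemma Lfun_cst0 : (cst 0%R : S -> R) \in Lfun m alpha%:E.
Proof.
apply/mem_LfunP; split; first exact: measurable_cst.
rewrite /powint (eq_integral (cst 0)) ?integral0// => s _ /=.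
by rewrite normr0 powR0// gt_eqF.
Qed.

Lemma le_powint h1 h2 : measurable_fun setT h1 -> measurable_fun setT h2 ->
  (forall s, `|h1 s| <= `|h2 s|)%R -> powint h1 <= powint h2.
Proof.
move=> m1 m2 h12; apply: ge0_le_integral => //.
- by apply/measurable_EFinP/measurable_absX.
- by apply/measurable_EFinP/measurable_absX.
- by move=> s _; rewrite lee_fin; apply: ge0_ler_powR; rewrite ?nnegrE// ltW.
Qed.

Lemma measurable_restrict_set h (A : set S) : measurable A ->
  measurable_fun setT h -> measurable_fun setT (h \_ A).
Proof.
move=> mA mh; apply/(measurable_restrictT _ _).1 => //.
exact: measurable_funS mh.
Qed.

Lemma Lfun_restrict h (A : set S) : measurable A ->
  h \in Lfun m alpha%:E -> h \_ A \in Lfun m alpha%:E.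
Proof.
move=> mA /mem_LfunP[mh fh]; have mAh := measurable_restrict_set mA mh.
apply/mem_LfunP; split; first exact: mAh.
apply: le_lt_trans fh; apply: (le_powint mAh mh) => s.
by rewrite patchE; case: ifP; rewrite // normr0.
Qed.

Lemma Lfun_linform (I : eqType) (g : I -> S -> R) (l : seq (R * I)) :
  (forall i, g i \in Lfun m alpha%:E) -> (fun s => linform l (g^~ s)) \in Lfun m alpha%:E.
Proof.
move=> gL; elim: l => [|p l IH].
  by rewrite (_ : (fun _ => _) = cst 0%R) ?Lfun_cst0//; apply/funext => s; rewrite /linform big_nil.
rewrite (_ : (fun _ => _) = fun s => p.1 * g p.2 s + linform l (g^~ s))%R.
  by apply: LfunD => //; exact: LfunZ.
by apply/funext => s; rewrite /linform big_cons.
Qed.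

Lemma powint_eq0 h : measurable_fun setT h ->
  powint h = 0 <-> {ae m, forall s, h s = 0%R}.
Proof.
move=> mh; have mh' : measurable_fun setT (fun s => (`|h s| `^ alpha)%:E).
  exact/measurable_EFinP/measurable_absX.
have -> : powint h = \int[m]_s `|(`|h s| `^ alpha)%:E|.
  by apply: eq_integral => s _; rewrite gee0_abs// lee_fin powR_ge0.
rewrite (ae_eq_integral_abs m measurableT mh'); split; apply: filterS => s.
  by move=> /(_ Logic.I)[] /powR_eq0_eq0 /normr0_eq0.
by move=> -> _ /=; rewrite normr0 powR0// gt_eqF.
Qed.

Lemma cvge0P (u : nat -> \bar R) : (forall n, 0 <= u n) ->
  u n @[n --> \oo] --> 0 <-> forall e : R, (0 < e)%R -> \forall n \near \oo, u n <= e%:E.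
Proof.
move=> u0; split.
  move=> /fine_cvgP[fu /cvgr0Pnorm_le cu] e e0.
  near=> n; have fn : u n \is a fin_num by near: n; exact: fu.
  rewrite -(fineK fn) lee_fin (le_trans (ler_norm _))//.
  by near: n; exact: cu.
move=> H; apply/fine_cvgP; split.
  near=> n; rewrite ge0_fin_numE//.
  by apply: (@le_lt_trans _ _ 1%:E); [near: n; exact: H|exact: ltry].
apply/cvgr0Pnorm_le => e e0; near=> n.
have un : u n <= e%:E by near: n; exact: H.
have fn : u n \is a fin_num by rewrite ge0_fin_numE// (le_lt_trans un)// ltry.
by rewrite /= ger0_norm ?fine_ge0// -lee_fin fineK.
Unshelve. all: by end_near. Qed.

Lemma cvge0_poweRP (u : nat -> \bar R) (p : R) : (0 < p)%R -> (forall n, 0 <= u n) ->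
  (u n `^ p @[n --> \oo] --> 0) <-> u n @[n --> \oo] --> 0.
Proof.
have H (v : nat -> \bar R) (q : R) : (0 < q)%R -> (forall n, 0 <= v n) ->
    v n @[n --> \oo] --> 0 -> (v n `^ q @[n --> \oo] --> 0).
  move=> q0 v0 /(cvge0P v0) vc; apply/cvge0P => [n|e e0]; first exact: poweR_ge0.
  have e1 : (0 < e `^ q^-1)%R by rewrite powR_gt0.
  apply: filterS (vc _ e1) => n vn.
  have := gt0_ler_poweR (ltW q0) _ _ vn.
  rewrite !in_itv/= v0 !leey lee_fin (ltW e1) => /(_ isT isT) /le_trans; apply.
  by rewrite -powRrM mulVf ?gt_eqF// powRr1// ltW.
move=> p0 u0; split; last exact: H.
move=> uc; have := H _ (p^-1)%R _ (fun n => poweR_ge0 _ _) uc.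
rewrite invr_gt0 => /(_ p0).
by under eq_fun do rewrite -poweRrM divff ?gt_eqF// poweRe1//.
Qed.

Lemma Lnorm_cvg0P (h : nat -> S -> R) :
  (Lnorm m alpha%:E (fun s => (h n s)%:E) @[n --> \oo] --> 0) <->
  powint (h n) @[n --> \oo] --> 0.
Proof.
under eq_fun do rewrite powint_LnormE.
by apply: cvge0_poweRP; [rewrite invr_gt0|move=> n; exact: powint_ge0].
Qed.
End power_integral.

Section ae_seq.
Context {R : realType} {d} {T : measurableType d} (mu : {measure set T -> \bar R}).

Lemma ae_all_seq (K : eqType) (ks : seq K) (Q : K -> T -> Prop) :
  (forall k, k \in ks -> {ae mu, forall w, Q k w}) ->
  {ae mu, forall w, forall k, k \in ks -> Q k w}.
Proof.
elim: ks => [|k ks IH] H; first by apply: aeW => w k; rewrite in_nil.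
have /IH IH' : forall k, k \in ks -> {ae mu, forall w, Q k w}.
  by move=> j jk; apply: H; rewrite in_cons jk orbT.
have := H k (mem_head _ _); move: IH'; apply: filterS2 => w Hks Hk j.
by rewrite in_cons => /predU1P[->|/Hks].
Qed.
End ae_seq.

(** * Integrals of simple functions *)

Section random_measure.
Import HBSimple.
Context {R : realType} {d} {S : measurableType d} {d'} {Omega : measurableType d'}.
Variables (alpha : R) (m : {measure set S -> \bar R}) (P : probability Omega R).
Variable M : set S -> {RV P >-> R}.
Hypothesis alpha_gt0 : 0 < alpha.
Hypothesis M_add : as_sigma_additive m M.

(** Sigma-additivity along the constant sequence of empty sets: a convergent series with equal terms
    has zero terms. *)
Lemma random_measure0 : {ae P, forall w, M set0 w = 0}.
Proof.
have := M_add (A := fun=> set0) (fun=> measurable0).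
rewrite bigcup0// measure0 => /(_ _ (ltry 0)) H.
have {}H := H (fun i j _ _ => ltac:(by move=> [x []])).
move: H; apply: filterS => w cw.
have /cvg_series_cvg_0 : cvgn (series (fun n : nat => M set0 w)).
  by apply/cvg_ex; eexists; exact: cw.
by move/(cvg_lim (@Rhausdorff R)) => <-; rewrite lim_cst.
Qed.

Lemma random_measureU (A B : set S) : measurable A -> measurable B ->
  A `&` B = set0 -> (m (A `|` B) < +oo)%E ->
  {ae P, forall w, M (A `|` B) w = M A w + M B w}.
Proof.
move=> mA mB AB fAB.
have := M_add (A := bigcup2 A B); rewrite bigcup2E => H.
have mAB n : measurable (bigcup2 A B n) by rewrite /bigcup2; do 2 case: ifP => // _.
have {H} := H mAB _ fAB.
rewrite -trivIset_bigcup2 => /(_ AB).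
move: random_measure0; apply: filterS2 => w M0 cw.
rewrite -(cvg_lim (@Rhausdorff R) cw); apply/cvg_lim => //; apply: cvg_near_cst; exists 2%N => // -[|[|n]] //= _.
rewrite (_ : series _ _ = \sum_(0 <= k < n.+2) M (bigcup2 A B k) w)//.
rewrite big_ltn// big_ltn// big_nat big1 ?addr0//.
by move=> [|[|i]].
Qed.

Lemma random_measure_bigU (K : choiceType) (ks : seq K) (A : K -> set S) : uniq ks ->
  (forall k, measurable (A k)) -> trivIset setT A ->
  (m (\big[setU/set0]_(k <- ks) A k) < +oo)%E ->
  {ae P, forall w, M (\big[setU/set0]_(k <- ks) A k) w = \sum_(k <- ks) M (A k) w}.
Proof.
move=> + mA tA; elim: ks => [|k ks IH] /=.
  move=> _ _; move: random_measure0; apply: filterS => w M0.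
  by rewrite !big_nil.
move=> /andP[kks uks]; rewrite big_cons => fk.
have mU : measurable (\big[setU/set0]_(k <- ks) A k) by exact: bigsetU_measurable.
have fks : (m (\big[setU/set0]_(k <- ks) A k) < +oo)%E.
  apply: le_lt_trans fk; apply: le_measure; rewrite ?inE//; exact: measurableU.
have disj : A k `&` \big[setU/set0]_(k <- ks) A k = set0.
  rewrite -subset0 => x [Akx]; rewrite -bigcup_seq => -[j /= jk Ajx].
  have kj : k = j by apply: tA => //; exists x.
  by move: kks; rewrite kj jk.
move: (IH uks fks) (random_measureU (mA k) mU disj fk); apply: filterS2 => w H1 H2.
by rewrite H2 H1 big_cons.
Qed.

(** Markov's inequality. It matters because the additivity of [M] is available on sets of finite
    measure only. *)
Lemma Lfun_level_lty (h : S -> R) (y : R) : h \in Lfun m alpha%:E -> y != 0 ->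
  (m (h @^-1` [set y]) < +oo)%E.
Proof.
move=> /(mem_LfunP m alpha_gt0)[mh fh] y0.
have mD : measurable (h @^-1` [set y]) by rewrite -[X in measurable X]setTI; exact: mh.
have c0 : 0 < `|y| `^ alpha by rewrite powR_gt0 ?normr_gt0.
have : (((`|y| `^ alpha)%:E * m (h @^-1` [set y])) <= powint m alpha h)%E.
  rewrite -(integral_cst _ mD); apply: (@le_trans _ _ (\int[m]_(s in h @^-1` [set y]) (`|h s| `^ alpha)%:E)%E).
    by apply: ge0_le_integral => //; [move=> s _; rewrite lee_fin powR_ge0
      |apply/measurable_EFinP/measurable_funTS; exact: measurable_absX
      |move=> s /= ->].
  apply: ge0_subset_integral => //.
    by apply/measurable_EFinP; exact: measurable_absX.
move=> /le_lt_trans/(_ fh); case: (m _) (measure_ge0 m (h @^-1` [set y])) => //= [r _ _|].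
  exact: ltry.
by rewrite gt0_muley ?lte_fin.
Qed.

(* The value [0] is exempted because its level set may have infinite measure. *)
Lemma simple_integral_refine (K : choiceType) (ks : seq K) (q : S -> K) (v : K -> R)
    (h : {sfun S >-> R}) : uniq ks -> (forall s, q s \in ks) ->
  (forall k, measurable (q @^-1` [set k])) -> (forall s, h s = v (q s)) ->
  (h : S -> R) \in Lfun m alpha%:E ->
  {ae P, forall w, simple_integral M h w = \sum_(k <- ks) v k * M (q @^-1` [set k]) w}.
Proof.
move=> uks qks mq hE hL.
pose ys := undup [seq v k | k <- ks].
have level y : h @^-1` [set y] = \big[setU/set0]_(k <- [seq k <- ks | v k == y]) (q @^-1` [set k]).
  rewrite -bigcup_seq; apply/seteqP; split=> [s /= hs|s [k /=]].
    by exists (q s) => //=; rewrite mem_filter qks -hE hs eqxx.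
  by rewrite mem_filter => /andP[/eqP <- _] <-.
have H y : y \in ys -> {ae P, forall w, y * M (h @^-1` [set y]) w =
    \sum_(k <- ks | v k == y) v k * M (q @^-1` [set k]) w}.
  move=> _; have [->|y0] := eqVneq y 0.
    by apply: aeW => w; rewrite mul0r big1// => k /eqP ->; rewrite mul0r.
  have := Lfun_level_lty hL y0; rewrite level => fy.
  have := @random_measure_bigU K _ (fun k => q @^-1` [set k]) (filter_uniq _ uks) mq _ fy.
  move=> /(_ _)/wrap[|]; first by move=> i j _ _ [s [/= -> ->]].
  apply: filterS => w ->; rewrite big_filter mulr_sumr.
  by apply: eq_bigr => k /eqP ->.
move: random_measure0 (ae_all_seq H); apply: filterS2 => w M0 {}H.
rewrite /simple_integral (@fsbig_widen _ _ _ _ (range h) [set` ys]); first last.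
- move=> y [/= _ hy]; rewrite (_ : _ @^-1` _ = set0) ?M0 ?mulr0//.
  by apply/seteqP; split => // s /= hs; apply: hy; exists s.
- by move=> _ [s _ <-] /=; rewrite mem_undup hE map_f.
rewrite -fsbig_seq ?undup_uniq// big_seq (eq_bigr _ H) -big_seq.
rewrite (exchange_big_dep xpredT)//=; rewrite big_seq [RHS]big_seq; apply: eq_bigr => k kk.
under eq_bigl do rewrite eq_sym.
by rewrite -big_filter filter_pred1_uniq ?undup_uniq ?big_seq1// mem_undup map_f.
Qed.

Lemma measurable_simple_integral (h : {sfun S >-> R}) :
  measurable_fun setT (simple_integral M h).
Proof.
rewrite /simple_integral; under eq_fun do rewrite fsbig_finite//.
by apply: measurable_sum => y; exact: measurable_funM.
Qed.

Lemma simple_integral_lin (a : R) (h1 h2 : {sfun S >-> R}) :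
  (h1 : S -> R) \in Lfun m alpha%:E -> (h2 : S -> R) \in Lfun m alpha%:E ->
  {ae P, forall w, simple_integral M (cst_sfun a * h1 + h2) w =
    a * simple_integral M h1 w + simple_integral M h2 w}.
Proof.
(* The level sets of the pair refine those of [h1], [h2] and [a h1 + h2] simultaneously. *)
move=> L1 L2; pose q s := (h1 s, h2 s).
have fq : finite_set (range h1 `*` range h2) by exact: finite_setX.
pose ks := finmap.enum_fset (fset_set (range h1 `*` range h2)).
have uks : uniq ks by exact: finmap.fset_uniq.
have qks s : q s \in ks by rewrite in_fset_set// inE/=; split; exists s.
have mq k : measurable (q @^-1` [set k]).
  rewrite (_ : _ @^-1` _ = (h1 @^-1` [set k.1]) `&` (h2 @^-1` [set k.2])).
    by apply: measurableI; exact: measurable_sfunP.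
  by case: k => k1 k2; apply/seteqP; split => s; rewrite /q /=; [case=> -> ->|case=> -> ->].
have L : ((cst_sfun a * h1 + h2 : {sfun S >-> R}) : S -> R) \in Lfun m alpha%:E.
  exact: (LfunD alpha_gt0 (LfunZ alpha_gt0 a L1) L2).
have E1 := @simple_integral_refine _ ks q fst h1 uks qks mq (fun=> erefl) L1.
have E2 := @simple_integral_refine _ ks q snd h2 uks qks mq (fun=> erefl) L2.
have E := @simple_integral_refine _ ks q (fun k => a * k.1 + k.2)
  (cst_sfun a * h1 + h2) uks qks mq (fun=> erefl) L.
move: E1 E2 E; apply: filterS3 => w -> -> ->.
by rewrite mulr_sumr -big_split/=; apply: eq_bigr => k _; rewrite mulrDl mulrA.
Qed.
End random_measure.

(** * Convergence in probability *)

Section in_probability.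
Context {R : realType} {d} {Omega : measurableType d} (P : probability Omega R).
Implicit Types Y : Omega -> R.

Lemma le_measure_ae (A B : set Omega) : measurable A -> measurable B ->
  {ae P, forall w, A w -> B w} -> (P A <= P B)%E.
Proof.
move=> mA mB [N [mN N0 NAB]].
apply: (@le_trans _ _ (P (B `|` N))).
  apply: le_measure; rewrite ?inE//; first exact: measurableU.
  move=> w Aw; have [Bw|nBw] := pselect (B w); [by left|right].
  by apply: NAB => /= /(_ Aw).
by rewrite -[leRHS]adde0 -N0 measureU2.
Qed.

Lemma measurable_dev (Y Z : Omega -> R) (e : R) : measurable_fun setT Y ->
  measurable_fun setT Z -> measurable [set w | e < `|Y w - Z w|].
Proof.
move=> mY mZ; apply: measurable_ltr_set.
by apply: measurableT_comp => //; exact: measurable_funB.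
Qed.

Lemma cvg_in_probabilityP (u : nat -> Omega -> R) Y :
  cvg_in_probability P u Y <-> forall e : R, 0 < e -> forall r : R, 0 < r ->
    \forall n \near \oo, (P [set w | (e < `|u n w - Y w|)%R] <= r%:E)%E.
Proof.
by split=> H e e0; [apply/cvge0P => //; exact: H|apply/cvge0P => //; exact: H].
Qed.

Lemma ae_cvg_in_probability (u : nat -> Omega -> R) Y :
  (forall n, measurable_fun setT (u n)) -> measurable_fun setT Y ->
  {ae P, forall w, u n w @[n --> \oo] --> Y w} -> cvg_in_probability P u Y.
Proof.
move=> mu mY uY e e0.
pose f n w : \bar R := (\1_[set w | e < `|u n w - Y w|] w : R)%:E.
have mf n : measurable_fun setT (f n).
  by apply/measurable_EFinP; apply: measurable_indic; exact: measurable_dev.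
have fE n : P [set w | e < `|u n w - Y w|] = (\int[P]_w f n w)%E.
  by rewrite integral_indic ?setIT//; exact: measurable_dev.
under eq_fun do rewrite fE; rewrite -(integral0 P setT).
have h1 : measurable_fun setT (cst 0%E : Omega -> \bar R) by exact: measurable_cst.
have h2 : {ae P, forall w, setT w -> f ^~ w @ \oo --> cst 0%E w}.
  move: uY; apply: filterS => w cw _; apply: cvg_near_cst.
  have /cvgrPdist_le/(_ _ e0) := cw; apply: filterS => n un.
  rewrite /f indicE memNset//= => H; move: un.
  by rewrite distrC leNgt H.
have h3 : P.-integrable setT (cst 1%E : Omega -> \bar R).
  by apply: (@bounded_integrable _ _ _ _ (cst 1%R) 1) => // w; rewrite normr1.
have h4 : {ae P, forall w n, setT w -> (`|f n w| <= cst 1 w)%E}.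
  apply: aeW => w n _; rewrite /f indicE abse_EFin lee_fin.
  by case: (_ \in _); rewrite ?normr1 ?normr0.
by have [_ _] := dominated_convergence measurableT mf h1 h2 h3 h4.
Qed.

Lemma cvg_in_probability_lin (u v z : nat -> Omega -> R) Y1 Y2 (a : R) :
  (forall n, measurable_fun setT (u n)) -> (forall n, measurable_fun setT (v n)) ->
  (forall n, measurable_fun setT (z n)) ->
  measurable_fun setT Y1 -> measurable_fun setT Y2 ->
  (forall n, {ae P, forall w, z n w = a * u n w + v n w}) ->
  cvg_in_probability P u Y1 -> cvg_in_probability P v Y2 ->
  cvg_in_probability P z (fun w => a * Y1 w + Y2 w).
Proof.
move=> mu mv mz m1 m2 zE /cvg_in_probabilityP u1 /cvg_in_probabilityP v2.
apply/cvg_in_probabilityP => e e0 r r0.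
(* Using [|a| + 1] in place of [|a|] keeps the threshold for [u] meaningful when [a = 0]. *)
have a0 : 0 < `|a| + 1 by rewrite ltr_wpDl.
have e1 : 0 < e / 2 / (`|a| + 1) by rewrite !divr_gt0.
have e2 : 0 < e / 2 by rewrite divr_gt0.
have r2 : 0 < r / 2 by rewrite divr_gt0.
near=> n.
have mA := measurable_dev (e / 2 / (`|a| + 1)) (mu n) m1.
have mB := measurable_dev (e / 2) (mv n) m2.
apply: (@le_trans _ _ (P ([set w | e / 2 / (`|a| + 1) < `|u n w - Y1 w|] `|`
                          [set w | e / 2 < `|v n w - Y2 w|]))).
  apply: le_measure_ae.
  - apply: measurable_dev => //; apply: measurable_funD => //.
    exact: measurable_funM.
  - exact: measurableU.
  apply: filterS (zE n) => w /= ->; apply: contraPP => /not_orP[/negP + /negP].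
  rewrite -!leNgt ler_pdivlMr// => A B; apply/negP; rewrite -leNgt.
  rewrite (_ : _ - _ = a * (u n w - Y1 w) + (v n w - Y2 w)); last by ring.
  rewrite (le_trans (ler_normD _ _))// normrM [leRHS](splitr e) lerD//.
  apply: le_trans A; rewrite mulrC ler_wpM2l// lerDl//.
rewrite (le_trans (measureU2 _ _ _))// [in leRHS](splitr r) EFinD leeD//.
  by near: n; exact: u1.
by near: n; exact: v2.
Unshelve. all: by end_near. Qed.
End in_probability.

(** * Tails of symmetric stable laws *)

Section stable_tail.
Context {R : realType} {d} {Omega : measurableType d} (P : probability Omega R).
Variable alpha : R.
Hypothesis alpha_gt0 : 0 < alpha.

(** Here [sigma] is the [alpha]-th power of the scale parameter. *)
Definition stable_law (Y : Omega -> R) (sigma : R) : Prop :=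
  measurable_fun setT Y /\
  forall theta, \int[P]_w cos (theta * Y w) = expR (- (`|theta| `^ alpha * sigma)).

(** The first factor comes from one dyadic shell, the second is the sum of the geometric series over
    the shells. *)
Definition tail_cst : R := (1 - cos 1)^-1 * (1 - 2 `^ (- alpha))^-1.

Lemma one_sub_cos1_gt0 : 0 < 1 - cos 1 :> R.
Proof.
rewrite subr_gt0 -[ltRHS]cos0 ltr_cos ?in_itv//= ?lexx ?pi_ge0//.
by rewrite ler01 (le_trans _ (pi_ge2 R))// ler1n.
Qed.

(** On the shell [|Y| / K] lies in [(1, 2]], hence below [pi], so [1 - cos (Y / K) >= 1 - cos 1];
    and the expectation of [1 - cos (Y / K)] is at most the characteristic exponent at [1 / K]. *)
Lemma dyadic_tail (Y : Omega -> R) sigma (K : R) : stable_law Y sigma -> 0 < K ->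
  fine (P [set w | K < `|Y w| /\ `|Y w| <= 2 * K]) <=
  (1 - cos 1)^-1 * (K `^ (- alpha) * sigma).
Proof.
move=> [mY cY] K0; have mYn : measurable_fun setT (fun w => `|Y w|) by exact: measurableT_comp.
have c1 := one_sub_cos1_gt0.
pose f w := (1 - cos 1)^-1 * (1 - cos (K^-1 * Y w)).
have mf : measurable_fun setT f.
  apply: measurable_funM => //; apply: (measurableT_comp measurable_one_sub_cos).
  exact: measurable_funM.
apply: (@le_trans _ _ (\int[P]_w f w)).
  apply: (@fine_prob_le_expectation _ _ _ _ _ _ ((1 - cos 1)^-1 * 2)) => //.
  - apply: measurableI; [exact: measurable_ltr_set|exact: measurable_ler_set].
  - move=> w; rewrite mulr_ge0 ?invr_ge0 ?(ltW c1) ?one_sub_cos_ge0//=.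
    rewrite ler_pM2l ?invr_gt0//; have := cos_geN1 (K^-1 * Y w); lra.
  - move=> w [Y1 Y2]; rewrite /f mulrC ler_pdivlMr// mul1r lerD2l lerN2.
    have -> : cos (K^-1 * Y w) = cos (K^-1 * `|Y w|).
      by rewrite -cos_norm normrM gtr0_norm// invr_gt0.
    have h1 : 1 < K^-1 * `|Y w| by rewrite mulrC ltr_pdivlMr// mul1r.
    have h2 : K^-1 * `|Y w| <= 2 by rewrite mulrC ler_pdivrMr.
    have p2 := pi_ge2 R.
    by rewrite ltW// ltr_cos// in_itv/=; apply/andP; split; lra.
have ic : P.-integrable setT (EFin \o (fun w => cos (K^-1 * Y w))).
  apply: (@bounded_integrable _ _ _ _ _ 1) => [|w]; last exact: cos_max.
  apply: (measurableT_comp (f := cos)); first exact: (continuous_measurable_fun (@continuous_cos R)).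
  exact: measurable_funM.
have i1 : P.-integrable setT (EFin \o (cst (1 : R))).
  by apply: (@bounded_integrable _ _ _ _ _ 1) => // w; rewrite normr1.
rewrite RintegralZl//; last first.
  apply: (@bounded_integrable _ _ _ _ _ 2) => [|w].
    by apply: (measurableT_comp measurable_one_sub_cos); exact: measurable_funM.
  by rewrite ger0_norm ?one_sub_cos_ge0//; have := cos_geN1 (K^-1 * Y w); lra.
rewrite RintegralB// Rintegral_prob_cst cY ler_pM2l ?invr_gt0//.
rewrite gtr0_norm ?invr_gt0// powRN -[in X in _ <= X]powRN.
have -> : K^-1 `^ alpha = K `^ (- alpha) by rewrite powRN -powR_inv1 ?ltW// -powRrM mulN1r powRN.
by rewrite lerBlDr -lerBlDl (le_trans _ (expR_ge1Dx _))//; lra.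
Qed.

(* The event [K < |Y|] is split into the dyadic shells [2^i K < |Y| <= 2^(i+1) K]. *)
Lemma stable_law_tail (Y : Omega -> R) sigma (K : R) : stable_law Y sigma -> 0 <= sigma -> 0 < K ->
  (P [set w | (K < `|Y w|)%R] <= (tail_cst * (K `^ (- alpha) * sigma))%:E)%E.
Proof.
move=> lY s0 K0; have [mY _] := lY.
have mYn : measurable_fun setT (fun w => `|Y w|) by exact: measurableT_comp.
pose F i := [set w | 2 ^+ i * K < `|Y w| /\ `|Y w| <= 2 * (2 ^+ i * K)].
have K2 i : 0 < 2 ^+ i * K by rewrite mulr_gt0// exprn_gt0.
have mF i : measurable (F i).
  by apply: measurableI; [exact: measurable_ltr_set|exact: measurable_ler_set].
have sub : [set w | K < `|Y w|] `<=` \bigcup_i F i.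
  move=> w /= KY.
  have [n nY] : exists n, `|Y w| <= 2 ^+ n * K.
    exists (Num.bound (`|Y w| / K)); rewrite -ler_pdivrMr// ltW//.
    apply: lt_le_trans (archi_boundP _) _; first by rewrite divr_ge0// ltW.
    by rewrite -natrX ler_nat ltnW// ltn_expl.
  elim: n nY => [|n IH]; first by rewrite expr0 mul1r leNgt KY.
  have [nY|nY] := leP `|Y w| (2 ^+ n * K); first by move=> _; exact: IH.
  by move=> nY'; exists n => //; split => //; rewrite mulrA -exprS.
apply: (le_trans (measure_sigma_subadditive _ mF _ sub)); first exact: measurable_ltr_set.
pose c := (1 - cos 1)^-1 * (K `^ (- alpha) * sigma).
have x0 : 0 < 2 `^ (- alpha) :> R by rewrite powR_gt0.
have x1 : 2 `^ (- alpha) < 1 :> R.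
  rewrite powRN invf_lt1 ?powR_gt0//.
  have : 1 `^ alpha < 2 `^ alpha :> R by apply: gt0_ltr_powR; rewrite ?nnegrE ?ltr1n.
  by rewrite powR1.
apply: lime_le; first by apply: is_cvg_nneseries.
apply: nearW => n; have -> : tail_cst * (K `^ (- alpha) * sigma) = c * (1 - 2 `^ (- alpha))^-1.
  by rewrite /tail_cst /c; ring.
apply: (@le_trans _ _ (series (geometric c (2 `^ (- alpha))) n)%:E); last first.
  rewrite lee_fin; apply: geometric_le_lim => //; last by rewrite gtr0_norm.
  by rewrite mulr_ge0 ?invr_ge0 ?(ltW one_sub_cos1_gt0)// mulr_ge0// powR_ge0.
rewrite /series/= -sumEFin; apply: lee_sum => i _.
rewrite -(fine_probE P (mF i)) lee_fin (le_trans (dyadic_tail lY (K2 i)))//.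
rewrite /c powRM ?exprn_ge0 ?(ltW K0)// -powR_mulrn// -powRrM (mulrC i%:R) powRrM powR_mulrn ?powR_ge0//.
by rewrite le_eqVlt; apply/orP; left; apply/eqP; ring.
Qed.

Lemma stable_law0 (Y : Omega -> R) : stable_law Y 0 -> {ae P, forall w, Y w = 0}.
Proof.
move=> lY; have [mY _] := lY.
have H n : P.-negligible [set w | n.+1%:R^-1 < `|Y w|].
  exists [set w | n.+1%:R^-1 < `|Y w|]; split => //.
    by apply: measurable_ltr_set; exact: measurableT_comp.
  apply/eqP; rewrite eq_le measure_ge0 andbT.
  by rewrite (le_trans (stable_law_tail lY _ _))// ?mulr0// mulr0.
apply: negligibleS (negligible_bigcup H) => w /= /eqP Y0.
have : 0 < `|Y w| by rewrite normr_gt0.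
move=> /ltr_add_invr[n]; rewrite add0r => nY; exists n => //.
Qed.
End stable_tail.

Section fast_cauchy.
Context {R : realType}.

Lemma fast_cauchy (u : nat -> R) N :
  (forall k, (N <= k)%N -> `|u k.+1 - u k| <= 2^-1 ^+ k) -> cvgn u.
Proof.
move=> H; apply/cvg_ex.
pose v n := u (n + N)%N.
have : cvgn (series (telescope v)).
  apply: normed_cvg; apply: (@series_le_cvg _ _ (geometric 1 2^-1)) => [n|n|n|].
  - exact: normr_ge0.
  - by rewrite /= mul1r exprn_ge0.
  - rewrite (_ : [sequence _]_n _ = `|u (n + N).+1 - u (n + N)%N|)//.
    rewrite (le_trans (H _ (leq_addl _ _)))//= mul1r.
    by rewrite exprD ler_piMr ?exprn_ge0// exprn_ile1// invf_le1 ?ler1n.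
  - by apply: is_cvg_geometric_series; rewrite ger0_norm// invf_lt1 ?ltr1n.
move=> /cvg_ex[/= l vl]; exists (l + v 0%N).
rewrite -(cvg_shiftn N); have : (series (telescope v) n + v 0%N) @[n --> \oo] --> l + v 0%N.
  by apply: cvgD => //; exact: cvg_cst.
by under eq_fun do rewrite addrC -eq_sum_telescope.
Qed.

Lemma pow_seq_cvg0 : (2^-1 ^+ n : R) @[n --> \oo] --> (0 : R).
Proof. by apply: cvg_expr; rewrite ger0_norm// invf_lt1 ?ltr1n. Qed.
End fast_cauchy.

(** * Existence, linearity and law of stable integrals *)

Section stable_integral_theory.
Import HBSimple HBNNSimple.
Context {R : realType} {d} {S : measurableType d} {d'} {Omega : measurableType d'}.
Variables (alpha : R) (m : {measure set S -> \bar R}) (P : probability Omega R).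
Variable M : set S -> {RV P >-> R}.
Hypothesis alpha_gt0 : 0 < alpha.
Hypothesis MS : SaS_random_measure alpha m M.

Let M_add : as_sigma_additive m M. Proof. by case: MS. Qed.
Let Lf (h : S -> R) := h \in Lfun m alpha%:E.

Lemma simple_stable_integral (h : {sfun S >-> R}) : Lf h ->
  is_stable_integral alpha m M h (simple_integral M h).
Proof.
move=> hL; split; first exact: measurable_simple_integral.
exists (fun=> h); split => //.
- apply/(Lnorm_cvg0P m alpha_gt0); apply: cvg_near_cst; apply: nearW => n.
  apply/(powint_eq0 m alpha_gt0); first exact: measurable_funB.
  by apply: aeW => s /=; rewrite subrr.
- move=> e e0; apply: cvg_near_cst; apply: nearW => n.
  rewrite (_ : [set _ | _] = set0) ?measure0//.
  by apply/seteqP; split => // w /=; rewrite subrr normr0 ltNge (ltW e0).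
Qed.

Lemma stable_integral_law (h : S -> R) Y : Lf h -> is_stable_integral alpha m M h Y ->
  stable_law P alpha Y (fine (powint m alpha h)).
Proof.
move=> hL hY; split; first by case: hY.
by move=> theta; case: MS => _ _ /(_ _ _ hL hY theta)[].
Qed.

Lemma stable_integral_sin (h : S -> R) Y theta : Lf h -> is_stable_integral alpha m M h Y ->
  \int[P]_w sin (theta * Y w) = 0.
Proof. by move=> hL hY; case: MS => _ _ /(_ _ _ hL hY theta)[]. Qed.

Lemma Lfun_fineK (h : S -> R) : Lf h -> (fine (powint m alpha h))%:E = powint m alpha h.
Proof. by move=> /(mem_LfunP m alpha_gt0)[_ hf]; rewrite fineK// ge0_fin_numE ?powint_ge0. Qed.

(** Continuity of the integral from [L^alpha] to convergence in probability: by linearity the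
    difference is the integral of a simple function, so the stable tail bound applies to it. *)
Lemma simple_integral_diff_tail (h1 h2 : {sfun S >-> R}) (K : R) : Lf h1 -> Lf h2 -> 0 < K ->
  (P [set w | (K < `|simple_integral M h1 w - simple_integral M h2 w|)%R] <=
   (tail_cst alpha * K `^ (- alpha))%:E * powint m alpha (fun s => h1 s - h2 s)%R)%E.
Proof.
move=> L1 L2 K0; pose h := cst_sfun (-1) * h2 + h1.
have hL : Lf h by exact: (LfunD alpha_gt0 (LfunZ alpha_gt0 (-1) L2) L1).
have lh := stable_integral_law hL (simple_stable_integral hL).
have s0 : 0 <= fine (powint m alpha h) by rewrite fine_ge0// powint_ge0.
have := stable_law_tail alpha_gt0 lh s0 K0; rewrite mulrA EFinM (Lfun_fineK hL).
have -> : (fun s => h1 s - h2 s) = h.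
  by apply/funext => s; rewrite /h /= mulN1r addrC.
apply: le_trans; apply: le_measure_ae.
- by apply: measurable_dev; exact: measurable_simple_integral.
- apply: measurable_ltr_set; apply: measurableT_comp => //.
  exact: measurable_simple_integral.
apply: filterS (simple_integral_lin alpha_gt0 M_add (-1) L2 L1) => w /= ->.
by rewrite mulN1r addrC.
Qed.

(** Approximating [|h|] from below and restoring the sign keeps [|h_n - h| <= |h|], which is the
    domination needed for convergence of the [alpha]-th powers. *)
Lemma simple_dense (h : S -> R) : Lf h -> exists h_ : nat -> {sfun S >-> R},
  (forall n, Lf (h_ n)) /\ powint m alpha (fun s => h_ n s - h s)%R @[n --> \oo] --> 0%E.
Proof.
move=> /(mem_LfunP m alpha_gt0)[mh hf].
have mah : measurable_fun setT (fun s => `|h s|%:E).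
  by apply/measurable_EFinP; exact: measurableT_comp.
have mA : measurable [set s | 0 <= h s] by exact: measurable_ge_set.
pose p n := nnsfun_approx measurableT mah n.
pose sg : {sfun S >-> R} := cst_sfun 2 * indic_sfun _ mA - cst_sfun 1.
pose h_ n : {sfun S >-> R} := sg * (p n : {sfun S >-> R}).
have sgE s : sg s = (-1) ^+ (h s < 0)%R.
  transitivity (2 * \1_[set s | 0 <= h s] s - 1 : R) => //.
  rewrite indicE; case: ltP => [h0|h0]; [rewrite memNset|rewrite mem_set] => //=.
  - by rewrite mulr0 sub0r expr1.
  - by apply/negP; rewrite -ltNge.
  - by rewrite mulr1 expr0; lra.
have hE s : h s = sg s * `|h s| by rewrite sgE; exact: numEsign.
have hnE n s : h_ n s = sg s * p n s by [].
have nsg s : `|sg s| = 1 by rewrite sgE normr_sign.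
have cp s : p n s @[n --> \oo] --> `|h s|.
  have := @cvg_nnsfun_approx _ _ _ _ measurableT _ mah (fun x _ => normr_ge0 (h x)) s Logic.I.
  by move=> /fine_cvgP[].
have p0 n s : 0 <= p n s by exact: fun_ge0.
have lep n s : p n s <= `|h s|.
  rewrite -(cvg_lim (@Rhausdorff R) (cp s)); apply: nondecreasing_cvgn_le.
    by move=> i j ij; have /lefP := @nd_nnsfun_approx _ _ _ _ measurableT _ mah i j ij; apply.
  by apply/cvg_ex; eexists; exact: cp.
have mhn n : measurable_fun setT (h_ n) by [].
have md n : measurable_fun setT (fun s => h_ n s - h s) by exact: measurable_funB.
exists h_; split.
  move=> n; apply/(mem_LfunP m alpha_gt0); split; first exact: mhn.
  apply: le_lt_trans hf; apply: le_powint => // s.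
  by rewrite hnE normrM nsg mul1r ger0_norm.
have ih : m.-integrable setT (fun s => (`|h s| `^ alpha)%:E).
  apply/integrableP; split; first exact/measurable_EFinP/measurable_absX.
  by under eq_integral do rewrite gee0_abs ?lee_fin ?powR_ge0//.
have h0 : measurable_fun setT (cst 0%E : S -> \bar R) by exact: measurable_cst.
have h1 n : measurable_fun setT (fun s => (`|h_ n s - h s| `^ alpha)%:E).
  by apply/measurable_EFinP/measurable_absX.
have h2 : {ae m, forall s, setT s -> (`|h_ n s - h s| `^ alpha)%:E @[n --> \oo] --> cst 0%E s}.
  apply: aeW => s _; under eq_fun do rewrite -poweR_EFin.
  apply/cvge0_poweRP => //; apply/cvg_EFin; first exact: nearW.
  rewrite -[X in _ --> X](normr0 R) -(subrr (h s)).
  apply: cvg_norm; apply: cvgB; last exact: cvg_cst.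
  by rewrite [X in _ --> X]hE; under eq_fun do rewrite hnE; apply: cvgM => //; exact: cvg_cst.
have h4 : {ae m, forall s n, setT s -> (`|(`|h_ n s - h s| `^ alpha)%:E| <= (`|h s| `^ alpha)%:E)%E}.
  apply: aeW => s n _; rewrite gee0_abs ?lee_fin ?powR_ge0//.
  apply: ge0_ler_powR; rewrite ?nnegrE ?(ltW alpha_gt0)//.
  rewrite hnE [X in _ - X]hE -mulrBr normrM nsg mul1r distrC.
  by rewrite ger0_norm ?subr_ge0// gerBl.
have [_ _] := dominated_convergence measurableT h1 h0 h2 ih h4.
by rewrite integral0.
Qed.

Lemma stable_integral_exists (h : S -> R) : Lf h -> exists Y, is_stable_integral alpha m M h Y.
Proof.
move=> hL; have [mh _] := (mem_LfunP m alpha_gt0 h).1 hL.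
have [h_ [hnL hc]] := simple_dense hL.
have pow1 : (1 : R) = 1 `^ alpha by rewrite powR1.
pose a k : R := 2^-1 ^+ k; have a0 k : 0 < a k by rewrite exprn_gt0.
(* The factor [a k ^ alpha] offsets the [a k ^ (- alpha)] of the tail bound at level [a k], so the
   probability of a step larger than [a k] is of order [a k], which is summable. *)
pose e k := a k * a k `^ alpha.
have e0 k : 0 < e k by rewrite mulr_gt0// powR_gt0.
have /choice[g gP] : forall k, exists g : {sfun S >-> R}, Lf g /\
    (powint m alpha (fun s => g s - h s)%R <= (e k)%:E)%E.
  move=> k; have /cvge0P := hc => /(_ (fun n => powint_ge0 _ _ _))/(_ _ (e0 k))[n _].
  by move=> /(_ n (leqnn n)) hn; exists (h_ n).
have gL k : Lf (g k) by case: (gP k).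
have gh k : (powint m alpha (fun s => g k s - h s)%R <= (e k)%:E)%E by case: (gP k).
have mg k : measurable_fun setT (g k) by [].
have ndecr k : e k.+1 <= e k.
  rewrite /e; have aS : a k.+1 <= a k by rewrite /a exprS ler_piMl ?exprn_ge0// invf_le1 ?ler1n.
  rewrite ler_pM ?powR_ge0 ?(ltW (a0 _))// ge0_ler_powR ?nnegrE ?(ltW (a0 _)) ?(ltW alpha_gt0)//.
have step k : (powint m alpha (fun s => g k.+1 s - g k s)%R <= (2 `^ alpha * (2 * e k))%:E)%E.
  have -> : (fun s => g k.+1 s - g k s) = (fun s => (g k.+1 s - h s) + - 1 * (g k s - h s)).
    by apply/funext => s; ring.
  apply: (le_trans (powintD m alpha_gt0 _ _)).
  - exact: measurable_funB.
  - by apply: measurable_funM => //; exact: measurable_funB.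
  rewrite powintZ//; last exact: measurable_funB.
  rewrite normrN1 powR1 mul1e EFinM lee_pmul2l ?fin_numE// ?lte_fin ?powR_gt0//.
  by rewrite mulr_natl mulr2n EFinD leeD// (le_trans (gh _))// lee_fin.
pose u k := simple_integral M (g k).
have mu k : measurable_fun setT (u k) by exact: measurable_simple_integral.
pose F k := [set w | a k < `|u k.+1 w - u k w|].
have mF k : measurable (F k) by exact: measurable_dev.
pose C := tail_cst alpha * (2 `^ alpha * 2).
have PF k : (P (F k) <= (C * a k)%:E)%E.
  apply: (le_trans (simple_integral_diff_tail (gL k.+1) (gL k) (a0 k))).
  apply: (@le_trans _ _ ((tail_cst alpha * a k `^ (- alpha))%:E * (2 `^ alpha * (2 * e k))%:E)%E).
    rewrite lee_wpmul2l// lee_fin mulr_ge0 ?powR_ge0//.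
    rewrite mulr_ge0 ?invr_ge0// ?(ltW (one_sub_cos1_gt0))// subr_ge0 powRN invf_le1 ?powR_gt0//.
    rewrite [leLHS]pow1; apply: ge0_ler_powR; rewrite ?nnegrE ?(ltW alpha_gt0)// ler1n//.
  rewrite -EFinM lee_fin /e powRN /C le_eqVlt; apply/orP; left; apply/eqP.
  have : a k `^ alpha != 0 by rewrite gt_eqF// powR_gt0.
  by move=> ?; field.
(* Borel-Cantelli: almost surely all but finitely many steps are at most [2^(-k)], and the sequence
   is Cauchy. *)
have F0 : P (lim_sup_set F) = 0%E.
  apply: lim_sup_set_cvg0 => //.
  apply: (@le_lt_trans _ _ (C * (1 - 2^-1)^-1)%:E); last exact: ltry.
  have C0 : 0 <= C.
    by have := le_trans (measure_ge0 P (F 0%N)) (PF 0%N); rewrite lee_fin /a expr0 mulr1.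
  apply: lime_le; first exact: is_cvg_nneseries.
  apply: nearW => n; apply: (@le_trans _ _ (series (geometric C 2^-1) n)%:E); last first.
    by rewrite lee_fin geometric_le_lim// ger0_norm// invf_lt1 ?ltr1n.
  by rewrite /series/= -sumEFin; apply: lee_sum => i _; exact: PF.
(* The upper limit is measurable on all of [Omega], including where the sequence diverges; [fine]
   makes it real-valued there. *)
pose Y w := fine (limn_esup (fun k => (u k w)%:E)).
have mY : measurable_fun setT Y.
  apply: measurableT_comp => //; apply: measurable_fun_limn_esup => n.
  exact/measurable_EFinP.
have uY : {ae P, forall w, u n w @[n --> \oo] --> Y w}.
  exists (lim_sup_set F); split => //.
    by apply: bigcap_measurable => // k _; exact: bigcup_measurable.
  move=> w /= nuY; apply: contrapT => nF; apply: nuY.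
  have [N HN] : exists N, forall k, (N <= k)%N -> ~ F k w.
    apply: contrapT => H; apply: nF => N _; apply: contrapT => HN; apply: H.
    by exists N => k Nk Fk; apply: HN; exists k.
  have /(@fast_cauchy _ (fun k => u k w)) : forall k, (N <= k)%N -> `|u k.+1 w - u k w| <= 2^-1 ^+ k.
    by move=> k /HN/negP; rewrite -leNgt.
  move=> /cvg_ex[/= l ul]; have ul' : (u n w)%:E @[n --> \oo] --> l%:E by apply: cvg_EFin => //; exact: nearW.
  rewrite /Y is_cvg_limn_esupE; last by apply/cvg_ex; exists l%:E.
  by rewrite (cvg_lim _ ul').
exists Y; split => //; exists g; split => //.
  apply/(Lnorm_cvg0P m alpha_gt0); apply/cvge0P => [n|r r0]; first exact: powint_ge0.
  have [N _ HN] : \forall n \near \oo, a n <= r.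
    have /cvgr0Pnorm_le/(_ _ r0) := @pow_seq_cvg0 R.
    by apply: filterS => n; rewrite ger0_norm// ltW.
  near=> n; apply: (le_trans (gh n)); rewrite lee_fin.
  apply: (@le_trans _ _ (a n)); last by apply: HN; near: n; exists N.
  rewrite /e ler_piMr ?(ltW (a0 _))//.
  rewrite [leRHS]pow1; apply: ge0_ler_powR; rewrite ?nnegrE ?(ltW alpha_gt0) ?(ltW (a0 _))//.
  by rewrite exprn_ile1// invf_le1 ?ler1n.
exact: ae_cvg_in_probability.
Unshelve. all: by end_near. Qed.

Local Notation I := (stable_integral alpha m M).

Lemma stable_integralP (h : S -> R) : Lf h -> is_stable_integral alpha m M h (I h).
Proof. by move=> /stable_integral_exists[Y hY]; exact: (xgetPex (cst 0) (ex_intro _ Y hY)). Qed.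

Lemma measurable_stable_integral (h : S -> R) : measurable_fun setT (I h).
Proof. by rewrite /stable_integral; case: xgetP => [Y _ []|_]. Qed.

Lemma is_stable_integral_lin (a : R) (h1 h2 : S -> R) Y1 Y2 : Lf h1 -> Lf h2 ->
  is_stable_integral alpha m M h1 Y1 -> is_stable_integral alpha m M h2 Y2 ->
  is_stable_integral alpha m M (fun s => a * h1 s + h2 s) (fun w => a * Y1 w + Y2 w).
Proof.
move=> /(mem_LfunP m alpha_gt0)[m1 _] /(mem_LfunP m alpha_gt0)[m2 _].
move=> [mY1 [u [uL uc uY]]] [mY2 [v [vL vc vY]]].
split; first by apply: measurable_funD => //; exact: measurable_funM.
exists (fun n => cst_sfun a * u n + v n); split.
- by move=> n; exact: (LfunD alpha_gt0 (LfunZ alpha_gt0 a (uL n)) (vL n)).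
- move: uc vc => /(Lnorm_cvg0P m alpha_gt0) uc /(Lnorm_cvg0P m alpha_gt0) vc.
  apply/(Lnorm_cvg0P m alpha_gt0).
  pose b n := ((2 `^ alpha)%:E * ((`|a| `^ alpha)%:E * powint m alpha (fun s => u n s - h1 s)%R
     + powint m alpha (fun s => v n s - h2 s)%R))%E.
  apply: (@squeeze_cvge _ _ _ _ (cst 0%E) _ b); [|exact: cvg_cst|].
    apply: nearW => n; rewrite powint_ge0/=.
    have E : (fun s => (cst_sfun a * u n + v n) s - (a * h1 s + h2 s)) =
             (fun s => a * (u n s - h1 s) + (v n s - h2 s)).
      apply/funext => s; transitivity (a * u n s + v n s - (a * h1 s + h2 s)) => //; ring.
    have d1 : measurable_fun setT (fun s => u n s - h1 s) by exact: measurable_funB.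
    have d2 : measurable_fun setT (fun s => v n s - h2 s) by exact: measurable_funB.
    rewrite E /b -powintZ//; apply: powintD => //; exact: measurable_funM.
  rewrite [X in _ --> X](_ : _ = (2 `^ alpha)%:E * ((`|a| `^ alpha)%:E * 0 + 0))%E; last first.
    by rewrite mule0 adde0 mule0.
  have au : ((`|a| `^ alpha)%:E * powint m alpha (fun s => u n s - h1 s)%R @[n --> \oo]
      --> (`|a| `^ alpha)%:E * 0)%E by exact: (cvgeZl _ uc).
  have def0 : ((`|a| `^ alpha)%:E * 0 +? 0)%E by rewrite mule0.
  exact: (cvgeZl _ (cvgeD def0 au vc)).
- apply: (cvg_in_probability_lin (a := a) _ _ _ mY1 mY2 _ uY vY) => n.
  + exact: measurable_simple_integral.
  + exact: measurable_simple_integral.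
  + exact: measurable_simple_integral.
  + exact: (simple_integral_lin alpha_gt0 M_add a (uL n) (vL n)).
Qed.

(** The difference of two versions is a version of the integral of 0, so its law has scale 0. *)
Lemma is_stable_integral_unique (h : S -> R) Y1 Y2 : Lf h ->
  is_stable_integral alpha m M h Y1 -> is_stable_integral alpha m M h Y2 ->
  {ae P, forall w, Y1 w = Y2 w}.
Proof.
move=> hL h1 h2; have := is_stable_integral_lin (-1) hL hL h1 h2.
have -> : (fun s => -1 * h s + h s) = cst 0 by apply/funext => s /=; ring.
move=> /(stable_integral_law (Lfun_cst0 m alpha_gt0)).
have -> : powint m alpha (cst 0) = 0%E by apply/powint_eq0 => //; exact: aeW.
move=> /(stable_law0 alpha_gt0); apply: filterS => w /eqP.
by rewrite mulN1r addrC subr_eq0 eq_sym => /eqP.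
Qed.

Lemma stable_integral_lin (a : R) (h1 h2 : S -> R) : Lf h1 -> Lf h2 ->
  {ae P, forall w, I (fun s => a * h1 s + h2 s) w = a * I h1 w + I h2 w}.
Proof.
move=> L1 L2; have L := LfunD alpha_gt0 (LfunZ alpha_gt0 a L1) L2.
apply: (is_stable_integral_unique L (stable_integralP L)).
by apply: is_stable_integral_lin => //; exact: stable_integralP.
Qed.

(** An integral vanishing almost surely has cosine transform 1 at frequency 1, which forces the
    exponent [powint] to be 0. *)
Lemma stable_integral_eq0 (h : S -> R) : Lf h ->
  powint m alpha h = 0%E <-> {ae P, forall w, I h w = 0}.
Proof.
move=> hL; have lI := stable_integral_law hL (stable_integralP hL); split.
  by move=> h0; move: lI; rewrite h0 => /(stable_law0 alpha_gt0).
move=> I0; have [mI /(_ 1)] := lI; rewrite normr1 powR1 mul1r.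
have -> : \int[P]_w cos (1 * I h w) = \int[P]_w (1 : R).
  congr fine; apply: ae_eq_integral => //.
    apply/measurable_EFinP; apply: (measurableT_comp (continuous_measurable_fun (@continuous_cos R))).
    exact: measurable_funM.
  by apply: filterS I0 => w -> _; rewrite mulr0 cos0.
rewrite Rintegral_prob_cst -expR0 => /expR_inj/eqP; rewrite eq_sym oppr_eq0 => /eqP h0.
by rewrite -(Lfun_fineK hL) h0.
Qed.

Lemma is_stable_integral_linform (J : eqType) (g : J -> S -> R) (l : seq (R * J)) :
  (forall i, Lf (g i)) ->
  is_stable_integral alpha m M (fun s => linform l (g^~ s)) (fun w => linform l (fun i => I (g i) w)).
Proof.
move=> gL; elim: l => [|p l IH].
  have -> : (fun s => linform [::] (g^~ s)) = cst 0 by apply/funext => s; rewrite /linform big_nil.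
  have -> : (fun w => linform [::] (fun i => I (g i) w)) = simple_integral M (cst_sfun 0).
    apply/funext => w; rewrite /linform big_nil /simple_integral fsbig_finite//.
    rewrite big1_seq// => y; rewrite andTb in_fset_set; last exact: fimfunP.
    move=> /set_mem[s _ <-].
    by rewrite mul0r.
  by apply: simple_stable_integral; exact: Lfun_cst0.
have -> : (fun s => linform (p :: l) (g^~ s)) = (fun s => p.1 * g p.2 s + linform l (g^~ s)).
  by apply/funext => s; rewrite /linform big_cons.
have -> : (fun w => linform (p :: l) (fun i => I (g i) w)) =
    (fun w => p.1 * I (g p.2) w + linform l (fun i => I (g i) w)).
  by apply/funext => w; rewrite /linform big_cons.
apply: is_stable_integral_lin => //; [exact: Lfun_linform|exact: stable_integralP].
Qed.

Lemma stable_integral_cos (J : eqType) (g : J -> S -> R) (l : seq (R * J)) (c : R) :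
  (forall i, Lf (g i)) ->
  \int[P]_w cos (linform l (fun i => I (g i) w) + c) =
  cos c * expR (- fine (powint m alpha (fun s => linform l (g^~ s)))).
Proof.
move=> gL; have hI := is_stable_integral_linform l gL.
have hL := Lfun_linform alpha_gt0 l gL.
have [mL cL] := stable_integral_law hL hI; have := stable_integral_sin 1 hL hI.
have := cL 1; rewrite normr1 powR1 mul1r.
under eq_Rintegral do rewrite mul1r.
move=> {}cL; under eq_Rintegral do rewrite mul1r; move=> sL.
under eq_Rintegral do rewrite cosD.
have ic : P.-integrable setT (EFin \o (fun w => cos (linform l (fun i => I (g i) w)))).
  apply: (@bounded_integrable _ _ _ _ _ 1) => [|w]; last exact: cos_max.
  exact: (measurableT_comp (continuous_measurable_fun (@continuous_cos R))).
have isin : P.-integrable setT (EFin \o (fun w => sin (linform l (fun i => I (g i) w)))).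
  apply: (@bounded_integrable _ _ _ _ _ 1) => [|w]; last exact: sin_max.
  exact: (measurableT_comp (continuous_measurable_fun (@continuous_sin R))).
rewrite RintegralB//; [|exact: (integrableZr measurableT (cos c) ic)|exact: (integrableZr measurableT (sin c) isin)].
by rewrite !RintegralZr// cL sL mul0r subr0 mulrC.
Qed.
End stable_integral_theory.

(** * Radon-Nikodym densities and group actions *)

Section densities.
Context {R : realType} {d} {S : measurableType d}.
Implicit Types (m nu : {measure set S -> \bar R}) (w : S -> R).

Definition is_density (nu : set S -> \bar R) m w : Prop :=
  [/\ measurable_fun setT w, forall s, 0 <= w s &
      forall A, measurable A -> nu A = (\int[m]_(s in A) (w s)%:E)%E].

(** Equal integrals identify functions only where these are integrable. Hence the exhaustion by sets
    of finite measure on which [w] is bounded. *)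
Lemma density_unique (m : {sigma_finite_measure set S -> \bar R})
    (nu : set S -> \bar R) (w w' : S -> R) :
  is_density nu m w -> is_density nu m w' -> {ae m, forall s, w s = w' s}.
Proof.
move=> [mw w0 dw] [mw' w'0 dw'].
have [F FT /all_and2[mF Ffin]] := sigma_finiteT m.
have mD n k : measurable (F n `&` [set s | w s <= k%:R]).
  by apply: measurableI => //; exact: measurable_ler_set.
have aeD n k : ae_eq m (F n `&` [set s | w s <= k%:R]) (EFin \o w) (EFin \o w').
  apply: integral_ae_eq => //.
  - apply/integrableP; split; first exact/measurable_EFinP/measurable_funTS.
    apply: (@le_lt_trans _ _ (\int[m]_(s in F n `&` [set s | (w s <= k%:R)%R]) k%:R%:E)%E).
      apply: ge0_le_integral => //.
      + by apply/measurable_EFinP/measurable_funTS; exact: measurableT_comp.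
      + by move=> s [_ /= wk]; rewrite lee_fin ger0_norm.
    rewrite integral_cst// lte_mul_pinfty// (le_lt_trans _ (Ffin n))//.
    by rewrite le_measure ?inE//; exact: subIsetl.
  - exact/measurable_EFinP/measurable_funTS.
  - by move=> A AD mA; rewrite -dw// -dw'.
have : m.-negligible (\bigcup_n \bigcup_k (~` [set s | (F n `&` [set s | w s <= k%:R]) s -> w s = w' s])).
  apply: negligible_bigcup => n; apply: negligible_bigcup => k.
  by move: (aeD n k); apply: filterS => s H /H [].
apply: negligibleS => s /= ww'.
have [n _ Fns] : (\bigcup_n F n) s by rewrite -FT.
exists n => //; exists (Num.bound (w s)) => //= H; apply: ww'; apply: H.
by split => //=; rewrite ltW// archi_boundP.
Qed.

(** The measure is cut into finite pieces over a partition and the densities of the pieces are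
    added. The sum is finite almost everywhere because its integral over each set of the partition
    is finite. *)
Lemma density_exists (m : {sigma_finite_measure set S -> \bar R}) nu :
  (exists F : nat -> set S, \bigcup_n F n = setT /\
     forall n, measurable (F n) /\ (nu (F n) < +oo)%E) ->
  nu `<< m -> exists w, is_density nu m w.
Proof.
move=> [F [FT /all_and2[mF Ffin]]] /null_content_dominatesP num.
pose E := seqDU F.
have mE k : measurable (E k).
  by apply: measurableD => //; exact: bigsetU_measurable.
have Efin k : (nu (E k) < +oo)%E.
  by rewrite (le_lt_trans _ (Ffin k))// le_measure ?inE//; exact: subDsetl.
have ET : \bigcup_i E i = [set: S] by rewrite -FT [RHS]seqDU_bigcup_eq.
have tE : trivIset setT E by exact: trivIset_seqDU.
pose nu_ k : {finite_measure set S -> \bar R} := mfrestr (mE k) (Efin k).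
have nukm k : nu_ k `<< m.
  apply/null_content_dominatesP => A mA mA0; apply: num; first exact: measurableI.
  by apply/eqP; rewrite eq_le measure_ge0 andbT -mA0 le_measure ?inE//; exact: measurableI.
have /choice[g gP] k := radon_nikodym_sigma_finite (nukm k).
have g0 k s : (0 <= g k s)%E by case: (gP k).
have mg k : measurable_fun setT (g k) by case: (gP k) => _ _ /integrableP[].
have gE k A : measurable A -> nu_ k A = (\int[m]_(s in A) g k s)%E by move=> mA; case: (gP k) => _ _ _ ->.
pose f s := (\sum_(k <oo) g k s)%E.
have mf : measurable_fun setT f by exact: ge0_emeasurable_sum.
have f0 s : (0 <= f s)%E by exact: nneseries_ge0.
have nuf A : measurable A -> nu A = (\int[m]_(s in A) f s)%E.
  move=> mA; rewrite integral_nneseries//; last by move=> k; exact: measurable_funTS.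
  transitivity (\sum_(k <oo) nu (A `&` E k))%E.
    rewrite -[in LHS](setIT A) -ET setI_bigcupr measure_semi_bigcup//.
    - by move=> i; exact: measurableI.
    - exact: trivIset_setIl.
    - by rewrite -setI_bigcupr ET setIT.
  by apply: eq_eseriesr => k _; rewrite -gE.
have ff : {ae m, forall s, f s \is a fin_num}.
  have : m.-negligible (\bigcup_k ~` [set s | E k s -> f s \is a fin_num]).
    apply: negligible_bigcup => k; apply: (integrable_ae (mE k)).
    apply/integrableP; split; first exact: measurable_funTS.
    by under eq_integral do rewrite gee0_abs//; rewrite -nuf.
  apply: negligibleS => s /= nf; have [k _ Eks] : (\bigcup_k E k) s by rewrite ET.
  by exists k => //= H; apply: nf; exact: H.
exists (fine \o f); split.
- exact: measurableT_comp.
- by move=> s /=; rewrite fine_ge0.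
- move=> A mA; rewrite nuf//; apply: ae_eq_integral => //.
  + exact: measurable_funTS.
  + by apply/measurable_EFinP; apply: measurableT_comp => //; exact: measurable_funTS.
  + by apply: filterS ff => s fs _ /=; rewrite fineK.
Qed.

Import HBNNSimple.

Lemma ge0_integral_density m nu w (F : S -> \bar R) : is_density nu m w ->
  measurable_fun setT F -> (forall s, 0 <= F s)%E ->
  (\int[nu]_s F s = \int[m]_s (F s * (w s)%:E))%E.
Proof.
move=> [mw w0 dw] mF F0; pose h := nnsfun_approx measurableT mF.
have mw' : measurable_fun setT (EFin \o w) by exact/measurable_EFinP.
have hF s : EFin \o h^~ s @ \oo --> F s by exact: cvg_nnsfun_approx.
have nd s : {homo (fun n => h n s) : a b / (a <= b)%N >-> a <= b}.
  by move=> a b ab; exact/lefP/nd_nnsfun_approx.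
transitivity (limn (fun n => \int[nu]_s (h n s)%:E)%E).
  rewrite -monotone_convergence//.
  - by apply: eq_integral => s _; apply/esym/cvg_lim => //; exact: hF.
  - by move=> n; exact/measurable_EFinP.
  - by move=> n s _; rewrite lee_fin.
  - by move=> s _ a b ab; rewrite lee_fin nd.
transitivity (limn (fun n => \int[m]_s ((h n s)%:E * (w s)%:E))%E); last first.
  rewrite -monotone_convergence//.
  - by apply: eq_integral => s _; apply/cvg_lim => //; apply: cvgeZr => //; exact: hF.
  - by move=> n; apply: emeasurable_funM => //; exact/measurable_EFinP.
  - by move=> n s _; rewrite mule_ge0 ?lee_fin.
  - by move=> s _ a b ab; rewrite lee_wpmul2r ?lee_fin ?nd.
congr (limn _); apply/funext => n.
have ind y : measurable_fun setT (fun s => (y * \1_(h n @^-1` [set y]) s)%:E).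
  by apply/measurable_EFinP; exact: measurable_funM.
transitivity (\int[nu]_s (\sum_(y \in range (h n)) (y * \1_(h n @^-1` [set y]) s)%:E))%E.
  by apply: eq_integral => s _; rewrite [in LHS]fimfunE fsumEFin.
rewrite ge0_integral_fsum//; last by move=> y s _; exact: nnfun_muleindic_ge0.
transitivity (\int[m]_s (\sum_(y \in range (h n)) (y * \1_(h n @^-1` [set y]) s)%:E * (w s)%:E))%E; last first.
  apply: eq_integral => s _; rewrite -ge0_mule_fsuml => [|y]; last exact: nnfun_muleindic_ge0.
  by rewrite fsumEFin// -fimfunE.
rewrite ge0_integral_fsum//; last 2 first.
- by move=> y; exact: emeasurable_funM.
- by move=> y s _; rewrite mule_ge0 ?lee_fin ?w0//; exact: nnfun_muleindic_ge0.
apply: eq_fsbigr => y; rewrite inE => -[s _ <-]; set c := h n s.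
have c0 : 0 <= c by [].
have mA : measurable (h n @^-1` [set c]) by exact: measurable_sfunP.
under eq_integral do rewrite EFinM.
rewrite ge0_integralZl//; last exact/measurable_EFinP.
under [RHS]eq_integral do rewrite EFinM -muleA.
rewrite [RHS]ge0_integralZl//; last first.
- by move=> x _; rewrite mule_ge0 ?lee_fin.
- by apply: emeasurable_funM => //; exact/measurable_EFinP.
congr (_ * _)%E; rewrite integral_indic// setIT dw//.
under [RHS]eq_integral do rewrite muleC.
rewrite [in LHS]integral_mkcond; apply: eq_integral => x _.
by rewrite epatch_indic.
Qed.
End densities.

Section weighted_measure.
Context {R : realType} {d} {S : measurableType d} (m : {measure set S -> \bar R}).
Variable w : S -> R.

(** The proofs of measurability and positivity are arguments so that the measure structure can be
    attached to the term. *)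
Definition weighted of measurable_fun setT w & (forall s, 0 <= w s) :=
  fun A : set S => (\int[m]_(s in A) (w s)%:E)%E.

Hypotheses (mw : measurable_fun setT w) (w0 : forall s, 0 <= w s).
Let mw' : measurable_fun setT (EFin \o w). Proof. exact/measurable_EFinP. Qed.

Let weighted0 : weighted mw w0 set0 = 0%E. Proof. exact: integral_set0. Qed.

Let weighted_ge0 A : (0 <= weighted mw w0 A)%E.
Proof. by apply: integral_ge0 => s _; rewrite lee_fin. Qed.

Let weighted_sigma_additive : semi_sigma_additive (weighted mw w0).
Proof.
move=> F mF tF mUF; rewrite /weighted ge0_integral_bigcup//; last 2 first.
- exact: measurable_funTS.
- by move=> s _; rewrite lee_fin.
apply: is_cvg_ereal_nneg_natsum_cond => n _ _.
by apply: integral_ge0 => s _; rewrite lee_fin.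
Qed.

HB.instance Definition _ := isMeasure.Build _ _ _ (weighted mw w0)
  weighted0 weighted_ge0 weighted_sigma_additive.

Lemma weighted_density : is_density (weighted mw w0) m w.
Proof. by []. Qed.

End weighted_measure.

(** * Walks and word balls *)

Section word_balls.
Context {G : groupType} (D : {fset G}).
Local Open Scope group_scope.
Implicit Types (t u v : G).

Lemma walk0 : cayley_walk D 1 0.
Proof. by exists [::]. Qed.

Lemma walk0P t : cayley_walk D t 0 -> t = 1.
Proof. by move=> [[|x p] [_ <- ]]. Qed.

Lemma walkS t n (x : G) : cayley_walk D t n -> x \in D -> cayley_walk D (t * x) n.+1.
Proof.
move=> [p [pp lp sp]] xD; exists (rcons p (t * x)); split.
- by rewrite rcons_path pp lp /cayley_edge mulgA mulVg mul1g.
- by rewrite last_rcons.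
- by rewrite size_rcons sp.
Qed.

Lemma walkSP t n : cayley_walk D t n.+1 ->
  exists u (x : G), [/\ cayley_walk D u n, x \in D & t = u * x].
Proof.
move=> [p [pp lp sp]]; case/lastP: p pp lp sp => // p x.
rewrite rcons_path last_rcons size_rcons => /andP[pp ex] xt [sp].
exists (last 1 p), ((last 1 p)^-1 * x); split => //; first by exists p.
by rewrite mulgA mulgV mul1g xt.
Qed.

Lemma walkD t u n k : cayley_walk D t n -> cayley_walk D u k -> cayley_walk D (t * u) (n + k)%N.
Proof.
move=> wt; elim: k u => [|k IH] u; first by move=> /walk0P ->; rewrite mulg1 addn0.
by move=> /walkSP[v [x [wv xD ->]]]; rewrite mulgA addnS; apply: walkS => //; exact: IH.
Qed.

Lemma walkDP t n k : cayley_walk D t (n + k)%N ->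
  exists u v, [/\ cayley_walk D u n, cayley_walk D v k & t = u * v].
Proof.
elim: k t => [|k IH] t.
  by rewrite addn0 => wt; exists t, 1; split; rewrite ?mulg1//; exact: walk0.
rewrite addnS => /walkSP[u [x [/IH[u' [v [wu wv ->]]] xD ->]]].
by exists u', (v * x); rewrite mulgA; split => //; exact: walkS.
Qed.

Lemma finite_walk n : finite_set [set t | cayley_walk D t n].
Proof.
elim: n => [|n IH]; first by apply: (sub_finite_set (B := [set 1])) => // t /walk0P.
apply: (sub_finite_set (B := (fun p => p.1 * p.2) @` ([set t | cayley_walk D t n] `*` [set` D]))).
  by move=> t /walkSP[u [x [wu xD ->]]]; exists (u, x).
by apply: finite_image; exact: finite_setX.
Qed.

Hypothesis D_sym : forall t, t \in D -> t^-1 \in D.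
Hypothesis D_gen : generates D.

Lemma walkV t n : cayley_walk D t n -> cayley_walk D t^-1 n.
Proof.
elim: n t => [|n IH] t; first by move=> /walk0P ->; rewrite invg1; exact: walk0.
move=> /walkSP[u [x [wu xD ->]]]; rewrite invgM -add1n; apply: walkD; last exact: IH.
by rewrite -[x^-1]mul1g; apply: walkS; [exact: walk0|exact: D_sym].
Qed.

Lemma walk_exists t : exists n, cayley_walk D t n.
Proof.
pose H : {pred G} := [pred t | `[< exists n, cayley_walk D t n >] ].
have /asboolP// : t \in H.
apply: D_gen => [|x xD].
  split; first by apply/asboolP; exists 0%N; exact: walk0.
  move=> x y /asboolP[n xn] /asboolP[k yk]; apply/asboolP; exists (n + k)%N.
  by apply: walkD => //; exact: walkV.
by apply/asboolP; exists 1%N; rewrite -[x]mul1g; apply: walkS => //; exact: walk0.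
Qed.

Lemma word_lengthP t : cayley_walk D t (word_length D t) /\
  forall k, cayley_walk D t k -> (word_length D t <= k)%N.
Proof.
have ex : exists n, `[< cayley_walk D t n >] by have [n wn] := walk_exists t; exists n; exact/asboolP.
apply: (@xgetPex _ 0%N [set n | cayley_walk D t n /\ forall k, cayley_walk D t k -> (n <= k)%N]).
case: (ex_minnP ex) => n /asboolP wn min; exists n; split => // k wk.
by apply: min; exact/asboolP.
Qed.

Lemma word_ballP t n : word_ball D n t <-> exists2 k, (k <= n)%N & cayley_walk D t k.
Proof.
have [wt min] := word_lengthP t; split; first by exists (word_length D t).
by move=> [k kn /min tk]; exact: leq_trans kn.
Qed.

Lemma finite_word_ball n : finite_set (word_ball D n).
Proof.
apply: (sub_finite_set (B := \bigcup_(k in `I_n.+1) [set t | cayley_walk D t k])).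
  by move=> t /word_ballP[k kn wk]; exists k.
by apply: bigcup_finite => // k _; exact: finite_walk.
Qed.

Lemma word_ball1 n : word_ball D n 1.
Proof. by apply/word_ballP; exists 0%N => //; exact: walk0. Qed.

Lemma word_ballM n k t u : word_ball D n t -> word_ball D k u -> word_ball D (n + k)%N (t * u).
Proof.
move=> /word_ballP[i iN wi] /word_ballP[j jk wj]; apply/word_ballP; exists (i + j)%N.
  exact: leq_add.
exact: walkD.
Qed.

Definition ball_size n := #|` fset_set (word_ball D n)|.

Lemma mem_ball n t : (t \in fset_set (word_ball D n)) = (t \in word_ball D n).
Proof. by rewrite in_fset_set//; exact: finite_word_ball. Qed.

Lemma ball_size_gt0 n : (0 < ball_size n)%N.
Proof.
rewrite cardfs_gt0; apply/fset0Pn; exists 1.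
by rewrite mem_ball inE; exact: word_ball1.
Qed.

(** A walk of length at most [n + k] splits into walks of lengths at most [n] and [k], so
    [E_(n + k)] is contained in the product set [E_n E_k]. *)
Lemma ball_size_submul n k : (ball_size (n + k) <= ball_size n * ball_size k)%N.
Proof.
rewrite /ball_size; set E := fset_set _; set A := fset_set (word_ball D n).
set B := fset_set (word_ball D k).
have sub : {subset E <= [seq (x * y)%g | x <- enum_fset A, y <- enum_fset B]}.
  move=> t; rewrite mem_ball inE => /word_ballP[i ink wt].
  have [j jn ijk] : exists2 j, (j <= n)%N & (i <= j + k)%N.
    exists (minn i n); first exact: geq_minr.
    by case: (leqP i n) => // _; exact: leq_addr.
  have [j' ij] : exists2 j', (j' <= k)%N & (minn i j + j' = i)%N.
    case: (leqP i j) => ij; first by exists 0%N; rewrite ?addn0.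
    by exists (i - j)%N; rewrite ?leq_subLR// subnKC// ltnW.
  move=> ije; move: wt; rewrite -ije => /walkDP[u [v [wu wv ->]]].
  apply/allpairsP; exists (u, v) => /=; split => //; rewrite mem_ball inE.
    by apply/word_ballP; exists (minn i j) => //; rewrite (leq_trans (geq_minr _ _)).
  by apply/word_ballP; exists j'.
by have := uniq_leq_size (fset_uniq E) sub; rewrite size_allpairs.
Qed.

(** A finite set with [N] elements lies in the ball whose radius is its largest word length. *)
Lemma ball_size_unbounded : infinite_set [set: G] -> forall N : nat,
  exists n, forall k, (n <= k)%N -> (N <= ball_size k)%N.
Proof.
move=> /infinite_set_fset infG N; have [B _ NB] := infG N.
exists (\max_(t <- enum_fset B) word_length D t) => k nk; apply: (leq_trans NB).
apply: fsubset_leq_card; apply/fsubsetP => t tB; rewrite mem_ball inE.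
apply: leq_trans nk; exact: leq_bigmax_seq.
Qed.

End word_balls.

(** * Maxima over word balls *)

Section ball_max.
Context {R : realType} {G : groupType} (D : {fset G}).
Implicit Types y : G -> R.
Hypothesis D_sym : forall t : G, t \in D -> (t^-1)%g \in D.
Hypothesis D_gen : generates D.

Lemma ball_max_ge0 y n : 0 <= ball_max D y n.
Proof. by rewrite /ball_max; elim/big_rec: _ => // t z _ z0; rewrite le_max z0 orbT. Qed.

Lemma le_ball_max y n t : word_ball D n t -> y t <= ball_max D y n.
Proof.
move=> tn; have : t \in fset_set (word_ball D n) by rewrite mem_ball// inE.
rewrite /ball_max -[t \in _]/(t \in enum_fset _); elim: (enum_fset _) => // x l IH.
by rewrite in_cons big_cons => /predU1P[<-|/IH tl]; rewrite le_max ?lexx// tl orbT.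
Qed.

Lemma ball_max_le y n (c : R) : 0 <= c -> (forall t, word_ball D n t -> y t <= c) ->
  ball_max D y n <= c.
Proof.
move=> c0 yc; rewrite /ball_max big_seq; elim/big_rec: _ => // t z.
by rewrite mem_ball// inE => tn zc; rewrite ge_max yc.
Qed.

Lemma ball_max_attained y n : (forall t, 0 <= y t) ->
  exists2 t, word_ball D n t & ball_max D y n = y t.
Proof.
(* If the fold returns its initial value 0, the nonnegative value at the identity must be 0, so the
   identity attains the maximum. *)
move=> y0; suff [H|//] : ball_max D y n = 0 \/ exists2 t, word_ball D n t & ball_max D y n = y t.
  exists 1%g; first exact: word_ball1.
  apply/eqP; rewrite eq_le; apply/andP; split; first by rewrite H.
  exact/le_ball_max/word_ball1.
rewrite /ball_max big_seq; elim/big_rec: _ => [|t z]; first by left.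
rewrite (mem_ball D_sym D_gen) inE => tn IH.
have [zt|tz] := leP z (y t); first by right; exists t.
exact: IH.
Qed.

Lemma ball_max_sum y n : (forall t, 0 <= y t) ->
  ball_max D y n <= \sum_(t <- fset_set (word_ball D n)) y t.
Proof.
move=> y0; apply: ball_max_le => [|t tn]; first exact: sumr_ge0.
have tE : t \in enum_fset (fset_set (word_ball D n)) by rewrite mem_ball// inE.
by rewrite (big_rem t tE)/= lerDl sumr_ge0.
Qed.

Lemma measurable_ball_max d (S : measurableType d) (y : G -> S -> R) n :
  (forall t, measurable_fun setT (y t)) -> measurable_fun setT (fun s => ball_max D (y^~ s) n).
Proof.
move=> my; rewrite /ball_max; elim: (enum_fset _) => [|t l IH].
  by under eq_fun do rewrite big_nil; exact: measurable_cst.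
by under eq_fun do rewrite big_cons; exact: measurable_maxr.
Qed.

Lemma ball_normingE (alpha : R) n : ball_norming alpha D n = (ball_size D n)%:R `^ alpha^-1.
Proof. by []. Qed.
End ball_max.

(** * Derivatives of a nonsingular action *)

Section nonsingular_action.
Context {R : realType} {G : groupType} {d} {S : measurableType d}.
Variables (phi : G -> S -> S).
Hypothesis phi_act : is_action phi.

Lemma action_measurable t : measurable_fun setT (phi t).
Proof. by case: phi_act. Qed.

Lemma action1 s : phi 1%g s = s.
Proof. by case: phi_act => _ -> _. Qed.

Lemma actionM t u s : phi (t * u)%g s = phi u (phi t s).
Proof. by case: phi_act => _ _ ->. Qed.

Lemma actionK t s : phi t^-1%g (phi t s) = s.
Proof. by rewrite -actionM mulgV action1. Qed.

Lemma actionVK t s : phi t (phi t^-1%g s) = s.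
Proof. by rewrite -actionM mulVg action1. Qed.

Lemma action_image t (A : set S) : phi t @` A = phi t^-1%g @^-1` A.
Proof.
apply/seteqP; split => [_ [s As <-]|s /= As]; first by rewrite /= actionK.
by exists (phi t^-1%g s) => //; rewrite actionVK.
Qed.

Lemma measurable_action_preimage t (A : set S) : measurable A -> measurable (phi t @^-1` A).
Proof. by move=> mA; rewrite -[X in measurable X]setTI; exact: action_measurable. Qed.

Lemma measurable_action_image t (A : set S) : measurable A -> measurable (phi t @` A).
Proof. by move=> mA; rewrite action_image; exact: measurable_action_preimage. Qed.

Section measure.
Variable m : {sigma_finite_measure set S -> \bar R}.
Hypothesis phi_ns : nonsingular m phi.

Let nu t : {measure set S -> \bar R} :=
  measure_function_pushforward__canonical__measure_function_Measure m (action_measurable t^-1%g).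

Lemma translateE t : translate m phi t = nu t.
Proof. by apply/funext => A; rewrite /translate action_image. Qed.

Lemma action_null t (A : set S) : measurable A -> m (phi t @^-1` A) = 0%E <-> m A = 0%E.
Proof.
move=> mA; have [] := phi_ns t^-1%g; rewrite translateE.
move=> /null_content_dominatesP h1 /null_content_dominatesP h2.
have E : nu t^-1%g A = m (phi t @^-1` A) by rewrite /nu/= /pushforward invgK.
by split => [|/(h1 _ mA)]; rewrite -E// => /(h2 _ mA).
Qed.

Lemma ae_action t (Q : S -> Prop) : {ae m, forall s, Q s} -> {ae m, forall s, Q (phi t s)}.
Proof.
move=> [N [mN N0 NQ]]; exists (phi t @^-1` N); split.
- exact: measurable_action_preimage.
- exact/action_null.
- by move=> s /= nQ; apply: NQ.
Qed.

Local Notation rn := (rn_deriv m phi).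

Lemma rnP t : is_density (translate m phi t) m (rn t).
Proof.
have ex : exists w, is_density (nu t) m w.
  apply: density_exists.
    have [F FT mF] := sigma_finiteT m; exists (fun n => phi t^-1%g @` F n); split.
      apply/seteqP; split => // s _; have [n _ Fn] : (\bigcup_n F n) (phi t s) by rewrite -FT.
      by exists n => //; exists (phi t s) => //; rewrite actionK.
    move=> n; have [mFn Fn] := mF n; split; first exact: measurable_action_image.
    rewrite /nu /= /pushforward (_ : _ @^-1` _ = F n)//.
    apply/seteqP; split => s /=; last by exists s.
    by move=> [x Fx /(congr1 (phi t))]; rewrite !actionVK => <-.
  by rewrite -translateE; have [] := phi_ns t.
by rewrite translateE /rn_deriv /density translateE; exact: (xgetPex (cst 0) ex).
Qed.

Lemma measurable_rn t : measurable_fun setT (rn t). Proof. by case: (rnP t). Qed.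
Lemma rn_ge0 t s : 0 <= rn t s. Proof. by case: (rnP t). Qed.

(** [m o phi_t] is the image of [m] under [phi_(t^-1)]; integrating [F o phi_t] against it undoes
    the map. *)
Lemma rn_change_of_variables t (F : S -> \bar R) : measurable_fun setT F ->
  (forall s, 0 <= F s)%E -> (\int[m]_s ((rn t s)%:E * F (phi t s)) = \int[m]_s F s)%E.
Proof.
move=> mF F0; have := rnP t; rewrite translateE => dt.
have mFt : measurable_fun setT (F \o phi t) by apply: measurableT_comp => //; exact: action_measurable.
under eq_integral do rewrite muleC.
rewrite -(ge0_integral_density dt mFt); last by move=> s; exact: F0.
rewrite (@ge0_integral_pushforward _ _ _ _ _ _ (action_measurable t^-1%g) m setT)//; last first.
  by move=> s _; exact: F0.
by apply: eq_integral => s _ /=; rewrite actionVK.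
Qed.

Lemma rn_change_of_variables_set t (w : S -> R) (A : set S) : measurable_fun setT w ->
  (forall s, 0 <= w s) -> measurable A ->
  (\int[m]_(s in A) (rn t s * w (phi t s))%:E = \int[m]_(s in phi t @` A) (w s)%:E)%E.
Proof.
move=> mw w0 mA; rewrite [in LHS]integral_mkcond [in RHS]integral_mkcond.
have mA' := measurable_action_image t mA.
rewrite -[RHS](@rn_change_of_variables t); first last.
- by move=> s; rewrite patchE; case: ifP => // _; rewrite lee_fin.
- by apply/(measurable_restrictT _ _).1 => //; apply/measurable_funTS/measurable_EFinP.
apply: eq_integral => s _; rewrite !patchE action_image.
have -> : (phi t s \in phi t^-1%g @^-1` A) = (s \in A).
  by apply/idP/idP; rewrite !inE /= actionK.
by case: ifP; rewrite ?mule0 ?EFinM.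
Qed.

Lemma density_translate t (nu' : set S -> \bar R) w : is_density nu' m w ->
  is_density (fun A => nu' (phi t @` A)) m (fun s => rn t s * w (phi t s)).
Proof.
move=> [mw w0 dw]; split.
- apply: measurable_funM; first exact: measurable_rn.
  by apply: measurableT_comp => //; exact: action_measurable.
- by move=> s; rewrite mulr_ge0// rn_ge0.
- by move=> A mA; rewrite rn_change_of_variables_set// dw//; exact: measurable_action_image.
Qed.

(** Chain rule: both sides are densities of [m o phi_(t u)]. The exceptional null set depends on [t]
    and [u], which is harmless because a ball contains finitely many elements. *)
Lemma rnM t u : {ae m, forall s, rn (t * u)%g s = rn t s * rn u (phi t s)}.
Proof.
have := density_translate t (rnP u).
rewrite (_ : (fun A => _) = translate m phi (t * u)%g); last first.
  apply/funext => A; congr (m _); apply/seteqP; split.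
    by move=> _ [_ [s As <-] <-]; exists s => //; rewrite actionM.
  by move=> _ [s As <-]; exists (phi t s); [exists s|rewrite actionM].
exact: density_unique (rnP _).
Qed.

Lemma rn1 : {ae m, forall s, rn 1%g s = 1}.
Proof.
apply: (density_unique (rnP 1%g)); split => // A mA.
rewrite integral_cst// mul1e /translate; congr (m _); apply/seteqP; split.
  by move=> _ [s As <-]; rewrite action1.
by move=> s As; exists s => //; rewrite action1.
Qed.
End measure.
End nonsingular_action.

(** * Sublinear weights *)

Section negligible_growth.
Context {R : realType} {G : groupType} (D : {fset G}).
Context {d} {S : measurableType d} (phi : G -> S -> S).
Hypothesis D_sym : forall t, t \in D -> (t^-1)%g \in D.
Hypothesis D_gen : generates D.
Hypothesis phi_act : is_action phi.
Variable m : {sigma_finite_measure set S -> \bar R}.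
Hypothesis phi_ns : nonsingular m phi.
Implicit Types (w : S -> R) (E : set S).

Local Notation rn := (rn_deriv m phi).
Local Notation k_ n := ((ball_size D n)%:R : R).

Definition max_integral n w : \bar R :=
  (\int[m]_s (ball_max D (fun t => rn t s * w (phi t s)) n)%:E)%E.
Local Notation Q := max_integral.

Definition admissible w :=
  [/\ measurable_fun setT w, forall s, 0 <= w s & (\int[m]_s (w s)%:E < +oo)%E].

Definition sublinear w := forall e : R, 0 < e ->
  \forall n \near \oo, (Q n w <= (e * k_ n)%:E)%E.

Lemma word_ball_enum n t : word_ball D n t -> t \in enum_fset (fset_set (word_ball D n)).
Proof.
by move=> tn; have : t \in fset_set (word_ball D n) by rewrite mem_ball// inE.
Qed.

Lemma measurable_trans t w : measurable_fun setT w ->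
  measurable_fun setT (fun s => rn t s * w (phi t s)).
Proof.
move=> mw; apply: measurable_funM; first exact: measurable_rn.
by apply: measurableT_comp => //; exact: action_measurable.
Qed.

Lemma measurable_ball_trans n w : measurable_fun setT w ->
  measurable_fun setT (fun s => (ball_max D (fun t => rn t s * w (phi t s)) n)%:E).
Proof.
by move=> mw; apply/measurable_EFinP/measurable_ball_max => t; exact: measurable_trans.
Qed.

Lemma trans_ge0 w t s : (forall s, 0 <= w s) -> 0 <= rn t s * w (phi t s).
Proof. by move=> w0; rewrite mulr_ge0// rn_ge0. Qed.

Lemma max_integral_ge0 n w : (0 <= Q n w)%E.
Proof. by apply: integral_ge0 => s _; rewrite lee_fin ball_max_ge0. Qed.

(** Only the finitely many maps [phi t] with [t] in the ball occur, and each of them preserves null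
    sets. *)
Lemma ae_le_max_integral n w w' : measurable_fun setT w -> measurable_fun setT w' ->
  {ae m, forall s, w s <= w' s} -> (Q n w <= Q n w')%E.
Proof.
move=> mw mw' ww'; apply: ae_ge0_le_integral => //.
- by move=> s _; rewrite lee_fin ball_max_ge0.
- exact: measurable_ball_trans.
- by move=> s _; rewrite lee_fin ball_max_ge0.
- exact: measurable_ball_trans.
have H t : t \in enum_fset (fset_set (word_ball D n)) -> {ae m, forall s, w (phi t s) <= w' (phi t s)}.
  by move=> _; exact: (ae_action phi_act phi_ns t ww').
apply: filterS (ae_all_seq H) => s {}H _; rewrite lee_fin.
apply: ball_max_le => //; first exact: ball_max_ge0.
move=> t tn; apply: (@le_trans _ _ (rn t s * w' (phi t s))).
  by rewrite ler_wpM2l ?rn_ge0// H// word_ball_enum.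
exact: (le_ball_max D_sym D_gen (fun t => rn t s * w' (phi t s))).
Qed.

Lemma max_integralD n w w' : measurable_fun setT w -> measurable_fun setT w' ->
  (Q n (fun s => w s + w' s)%R <= Q n w + Q n w')%E.
Proof.
move=> mw mw'; have m1 := measurable_ball_trans n mw; have m2 := measurable_ball_trans n mw'.
rewrite /Q -ge0_integralD//; try by move=> s _; rewrite lee_fin ball_max_ge0.
apply: ge0_le_integral => //.
- by move=> s _; rewrite lee_fin ball_max_ge0.
- by have := measurable_ball_trans n (measurable_funD mw mw').
- exact: emeasurable_funD.
move=> s _; rewrite -EFinD lee_fin; apply: ball_max_le => //.
  by rewrite addr_ge0// ball_max_ge0.
move=> t tn; rewrite mulrDr lerD//.
  exact: (le_ball_max D_sym D_gen (fun t => rn t s * w (phi t s))).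
exact: (le_ball_max D_sym D_gen (fun t => rn t s * w' (phi t s))).
Qed.

Lemma max_integralZ n (c : R) w : 0 <= c -> measurable_fun setT w ->
  (Q n (fun s => (c * w s)%R) <= c%:E * Q n w)%E.
Proof.
move=> c0 mw; have m1 := measurable_ball_trans n mw.
rewrite /Q -ge0_integralZl//; last by move=> s _; rewrite lee_fin ball_max_ge0.
apply: ge0_le_integral => //.
- by move=> s _; rewrite lee_fin ball_max_ge0.
- by have := measurable_ball_trans n (measurable_funM (measurable_cst c) mw).
- exact: measurable_funeM.
move=> s _; rewrite -EFinM lee_fin; apply: ball_max_le => //.
  by rewrite mulr_ge0// ball_max_ge0.
move=> t tn; rewrite mulrCA ler_wpM2l//.
exact: (le_ball_max D_sym D_gen (fun t => rn t s * w (phi t s))).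
Qed.

Lemma integral_trans t w : measurable_fun setT w -> (forall s, 0 <= w s) ->
  (\int[m]_s (rn t s * w (phi t s))%:E = \int[m]_s (w s)%:E)%E.
Proof.
move=> mw w0; rewrite -(rn_change_of_variables phi_act phi_ns t (F := EFin \o w))//.
exact/measurable_EFinP.
Qed.

Lemma integral_ball_sum n w : measurable_fun setT w -> (forall s, 0 <= w s) ->
  (\int[m]_s (\sum_(t <- fset_set (word_ball D n)) rn t s * w (phi t s))%:E =
   (k_ n)%:E * \int[m]_s (w s)%:E)%E.
Proof.
move=> mw w0; under eq_integral do rewrite -sumEFin.
rewrite ge0_integral_sum//; first last.
- by move=> t s _; rewrite lee_fin trans_ge0.
- by move=> t; apply/measurable_EFinP; exact: measurable_trans.
under eq_bigr do rewrite integral_trans//.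
rewrite /ball_size -[X in _ = (X%:R%:E * _)%E]/(size (enum_fset (fset_set (word_ball D n)))).
elim: (enum_fset _) => [|t l IH] /=; first by rewrite big_nil mul0e.
by rewrite big_cons IH -natr1 EFinD ge0_muleDl ?lee_fin ?ler0n// mul1e addeC.
Qed.

Lemma max_integral_le n w : measurable_fun setT w -> (forall s, 0 <= w s) ->
  (Q n w <= (k_ n)%:E * \int[m]_s (w s)%:E)%E.
Proof.
move=> mw w0; rewrite -integral_ball_sum//; apply: ge0_le_integral => //.
- by move=> s _; rewrite lee_fin ball_max_ge0.
- exact: measurable_ball_trans.
- by apply/measurable_EFinP; apply: measurable_sum => t; exact: measurable_trans.
- by move=> s _; rewrite lee_fin ball_max_sum// => t; exact: trans_ge0.
Qed.

Lemma k_gt0 n : 0 < k_ n.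
Proof. by rewrite ltr0n (ball_size_gt0 D_sym D_gen). Qed.

Lemma ae_le_sublinear w w' : measurable_fun setT w -> measurable_fun setT w' ->
  {ae m, forall s, w s <= w' s} -> sublinear w' -> sublinear w.
Proof.
move=> mw mw' ww' w's e e0; apply: filterS (w's e e0) => n.
exact/le_trans/ae_le_max_integral.
Qed.

Lemma sublinearD w w' : measurable_fun setT w -> measurable_fun setT w' ->
  sublinear w -> sublinear w' -> sublinear (fun s => w s + w' s).
Proof.
move=> mw mw' sw sw' e e0; have e2 : 0 < e / 2 by rewrite divr_gt0.
apply: filterS2 (sw _ e2) (sw' _ e2) => n h1 h2.
rewrite (le_trans (max_integralD n mw mw'))// [e]splitr mulrDl EFinD leeD//.
Qed.

Lemma sublinearZ (c : R) w : 0 <= c -> measurable_fun setT w ->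
  sublinear w -> sublinear (fun s => c * w s).
Proof.
move=> c0 mw sw e e0; have c1 : 0 < c + 1 by rewrite ltr_wpDl.
have e2 : 0 < e / (c + 1) by rewrite divr_gt0.
apply: filterS (sw _ e2) => n h; rewrite (le_trans (max_integralZ n c0 mw))//.
apply: (@le_trans _ _ (c%:E * (e / (c + 1) * k_ n)%:E)%E); first by rewrite lee_wpmul2l ?lee_fin.
rewrite -EFinM lee_fin mulrA ler_wpM2r ?ler0n//.
by rewrite mulrCA ler_piMr ?(ltW e0)// ler_pdivrMr// mul1r lerDl.
Qed.

Lemma admissible_le w w' : admissible w -> measurable_fun setT w' ->
  (forall s, 0 <= w' s <= w s) -> admissible w'.
Proof.
move=> [mw w0 iw] mw' w'w; split => //; first by move=> s; case/andP: (w'w s).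
apply: le_lt_trans iw; apply: ge0_le_integral => //.
- by move=> s _; rewrite lee_fin; case/andP: (w'w s).
- exact/measurable_EFinP.
- exact/measurable_EFinP.
- by move=> s _; rewrite lee_fin; case/andP: (w'w s).
Qed.

(** Stability under [L^1] limits: divided by the ball size, the maximal integral of the error
    [w - w_k] is at most its plain integral, uniformly in [n], and this tends to 0 by dominated
    convergence. *)
Lemma sublinear_approx (w_ : nat -> S -> R) w : admissible w ->
  (forall k, measurable_fun setT (w_ k)) -> (forall k s, 0 <= w_ k s <= w s) ->
  (forall s, w_ k s @[k --> \oo] --> w s) -> (forall k, sublinear (w_ k)) -> sublinear w.
Proof.
move=> [mw w0 iw] mw_ w_w cw sw e e0; have e2 : 0 < e / 2 by rewrite divr_gt0.
have md k : measurable_fun setT (fun s => w s - w_ k s) by exact: measurable_funB.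
have dw k s : 0 <= w s - w_ k s <= w s.
  by have /andP[a b] := w_w k s; rewrite subr_ge0 b/= gerBl.
have i1 : m.-integrable setT (EFin \o w).
  apply/integrableP; split; first exact/measurable_EFinP.
  by under eq_integral do rewrite /= ger0_norm//.
have h1 k : measurable_fun setT (fun s => (w s - w_ k s)%:E) by exact/measurable_EFinP.
have h0 : measurable_fun setT (cst 0%E : S -> \bar R) by exact: measurable_cst.
have h2 : {ae m, forall s, setT s -> (w s - w_ k s)%:E @[k --> \oo] --> cst 0%E s}.
  apply: aeW => s _; apply/cvg_EFin; first exact: nearW.
  by rewrite -[X in _ --> X](subrr (w s)); apply: cvgB; [exact: cvg_cst|exact: cw].
have h3 : {ae m, forall s k, setT s -> (`|(w s - w_ k s)%:E| <= (EFin \o w) s)%E}.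
  by apply: aeW => s k _; have /andP[a b] := dw k s; rewrite gee0_abs lee_fin.
have [_ _] := dominated_convergence measurableT h1 h0 h2 i1 h3.
rewrite integral0 => /cvge0P H.
have id0 k : (0 <= \int[m]_s (w s - w_ k s)%:E)%E.
  by apply: integral_ge0 => s _; rewrite lee_fin; case/andP: (dw k s).
have {H}[k _ /(_ k (leqnn k)) Hk] := H id0 _ e2.
apply: filterS (sw k _ e2) => n hn.
apply: (@le_trans _ _ (Q n (w_ k) + Q n (fun s => w s - w_ k s)%R)%E).
  rewrite (le_trans _ (max_integralD n (mw_ k) (md k)))//.
  by apply: ae_le_max_integral => //; [exact: measurable_funD|apply: aeW => s; rewrite addrC subrK].
rewrite [in leRHS](splitr e) mulrDl EFinD leeD//.
rewrite (le_trans (max_integral_le n (md k) _))//; first by move=> s; case/andP: (dw k s).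
by rewrite muleC EFinM lee_wpmul2r// lee_fin ler0n.
Qed.

Definition sublinear_set E := measurable E /\
  forall w, admissible w -> (forall s, ~ E s -> w s = 0) -> sublinear w.

Lemma sublinear_setS E E' : measurable E' -> E' `<=` E -> sublinear_set E -> sublinear_set E'.
Proof. by move=> mE' sub [_ H]; split => // w aw w0; apply: H => // s nE; apply: w0 => /sub. Qed.

Lemma measurable_mul_indic w E : measurable E -> measurable_fun setT w ->
  measurable_fun setT (fun s => w s * \1_E s).
Proof. by move=> mE mw; apply: measurable_funM => //; exact: measurable_indic. Qed.

Lemma mul_indic_itv (x : R) E s : 0 <= x -> 0 <= x * \1_E s <= x.
Proof.
by move=> x0; rewrite indicE; case: (_ \in _); rewrite ?mulr1 ?mulr0 x0 lexx.
Qed.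

Lemma sublinear_setU E E' : sublinear_set E -> sublinear_set E' -> sublinear_set (E `|` E').
Proof.
move=> [mE HE] [mE' HE']; split; first exact: measurableU.
move=> w aw w0; have [mw w_ge0 _] := aw.
have m1 := measurable_mul_indic mE mw; have m2 := measurable_mul_indic mE' mw.
apply: (@ae_le_sublinear _ (fun s => w s * \1_E s + w s * \1_E' s)) => //.
- exact: measurable_funD.
- apply: aeW => s; rewrite -mulrDr; have [EE|nE] := pselect ((E `|` E') s); last by rewrite w0// mul0r.
  rewrite ler_peMr// !indicE; case: EE => Es; rewrite (mem_set Es) /= ?lerDl ?lerDr//.
- apply: sublinearD => //.
  + apply: HE; first by apply: admissible_le aw m1 _ => s; exact: mul_indic_itv.
    by move=> s nE; rewrite indicE memNset// mulr0.
  + apply: HE'; first by apply: admissible_le aw m2 _ => s; exact: mul_indic_itv.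
    by move=> s nE; rewrite indicE memNset// mulr0.
Qed.

Lemma sublinear_set_bigcup (E_ : nat -> set S) : (forall k, sublinear_set (E_ k)) ->
  sublinear_set (\bigcup_k E_ k).
Proof.
move=> HE; split; first by apply: bigcup_measurable => k _; case: (HE k).
move=> w aw w0; have [mw w_ge0 _] := aw.
pose F k := \big[setU/set0]_(i < k) E_ i.
have HF k : sublinear_set (F k).
  rewrite /F; elim: k => [|k IH]; last by rewrite big_ord_recr; exact: sublinear_setU.
  rewrite big_ord0; apply: (@sublinear_setS (E_ 0%N)) => //; exact: HE.
have mF k : measurable (F k) by case: (HF k).
apply: (@sublinear_approx (fun k s => w s * \1_(F k) s)) => //.
- by move=> k; exact: measurable_mul_indic.
- by move=> k s; exact: mul_indic_itv.
- move=> s; apply: cvg_near_cst; have [[k _ Eks]|nE] := pselect ((\bigcup_k E_ k) s); last first.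
    by apply: nearW => k; rewrite w0// mul0r.
  exists k.+1 => // n /= kn; rewrite indicE mem_set ?mulr1// /F.
  by rewrite -bigcup_mkord; exists k.
- move=> k; case: (HF k) => _; apply.
    by apply: admissible_le aw _ _ => [|s]; [exact: measurable_mul_indic|exact: mul_indic_itv].
  by move=> s nE; rewrite indicE memNset// mulr0.
Qed.

(** Exhaustion is done separately on each set [F k] of finite measure, since [m] itself may be
    infinite. There the supremum of [m (E & F k)] is attained by the union of a maximizing sequence,
    and adjoining another sublinear set cannot increase it. *)
Lemma sublinear_set_maximal : exists2 B, sublinear_set B &
  forall E, sublinear_set E -> m (E `\` B) = 0%E.
Proof.
have [F FT /all_and2[mF Ffin]] := sigma_finiteT m.
have mI E k : sublinear_set E -> measurable (E `&` F k) by case=> mE _; exact: measurableI.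
have fI E k : sublinear_set E -> (m (E `&` F k) < +oo)%E.
  by move=> sE; rewrite (le_lt_trans _ (Ffin k))// le_measure ?inE//; exact: mI.
have ss0 : sublinear_set set0.
  split=> // w aw w0; have [mw w_ge0 _] := aw; have -> : w = cst 0 by apply/funext => s; rewrite w0.
  move=> e e0; apply: nearW => n; rewrite (le_trans (max_integral_le n _ _))//.
  by rewrite integral0 mule0 lee_fin mulr_ge0// ltW.
have /choice[B BP] k : exists B, sublinear_set B /\
    forall E, sublinear_set E -> m ((E `\` B) `&` F k) = 0%E.
  pose V := [set fine (m (E `&` F k)) | E in sublinear_set].
  have V0 : V !=set0 by exists (fine (m (set0 `&` F k))); exists set0.
  have Vub : has_ubound V.
    exists (fine (m (F k))) => _ [E sE <-]; apply: fine_le.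
    - by rewrite ge0_fin_numE// fI.
    - by rewrite ge0_fin_numE// Ffin.
    - by rewrite le_measure ?inE//; exact: mI.
  have /choice[E EP] j : exists E, sublinear_set E /\ sup V - j.+1%:R^-1 < fine (m (E `&` F k)).
    have j0 : 0 < j.+1%:R^-1 :> R by rewrite invr_gt0.
    have [_ [E sE <-] h] := sup_adherent j0 (conj V0 Vub).
    by exists E.
  have sB : sublinear_set (\bigcup_j E j) by apply: sublinear_set_bigcup => j; case: (EP j).
  exists (\bigcup_j E j); split => // A sA.
  have sAB : sublinear_set (A `|` \bigcup_j E j) by exact: sublinear_setU.
  have leV X : sublinear_set X -> fine (m (X `&` F k)) <= sup V.
    by move=> sX; apply: ub_le_sup => //; exists X.
  have geV : sup V <= fine (m ((\bigcup_j E j) `&` F k)).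
    apply/ler_addgt0Pr => e e0; have [j je] := ltr_add_invr e0.
    rewrite add0r in je; have [sE /ltW] := EP j.
    rewrite lerBlDr => /le_trans; apply; rewrite lerD ?(ltW je)//.
    apply: fine_le; rewrite ?ge0_fin_numE ?fI//.
    by apply: le_measure; rewrite ?inE; [exact: mI|exact: mI|apply: setSI; exact: bigcup_sup].
  have mD : measurable ((A `\` \bigcup_j E j) `&` F k).
    by apply: measurableI => //; apply: measurableD; [case: sA|case: sB].
  have := leV _ sAB; move=> /le_trans/(_ geV).
  rewrite -lee_fin !fineK ?ge0_fin_numE ?fI//.
  rewrite (_ : (A `|` _) `&` F k = ((A `\` \bigcup_j E j) `&` F k) `|` ((\bigcup_j E j) `&` F k)).
    rewrite measureU//; [|exact: mI|]; last first.
      by apply/seteqP; split => // s [[[_ nE] _] [sE _]].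
    move=> h; have {}h : (m ((A `\` \bigcup_j E j) `&` F k) + m ((\bigcup_j E j) `&` F k) <=
      m ((\bigcup_j E j) `&` F k))%E := h.
    move: h; rewrite -leeBrDr ?ge0_fin_numE ?fI// subee ?ge0_fin_numE ?fI// => h.
    by apply/eqP; rewrite eq_le h measure_ge0.
  by rewrite -setIUl setUDl setDv setD0.
exists (\bigcup_k B k).
  by apply: sublinear_set_bigcup => k; case: (BP k).
move=> E sE; have mB : measurable (\bigcup_k B k) by apply: bigcup_measurable => k _; case: (BP k) => -[].
have mE : measurable E by case: sE.
have : m.-negligible (\bigcup_k ((E `\` B k) `&` F k)).
  apply: negligible_bigcup => k; exists ((E `\` B k) `&` F k); split => //.
    by apply: measurableI => //; apply: measurableD => //; case: (BP k) => -[].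
  by case: (BP k) => _; exact.
move=> /negligible_null_set/(_ (E `\` \bigcup_k B k)); apply; first exact: measurableD.
move=> s [Es nB]; have [k _ Fk] : (\bigcup_k F k) s by rewrite -FT.
by exists k => //; split => //; split => // Bk; apply: nB; exists k.
Qed.

(** A weight [w'] vanishing where [w] does is the pointwise limit of [min (w', k w)], and each of
    these is dominated by the sublinear weight [k w]. *)
Lemma sublinear_support w : admissible w -> sublinear w -> sublinear_set [set s | w s != 0].
Proof.
move=> [mw w0 iw] sw; split.
  rewrite (_ : [set s | _] = ~` (w @^-1` [set 0])).
    by apply: measurableC; rewrite -[X in measurable X]setTI; exact: mw.
  by apply/seteqP; split => s /=; [move/eqP|move=> h; apply/eqP].
move=> w' aw' w'0; have [mw' w'_ge0 _] := aw'.
have mk k : measurable_fun setT (fun s => Num.min (w' s) (k%:R * w s)).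
  by apply: measurable_minr => //; exact: measurable_funM.
apply: (@sublinear_approx (fun k s => Num.min (w' s) (k%:R * w s))) => //.
- by move=> k s; rewrite le_min ge_min w'_ge0 mulr_ge0// lexx.
- move=> s; apply: cvg_near_cst; have [ws|ws] := eqVneq (w s) 0.
    apply: nearW => k; rewrite ws mulr0 w'0 ?minxx//.
    by rewrite /= ws eqxx.
  have ws0 : 0 < w s by rewrite lt_neqAle eq_sym ws w0.
  exists (Num.bound (w' s / w s)) => // k /= bk; apply/min_idPl.
  rewrite -ler_pdivrMr// ltW// (lt_le_trans (archi_boundP _))// ?divr_ge0//.
  by rewrite ler_nat.
- move=> k; apply: (ae_le_sublinear (mk k) (w' := fun s => k%:R * w s)).
  + exact: measurable_funM.
  + by apply: aeW => s; rewrite ge_min lexx orbT.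
  + exact: sublinearZ.
Qed.

(* With [w' = T_(u^-1) w] one has [w = T_u w'], and [T_t T_u = T_(t u)] turns
   the maximum over [E_n] into one over [E_n u], a subset of [E_(n + |u|)]. *)
Lemma sublinear_set_preimage u E : sublinear_set E -> sublinear_set (phi u @^-1` E).
Proof.
move=> [mE HE]; split; first exact: measurable_action_preimage.
move=> w aw w0; have [mw w_ge0 iw] := aw.
pose w' s := rn u^-1%g s * w (phi u^-1%g s).
have mw' : measurable_fun setT w' by exact: measurable_trans.
have aw' : admissible w'.
  by split => //; [move=> s; exact: trans_ge0|rewrite integral_trans].
have sw' : sublinear w'.
  apply: HE => // s nE; rewrite /w' w0 ?mulr0//=.
  by rewrite (actionVK phi_act).
have [l ul] := walk_exists D_sym D_gen u.
have uB : word_ball D l u by apply/word_ballP => //; exists l.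
have Q_le n : (Q n w <= Q (n + l)%N w')%E.
  apply: ae_ge0_le_integral => //.
  - by move=> s _; rewrite lee_fin ball_max_ge0.
  - exact: measurable_ball_trans.
  - by move=> s _; rewrite lee_fin ball_max_ge0.
  - exact: measurable_ball_trans.
  have H t : t \in enum_fset (fset_set (word_ball D n)) -> {ae m, forall s,
      rn t s * w (phi t s) = rn (t * u)%g s * w' (phi (t * u)%g s)}.
    move=> _; apply: filterS2 (rnM phi_act phi_ns (t * u)%g u^-1%g) (rnM phi_act phi_ns t 1%g) => s h _.
    move: h; rewrite mulgK /w' => ->; rewrite mulrA; congr (_ * _).
    by rewrite -(actionM phi_act) mulgK.
  apply: filterS (ae_all_seq H) => s {}H _; rewrite lee_fin.
  apply: ball_max_le => //; first exact: ball_max_ge0.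
  move=> t tn; rewrite H; last exact: word_ball_enum.
  apply: (le_ball_max D_sym D_gen (fun t => rn t s * w' (phi t s))).
  exact: word_ballM.
move=> e e0; have e1 : 0 < e / k_ l by rewrite divr_gt0// k_gt0.
have [N _ HN] := sw' _ e1; exists N => // n /= Nn.
rewrite (le_trans (Q_le n))// (le_trans (HN _ _))//=; first by rewrite (leq_trans Nn)// leq_addr.
rewrite lee_fin -mulrA ler_wpM2l ?(ltW e0)// mulrC ler_pdivrMr ?k_gt0//.
by rewrite -natrM ler_nat (ball_size_submul D_sym D_gen).
Qed.
End negligible_growth.

(** * Change to an equivalent measure *)

Section equivalent_measures_theory.
Context {R : realType} {G : groupType} (D : {fset G}).
Context {d} {S : measurableType d} (phi : G -> S -> S).
Hypothesis D_sym : forall t, t \in D -> (t^-1)%g \in D.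
Hypothesis D_gen : generates D.
Hypothesis phi_act : is_action phi.
Implicit Types m : {sigma_finite_measure set S -> \bar R}.

Lemma equivalent_measuresP m m' : equivalent_measures m' m ->
  forall A, measurable A -> m' A = 0%E <-> m A = 0%E.
Proof.
by move=> [/null_content_dominatesP h1 /null_content_dominatesP h2] A mA; split; [exact: h2|exact: h1].
Qed.

Lemma nonsingular_equivalent m m' : equivalent_measures m' m ->
  nonsingular m phi -> nonsingular m' phi.
Proof.
move=> e phi_ns t; rewrite (translateE phi_act); split; apply/null_content_dominatesP => A mA.
  rewrite /= /pushforward => /(equivalent_measuresP e mA).1 mA0.
  apply/(equivalent_measuresP e); first exact: measurable_action_preimage.
  exact/(action_null phi_act phi_ns).
rewrite /= /pushforward => /(equivalent_measuresP e (measurable_action_preimage phi_act _ mA)).1.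
by move=> /(action_null phi_act phi_ns _ mA).1 h; apply/(equivalent_measuresP e mA).
Qed.

(** With [g] the density of [m'] with respect to [m], the weight [g w] for [m] plays the role of [w]
    for [m']: it has the same integral, the same support constraint, and dominates the maximal
    integrals. *)
Lemma sublinear_set_equivalent m m' E : nonsingular m phi -> equivalent_measures m' m ->
  sublinear_set D phi m E -> sublinear_set D phi m' E.
Proof.
move=> phi_ns e [mE HE]; split => // w [mw w0 iw] wE.
have phi_ns' := nonsingular_equivalent e phi_ns.
have [g [mg g0 dg]] : exists g, is_density m' m g.
  apply: density_exists; last by case: e.
  by have [F FT mF] := sigma_finiteT m'; exists F.
have mgw : measurable_fun setT (fun s => g s * w s) by exact: measurable_funM.
have gw : sublinear D phi m (fun s => g s * w s).
  apply: HE => [|s nE]; last by rewrite wE ?mulr0.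
  split => //; first by move=> s; rewrite mulr_ge0.
  apply: le_lt_trans iw; rewrite (ge0_integral_density (And3 mg g0 dg))//.
    by under [leRHS]eq_integral do rewrite -EFinM mulrC.
  exact/measurable_EFinP.
(* Both sides are densities of [m' o phi_t] with respect to [m], taken through [m'] on the left and
   through [m o phi_t] on the right. *)
have rnE t : {ae m, forall s, rn_deriv m' phi t s * g s = rn_deriv m phi t s * g (phi t s)}.
  have d1 := density_translate phi_act phi_ns t (And3 mg g0 dg).
  apply: density_unique d1; split.
  - by apply: measurable_funM => //; exact: measurable_rn.
  - by move=> s; rewrite mulr_ge0// rn_ge0.
  - move=> A mA; have [mr r0 dr] := rnP phi_act phi_ns' t; rewrite -/(translate m' phi t A) dr//.
    rewrite [LHS]integral_mkcond (ge0_integral_density (And3 mg g0 dg)).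
    + rewrite [RHS]integral_mkcond; apply: eq_integral => s _; rewrite !patchE.
      by case: ifP; rewrite ?mul0e.
    + apply/(measurable_restrictT _ _).1 => //; apply/measurable_funTS.
      exact/measurable_EFinP.
    + by move=> s; rewrite patchE; case: ifP => // _; rewrite lee_fin.
suff QE n : (max_integral D phi m' n w <= max_integral D phi m n (fun s => (g s * w s)%R))%E.
  by move=> eps eps0; apply: filterS (gw _ eps0) => n; exact: le_trans (QE n).
rewrite /max_integral (ge0_integral_density (And3 mg g0 dg)); first last.
- by move=> s; rewrite lee_fin ball_max_ge0.
- exact: measurable_ball_trans.
apply: ae_ge0_le_integral => //.
- by move=> s _; rewrite mule_ge0 ?lee_fin ?ball_max_ge0.
- by apply: emeasurable_funM; [exact: measurable_ball_trans|exact/measurable_EFinP].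
- by move=> s _; rewrite lee_fin ball_max_ge0.
- by have := measurable_ball_trans D phi_act phi_ns n mgw.
have H t : t \in enum_fset (fset_set (word_ball D n)) -> {ae m, forall s,
    rn_deriv m' phi t s * g s = rn_deriv m phi t s * g (phi t s)} by move=> _; exact: rnE.
apply: filterS (ae_all_seq H) => s {}H _; rewrite -EFinM lee_fin.
have [t tn ->] := ball_max_attained D_sym D_gen n
  (fun t => trans_ge0 phi_act phi_ns' t s w0).
rewrite mulrAC H; last exact: word_ball_enum.
rewrite -mulrA; exact: (le_ball_max D_sym D_gen (fun t => rn_deriv m phi t s * (g (phi t s) * w (phi t s)))).
Qed.
End equivalent_measures_theory.

(** * The decomposition, its uniqueness and its relation to other parts *)

Section decomposition.
Context {R : realType} {G : groupType} (D : {fset G}) (alpha : R).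
Context {d} {S : measurableType d} (phi : G -> S -> S).
Hypothesis alpha_gt0 : 0 < alpha.
Hypothesis D_sym : forall t, t \in D -> (t^-1)%g \in D.
Hypothesis D_gen : generates D.
Hypothesis infinite_G : infinite_set [set: G].
Hypothesis phi_act : is_action phi.
Implicit Types m : {sigma_finite_measure set S -> \bar R}.

Definition maximal_sublinear m B := sublinear_set D phi m B /\
  forall E, sublinear_set D phi m E -> m (E `\` B) = 0%E.

Lemma b_ratioE m (f : S -> R) n : b_ratio alpha D m phi f n =
  ((max_integral D phi m n (fun s => `|f s| `^ alpha)%R * ((ball_size D n)%:R^-1)%:E) `^ alpha^-1)%E.
Proof.
rewrite poweRM ?max_integral_ge0 ?lee_fin ?invr_ge0 ?ler0n// poweR_EFin.
congr (_ * _%:E)%E; rewrite ball_normingE -powRN -[in RHS](powR_inv1 (ler0n _ _)) -powRrM.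
by rewrite mulN1r.
Qed.

Lemma b_ratio_ge0 m (f : S -> R) n : (0 <= b_ratio alpha D m phi f n)%E.
Proof. by rewrite b_ratioE poweR_ge0. Qed.

Lemma b_ratio_cvg0P m (f : S -> R) : b_ratio alpha D m phi f n @[n --> \oo] --> 0%E <->
  sublinear D phi m (fun s => `|f s| `^ alpha).
Proof.
under eq_fun do rewrite b_ratioE.
have u0 n : (0 <= max_integral D phi m n (fun s => `|f s| `^ alpha)%R * ((ball_size D n)%:R^-1)%:E)%E.
  by rewrite mule_ge0 ?max_integral_ge0 ?lee_fin ?invr_ge0 ?ler0n.
rewrite cvge0_poweRP ?invr_gt0//; rewrite (cvge0P u0).
have E n (e : R) : (max_integral D phi m n (fun s => `|f s| `^ alpha)%R * ((ball_size D n)%:R^-1)%:E <= e%:E)%E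
    = (max_integral D phi m n (fun s => `|f s| `^ alpha)%R <= (e * (ball_size D n)%:R)%:E)%E.
  by rewrite EFinM lee_pdivrMr// k_gt0.
by split=> H e e0; apply: filterS (H e e0) => n; rewrite E.
Qed.

Lemma Lfun_admissible m (f : S -> R) : f \in Lfun m alpha%:E ->
  admissible m (fun s => `|f s| `^ alpha).
Proof.
move=> /(mem_LfunP m alpha_gt0)[mf ff]; split => //; exact: measurable_absX.
Qed.

Lemma admissible_Lfun m w : admissible m w ->
  (fun s => w s `^ alpha^-1) \in Lfun m alpha%:E /\
  (forall s, `|w s `^ alpha^-1| `^ alpha = w s).
Proof.
move=> [mw w0 iw]; have E s : `|w s `^ alpha^-1| `^ alpha = w s.
  by rewrite ger0_norm ?powR_ge0// -powRrM mulVf ?gt_eqF// powRr1.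
split => //; apply/(mem_LfunP m alpha_gt0); split.
  exact: (measurableT_comp (measurable_powR _)).
by rewrite /powint; under eq_integral do rewrite E.
Qed.

(** Invariance comes from maximality: preimages of [B] are sublinear sets, hence contained in [B] up
    to null sets, and using [t^-1] gives the reverse inclusion. For (b), a zero upper limit makes
    [|f|^alpha] sublinear, so its support would lie in [B]. *)
Lemma ab_of_maximal m B : nonsingular m phi -> maximal_sublinear m B ->
  ab_decomposition alpha D m phi (~` B) B.
Proof.
move=> phi_ns [sB maxB]; have [mB HB] := sB.
have mP t A : measurable A -> measurable (phi t @^-1` A) by exact: measurable_action_preimage.
have sub1 t : m (phi t @^-1` B `\` B) = 0%E by apply: maxB; exact: sublinear_set_preimage.
have sub2 t : m (B `\` phi t @^-1` B) = 0%E.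
  rewrite (_ : _ `\` _ = phi t @^-1` (phi t^-1%g @^-1` B `\` B)); last first.
    by apply/seteqP; split => s /=; rewrite (actionK phi_act).
  by apply/action_null => //; apply: measurableD => //; exact: mP.
have negl A : measurable A -> m A = 0%E -> m.-negligible A by move=> mA A0; exists A; split.
have n1 t : m.-negligible (phi t @^-1` B `\` B).
  by apply: negl => //; apply: measurableD => //; exact: mP.
have n2 t : m.-negligible (B `\` phi t @^-1` B).
  by apply: negl => //; apply: measurableD => //; exact: mP.
split; first split.
- split; first exact: measurableC.
  move=> t; split.
    by apply: negligibleS (n2 t) => s [/= h1 h2]; split => //; exact: contrapT.
  by apply: negligibleS (n1 t) => s [/= h1 h2]; split => //; exact: contrapT.
- by split => // t; split; [exact: n1|exact: n2].
- split; first by apply: negligibleS (negligible_set0 m) => s [[]].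
  by apply: negligibleS (negligible_set0 m) => s [].
- split; first by apply: negligibleS (negligible_set0 m) => s [_ nT]; case: nT.
  by apply: negligibleS (negligible_set0 m) => s [_ /= /not_orP[/contrapT]].
move=> f fL; have [mf _] := (mem_LfunP m alpha_gt0 f).1 fL.
have aw := Lfun_admissible fL; have [mw w0 iw] := aw; split.
  move=> fB; apply/b_ratio_cvg0P.
  have mwB := measurable_mul_indic mB mw.
  apply: (ae_le_sublinear D_sym D_gen phi_act phi_ns mw mwB).
    move: fB; rewrite /ae_subset => fB; apply: negligibleS fB => s /= h.
    have [fs|fs] := eqVneq (f s) 0.
      by exfalso; apply: h; rewrite fs normr0 powR0 ?gt_eqF// mul0r.
    by split => // Bs; apply: h; rewrite indicE mem_set// mulr1.
  apply: HB; last by move=> s nB; rewrite indicE memNset// mulr0.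
  by apply: admissible_le aw mwB _ => s; exact: mul_indic_itv.
move=> fA; rewrite ltNge; apply/negP => le0.
have /b_ratio_cvg0P sw : b_ratio alpha D m phi f n @[n --> \oo] --> 0%E.
  by apply: limn_esup_le_cvg => // n; exact: b_ratio_ge0.
have := maxB _ (sublinear_support D_sym D_gen phi_act phi_ns aw sw) .
rewrite (_ : _ `\` B = [set s | f s != 0] `&` ~` B); first by move=> h; move: fA; rewrite [X in (_ < X)%E](_ : _ = 0%E) ?ltxx.
rewrite setDE; congr (_ `&` _); apply/seteqP; split => s /=.
  by rewrite powR_eq0 normr_eq0 (gt_eqF alpha_gt0) andbT.
by rewrite powR_eq0 normr_eq0 (gt_eqF alpha_gt0) andbT.
Qed.

(** Property (a) makes [B'] a sublinear set, hence contained in [B]. Conversely, the indicator of a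
    piece of [A' & B] of finite measure has vanishing ratio because of [B], and property (b) for
    [A'] then forces the piece to be null. *)
Lemma ab_unique m B A' B' : nonsingular m phi -> maximal_sublinear m B ->
  ab_decomposition alpha D m phi A' B' -> ae_eqset m A' (~` B) /\ ae_eqset m B' B.
Proof.
move=> phi_ns [sB maxB] [[[mA' _] [mB' _] [disj _] [_ cov]] H].
have [mB HB] := sB.
have sB' : sublinear_set D phi m B'.
  split => // w aw wB'; have [fL fE] := admissible_Lfun aw.
  have [H1 _] := H _ fL; have : ae_subset m [set s | w s `^ alpha^-1 != 0] B'.
    apply: negligibleS (negligible_set0 m) => s [/= fs nB']; case/eqP: fs.
    by rewrite wB' // powR0// invr_neq0// gt_eqF.
  move=> /H1/b_ratio_cvg0P; rewrite (_ : (fun s => `|_| `^ _) = w)//; exact/funext.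
have B'B : m.-negligible (B' `\` B) by exists (B' `\` B); split => //; [exact: measurableD|exact: maxB].
have A'B : m.-negligible (A' `&` B).
  have [F FT /all_and2[mF Ffin]] := sigma_finiteT m.
  have : m.-negligible (\bigcup_k (A' `&` B `&` F k)).
    apply: negligible_bigcup => k; pose X := A' `&` B `&` F k.
    have mX : measurable X by do 2 apply: measurableI => //.
    exists X; split => //; have aX : admissible m \1_X.
      split; [exact: measurable_indic|by move=> s; rewrite indicE|].
      by rewrite integral_indic// setIT (le_lt_trans _ (Ffin k))// le_measure ?inE//; exact: subIsetr.
    have [fL fE] := admissible_Lfun aX.
    have fX s : (fun s => (\1_X s : R) `^ alpha^-1) s != 0 -> X s.
      move=> /=; rewrite indicE; case: (boolP (s \in X)) => [|_]; first by rewrite inE.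
      by rewrite powR0 ?eqxx// invr_neq0// gt_eqF.
    have [H1 H2] := H _ fL; apply/eqP; rewrite eq_le measure_ge0 andbT leNgt; apply/negP => X0.
    have : (0 < limn_esup (b_ratio alpha D m phi (fun s => (\1_X s `^ alpha^-1)%R)))%E.
      apply: H2; apply: (lt_le_trans X0); apply: le_measure; rewrite ?inE//.
        apply: measurableI => //; rewrite (_ : [set s | _] = X)//.
        apply/seteqP; split => s; first exact: fX.
        by move=> Xs /=; rewrite indicE mem_set// powR1 oner_neq0.
      move=> s Xs; split; last by case: Xs => -[].
      by rewrite /= indicE mem_set// powR1 oner_neq0.
    have /b_ratio_cvg0P c0 : sublinear D phi m (fun s => `|(\1_X s : R) `^ alpha^-1| `^ alpha).
      rewrite (_ : (fun s => `|_| `^ _) = \1_X); last exact/funext.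
      by apply: HB => // s nB; rewrite indicE memNset// => -[[]].
    by rewrite is_cvg_limn_esupE ?(cvg_lim _ c0)// ?ltxx//; apply/cvg_ex; exists 0%E.
  apply: negligibleS => s AB; have [k _ Fk] : (\bigcup_k F k) s by rewrite -FT.
  by exists k.
split; split.
- by apply: negligibleS A'B => s [A's /contrapT Bs].
- apply: negligibleS (negligibleU B'B cov) => s [/= nB nA'].
  have [B's|nB's] := pselect (B' s); first by left.
  by right; split => // -[].
- exact: B'B.
- apply: negligibleS (negligibleU A'B cov) => s [/= Bs nB'].
  have [A's|nA's] := pselect (A' s); first by left.
  by right; split => // -[].
Qed.

Lemma maximal_sublinear_equivalent m m' B : nonsingular m phi ->
  equivalent_measures m' m -> maximal_sublinear m B -> maximal_sublinear m' B.
Proof.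
move=> phi_ns e [sB maxB]; split; first exact: sublinear_set_equivalent sB.
have e' : equivalent_measures m m' by case: e.
move=> E sE; have [mE _] := sE; have [mB _] := sB.
apply/(equivalent_measuresP e); first exact: measurableD.
apply: maxB; apply: sublinear_set_equivalent sE => //; exact: nonsingular_equivalent e phi_ns.
Qed.

(** It suffices that each piece [V] of finite measure of a translate of [W] inside [B] is null: its
    indicator is sublinear, whereas its maximal integral is at least [|E_n| m V]. *)
Lemma dissipative_subset m B C Di : nonsingular m phi -> maximal_sublinear m B ->
  hopf_decomposition m phi C Di -> ae_subset m Di (~` B).
Proof.
move=> phi_ns [[mB HB] maxB] [_ [W [[mW tW] [DiW _]]] _].
have [F FT /all_and2[mF Ffin]] := sigma_finiteT m.
have V0 t k : m (phi t @` W `&` B `&` F k) = 0%E.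
  set V := _ `&` _; have mV : measurable V.
    by do 2 apply: measurableI => //; exact: measurable_action_image.
  have mI : measurable_fun setT (\1_V : S -> R) by exact: measurable_indic.
  have I0 s : 0 <= \1_V s :> R by rewrite indicE.
  have iV : (\int[m]_s (\1_V s)%:E = m V)%E by rewrite integral_indic// setIT.
  have fV : (m V < +oo)%E by rewrite (le_lt_trans _ (Ffin k))// le_measure ?inE//; exact: subIsetr.
  have sV : sublinear D phi m \1_V.
    apply: HB; first by split; rewrite ?iV.
    by move=> s nB; rewrite indicE memNset// => -[[]].
  (* Disjointness indexed by [G]: if [phi a s] and [phi b s] both lie in [phi t (W)], then [s] lies
     in the translates by [t a^-1] and [t b^-1], so these elements coincide. Hence at most one term
     of the sum over the ball is nonzero. *)
  have one s a b : V (phi a s) -> V (phi b s) -> a = b.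
    move=> [[[x Wx xa] _] _] [[[y Wy yb] _] _].
    have : (t * a^-1 = t * b^-1)%g.
      apply: tW => //; exists s; split; [exists x|exists y] => //.
        by rewrite (actionM phi_act) xa (actionK phi_act).
      by rewrite (actionM phi_act) yb (actionK phi_act).
    by move=> /mulgI /invg_inj.
  have QE n : ((ball_size D n)%:R%:E * m V <= max_integral D phi m n \1_V)%E.
    rewrite -iV -(integral_ball_sum D phi_act phi_ns)//; apply: ge0_le_integral => //.
    - by move=> s _; rewrite lee_fin sumr_ge0// => a _; exact: trans_ge0.
    - by apply/measurable_EFinP; apply: measurable_sum => a; exact: measurable_trans.
    - exact: measurable_ball_trans.
    move=> s _; rewrite lee_fin.
    pose y a := rn_deriv m phi a s * \1_V (phi a s).
    have [[a [an Va]]|none] := pselect (exists a, word_ball D n a /\ V (phi a s)); last first.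
      rewrite big1_seq ?ball_max_ge0// => a /= an; rewrite indicE memNset ?mulr0// => Va.
      apply: none; exists a; split => //; move: an.
      by rewrite -[a \in _]/(a \in fset_set _) mem_ball// inE.
    rewrite (bigD1_seq a) ?fset_uniq//=; last exact: word_ball_enum.
    rewrite big1 ?addr0; first exact: (le_ball_max D_sym D_gen y).
    move=> b ba; rewrite indicE memNset ?mulr0// => Vb.
    by move/eqP: ba; apply; exact: one Vb Va.
  apply/eqP; rewrite eq_le measure_ge0 andbT; apply/lee_addgt0Pr => e e0.
  rewrite add0e; have [n _ /(_ n (leqnn n)) Hn] := sV e e0.
  have := le_trans (QE n) Hn; rewrite muleC EFinM.
  by rewrite lee_pmul2r// ?fin_num_abs ?lte_fin ?k_gt0// abse_EFin ltry.
(* Each element of [G] has a position in some ball, which turns the union over [G] into a countable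
   one. *)
pose enum n i := nth 1%g (enum_fset (fset_set (word_ball D n))) i.
have : m.-negligible (\bigcup_n \bigcup_i \bigcup_k (phi (enum n i) @` W `&` B `&` F k)).
  apply: negligible_bigcup => n; apply: negligible_bigcup => i; apply: negligible_bigcup => k.
  exists (phi (enum n i) @` W `&` B `&` F k); split => //; last exact: V0.
  by do 2 apply: measurableI => //; exact: measurable_action_image.
move=> /(negligibleU DiW); apply: negligibleS => s [Ds /contrapT Bs].
have [[t _ Wt]|nW] := pselect ((\bigcup_t phi t @` W) s); last by left.
right; have [k _ Fk] : (\bigcup_k F k) s by rewrite -FT.
have [n tn] := walk_exists D_sym D_gen t.
have tb : word_ball D n t by apply/word_ballP => //; exists n.
have te := word_ball_enum D_sym D_gen tb.
exists n => //; exists (index t (enum_fset (fset_set (word_ball D n)))) => //.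
by exists k => //; rewrite /enum nth_index.
Qed.

Lemma positive_subset m B Po N : nonsingular m phi -> maximal_sublinear m B ->
  neveu_decomposition m phi Po N -> ae_subset m Po B.
Proof.
move=> phi_ns [[mB HB] maxB] [[mPo _] [mu [mu_inv mu0]] _ _].
have mum : mu `<< m.
  apply/null_content_dominatesP => A mA A0; apply/mu0 => //.
  by apply/eqP; rewrite eq_le measure_ge0 andbT -A0 le_measure ?inE//; exact: measurableI.
have [w dw] : exists w, is_density mu m w.
  apply: density_exists => //; exists (fun=> setT); split; first by rewrite bigcup_const.
  by move=> n; split => //; rewrite -ge0_fin_numE// fin_num_measure.
have [mw w0 wE] := dw.
have aw : admissible m w.
  by split => //; rewrite -wE// -ge0_fin_numE// fin_num_measure.
have inv t : {ae m, forall s, rn_deriv m phi t s * w (phi t s) = w s}.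
  have [h1 h2 h3] := density_translate phi_act phi_ns t dw.
  apply: density_unique dw; split => // A mA; rewrite -h3// (action_image phi_act) mu_inv//.
have QE n : (max_integral D phi m n w <= \int[m]_s (w s)%:E)%E.
  apply: ae_ge0_le_integral => //.
  - by move=> s _; rewrite lee_fin ball_max_ge0.
  - exact: measurable_ball_trans.
  - by move=> s _; rewrite lee_fin.
  - exact/measurable_EFinP.
  have H t : t \in enum_fset (fset_set (word_ball D n)) ->
    {ae m, forall s, rn_deriv m phi t s * w (phi t s) = w s} by move=> _; exact: inv.
  apply: filterS (ae_all_seq H) => s {}H _; rewrite lee_fin ball_max_le// => t tn.
  by rewrite H//; exact: word_ball_enum.
have sw : sublinear D phi m w.
  move=> e e0; pose c := fine (\int[m]_s (w s)%:E)%E.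
  have cE : (\int[m]_s (w s)%:E)%E = c%:E.
    by rewrite fineK// ge0_fin_numE; [case: aw|apply: integral_ge0 => s _; rewrite lee_fin].
  (* The maximal integral is bounded by the constant [c]; infinitude of [G] makes the ball size
     exceed [c / e]. *)
  have [n Hn] := ball_size_unbounded D_sym D_gen infinite_G (Num.bound (c / e)).
  exists n => // k /= /Hn kn; rewrite (le_trans (QE k))// cE lee_fin.
  have c0 : 0 <= c by rewrite fine_ge0// integral_ge0// => s _; rewrite lee_fin.
  rewrite mulrC -ler_pdivrMr// (le_trans (ltW (archi_boundP _)))// ?divr_ge0// ?(ltW e0)//.
  by rewrite ler_nat.
have ss := sublinear_support D_sym D_gen phi_act phi_ns aw sw.
have mZ : measurable [set s | w s = 0] by have := mw measurableT [set 0] (measurable_set1 0); rewrite setTI.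
(* [mu] gives no mass to the zero set of its density, and on [Po] its null sets are those of [m]; so
   [w] is positive almost everywhere on [Po]. *)
have PZ : m (Po `&` [set s | w s = 0]) = 0%E.
  rewrite setIC; apply/mu0 => //; rewrite wE// (eq_integral (cst 0%E)) ?integral0//.
  by move=> s; rewrite inE /= => ->.
have n1 : m.-negligible (Po `&` [set s | w s = 0]).
  by exists (Po `&` [set s | w s = 0]); split => //; exact: measurableI.
have n2 : m.-negligible ([set s | w s != 0] `\` B).
  by exists ([set s | w s != 0] `\` B); split => //; [apply: measurableD => //; case: ss|exact: maxB].
apply: negligibleS (negligibleU n1 n2) => s [Ps nB].
by have [ws|ws] := eqVneq (w s) 0; [left|right].
Qed.
End decomposition.

(** * Stationary stable fields *)

Section pi_lambda_independence.
Context {R : realType} {d} {Omega : measurableType d} (P : probability Omega R).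

Lemma pi_lambda_product (K : set (set Omega)) (F : set Omega) :
  setI_closed K -> K `<=` measurable -> measurable F ->
  (forall E, K E -> P (E `&` F) = (P E * P F)%E) ->
  forall E, <<s K >> E -> P (E `&` F) = (P E * P F)%E.
Proof.
move=> KI Km mF KF E sE.
have fin A : measurable A -> P A \is a fin_num by move=> mA; exact: fin_num_measure.
suff sub : <<s K >> `<=` [set A | measurable A /\ P (A `&` F) = (P A * P F)%E] by case: (sub _ sE).
apply: lambda_system_subset => //; last by move=> A KA; split; [exact: Km|exact: KF].
apply/dynkin_lambda_system; split.
- by split => //; rewrite setTI [X in (X * _)%E](probability_setT P) mul1e.
- move=> A [mA AF]; split; first exact: measurableC.
  have -> : ~` A `&` F = F `\` (A `&` F) by rewrite setDIr setDv setU0 setDE setIC.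
  rewrite measureD ?(fin_num_measure) ?ltey_eq ?fin//; last exact: measurableI.
  have -> : F `&` (A `&` F) = A `&` F by rewrite setICA setIid.
  rewrite [X in (_ - X)%E](_ : _ = P A * P F)%E; last exact: AF.
  rewrite probability_setC// -(fineK (fin A mA)) -(fineK (fin F mF)) -EFinM -!EFinB -EFinM.
  rewrite [X in (X - _)%E](_ : _ = (fine (P F))%:E); last by rewrite fineK ?fin.
  by rewrite mulrBl mul1r.
- move=> A tA HA; have mA n : measurable (A n) by case: (HA n).
  split; first exact: bigcup_measurable.
  rewrite setI_bigcupl measure_semi_bigcup//; last 3 first.
  + by move=> n; exact: measurableI.
  + exact: trivIset_setIr.
  + by rewrite -setI_bigcupl; apply: measurableI => //; exact: bigcup_measurable.
  rewrite measure_semi_bigcup//; last exact: bigcup_measurable.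
  rewrite -(fineK (fin F mF)) muleC -nneseriesZl//; apply: eq_eseriesr => n _.
  have [_ AnF] := HA n; apply: etrans AnF _; rewrite fineK ?fin//; exact: muleC.
Qed.

Lemma pi_lambda_independent (K1 K2 : set (set Omega)) :
  setI_closed K1 -> setI_closed K2 -> K1 `<=` measurable -> K2 `<=` measurable ->
  (forall E F, K1 E -> K2 F -> P (E `&` F) = (P E * P F)%E) ->
  forall E F, <<s K1 >> E -> <<s K2 >> F -> P (E `&` F) = (P E * P F)%E.
Proof.
move=> I1 I2 m1 m2 H E F sE sF.
have mF : measurable F by apply: smallest_sub sF => //; exact: sigma_algebra_measurable.
apply: (pi_lambda_product I1 m1 mF) sE => {}E KE.
rewrite setIC muleC; apply: (pi_lambda_product I2 m2 (m1 _ KE)) sF => F' KF.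
by rewrite setIC muleC H.
Qed.
End pi_lambda_independence.

(** * Boxes as a generating system and independence *)

Section box_system.
Context {R : realType} {G : groupType} {d} {Omega : measurableType d}.
Variable X : G -> Omega -> R.
Hypothesis mX : forall t, measurable_fun setT (X t).

Definition boxes : set (set Omega) :=
  [set E | exists J : seq (G * (R * R)), {in J, forall j, 0 <= j.2.2} /\ E = box X J 0].

Lemma boxes_setI : setI_closed boxes.
Proof.
move=> _ _ [J [J0 ->]] [J' [J'0 ->]]; exists (J ++ J'); split.
  by move=> j; rewrite mem_cat => /orP[/J0|/J'0].
apply/seteqP; split => [w [h h'] j|w h]; first by rewrite mem_cat => /orP[/h|/h'].
by split => j jJ; apply: h; rewrite mem_cat jJ ?orbT.
Qed.

Lemma boxes_measurable : boxes `<=` measurable.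
Proof. by move=> _ [J [_ ->]]; exact: box_measurable. Qed.

Lemma field_sigma_boxes : field_sigma X `<=` <<s boxes >>.
Proof.
apply: smallest_sub; first exact: smallest_sigma_algebra.
move=> _ [t [B [mB ->]]].
have sub : @measurable _ (measurableTypeR R) `<=` [set B : set R | <<s boxes >> (X t @^-1` B)].
  rewrite RGenCInfty.measurableE; apply: smallest_sub.
    have [h0 hD hU] := smallest_sigma_algebra setT boxes; split => /=.
    - by rewrite preimage_set0.
    - by move=> A /hD; rewrite !setTD preimage_setC.
    - by move=> F hF; rewrite preimage_bigcup; exact: hU.
  move=> _ [x ->] /=.
  (* The half-line from [x] is the increasing union of the closed intervals [[x, x + 2 n]], of
     center [x + n] and radius [n]. *)
  rewrite (_ : _ @^-1` _ = \bigcup_(n : nat) box X [:: (t, (x + n%:R, n%:R : R))] 0).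
    apply: sigma_algebra_bigcup => n; apply: sub_sigma_algebra.
    by exists [:: (t, (x + n%:R, n%:R : R))]; split => // j; rewrite inE => /eqP ->/=.
  apply/seteqP; split => w /=; rewrite in_itv/= andbT.
    move=> xw; exists (Num.bound (X t w - x)) => // j; rewrite inE => /eqP -> /=.
    have := archi_boundP (_ : 0 <= X t w - x); rewrite subr_ge0 => /(_ xw) h.
    by rewrite addr0 ler_norml; apply/andP; split; lra.
  move=> [n _ /(_ (t, (x + n%:R, n%:R)))]; rewrite inE eqxx => /(_ isT) /=.
  by rewrite addr0 ler_norml => /andP[h _]; lra.
exact: sub.
Qed.
End box_system.

Section joint_law.
Context {R : realType} {G : groupType} {d} {Omega : measurableType d}.
Variables (P : probability Omega R) (X1 X2 : G -> Omega -> R).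
Hypotheses (mX1 : forall t, measurable_fun setT (X1 t))
           (mX2 : forall t, measurable_fun setT (X2 t)).

Definition joint (j : G + G) (w : Omega) : R :=
  match j with inl t => X1 t w | inr t => X2 t w end.

(* [X1] and [X2] are independent iff they have the joint law of independent copies. *)
Definition joint_copy (j : G + G) (z : Omega * Omega) : R :=
  match j with inl t => X1 t z.1 | inr t => X2 t z.2 end.

Hypothesis same_cos : forall (l : seq (R * (G + G))) c,
  \int[P]_w cos (linform l (joint^~ w) + c) =
  \int[product_prob P P]_z cos (linform l (joint_copy^~ z) + c).

(** Over the index set [G + G] a box splits into one box for each field, so uniqueness of box
    probabilities yields the product formula on boxes. These are closed under intersection, and the
    formula extends to the generated sigma-algebras. *)
Lemma independent_of_cos : independent_fields P X1 X2.
Proof.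
move=> E1 E2 /field_sigma_boxes s1 /field_sigma_boxes s2.
apply: (pi_lambda_independent (boxes_setI (X := X1)) (boxes_setI (X := X2))
  (boxes_measurable mX1) (boxes_measurable mX2)) s1 s2.
move=> _ _ [J1 [J10 ->]] [J2 [J20 ->]].
pose f1 (j : G * (R * R)) : (G + G) * (R * R) := (inl j.1, j.2).
pose f2 (j : G * (R * R)) : (G + G) * (R * R) := (inr j.1, j.2).
pose J := [seq f1 j | j <- J1] ++ [seq f2 j | j <- J2].
have mj j : measurable_fun setT (joint j) by case: j.
have mjc j : measurable_fun setT (joint_copy j) by case: j => t; exact: measurableT_comp.
have := prob_box_unique mj mjc same_cos (J := J).
have J0 : {in J, forall j, 0 <= j.2.2}.
  by move=> j; rewrite mem_cat => /orP[|] /mapP[i iJ ->] /=; [exact: J10|exact: J20].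
move=> /(_ J0).
have -> : box joint J 0 = box X1 J1 0 `&` box X2 J2 0.
  apply/seteqP; split => [w h|w [h1 h2] j].
    split=> j jJ; first by apply: (h (f1 j)); rewrite mem_cat map_f.
    by apply: (h (f2 j)); rewrite mem_cat map_f ?orbT.
  by rewrite mem_cat => /orP[|] /mapP[i iJ ->] /=; [exact: h1|exact: h2].
have -> : box joint_copy J 0 = box X1 J1 0 `*` box X2 J2 0.
  apply/seteqP; split => [w h|w [h1 h2] j].
    split=> j jJ; first by apply: (h (f1 j)); rewrite mem_cat map_f.
    by apply: (h (f2 j)); rewrite mem_cat map_f ?orbT.
  by rewrite mem_cat => /orP[|] /mapP[i iJ ->] /=; [exact: h1|exact: h2].
move=> ->; exact: (product_measure1E P P (box_measurable mX1 J1 0) (box_measurable mX2 J2 0)).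
Qed.
End joint_law.

Section fdd.
Context {R : realType} {G : groupType} {d} {Omega : measurableType d}.
Variable P : probability Omega R.

Lemma measurable_field_tuple (Y : G -> Omega -> R) k (t : k.-tuple G) :
  (forall t, measurable_fun setT (Y t)) ->
  measurable_fun setT (fun w => [tuple Y (tnth t i) w | i < k]).
Proof.
move=> mY; apply/measurable_fun_tnthP => i.
rewrite (_ : _ \o _ = Y (tnth t i))//.
by apply/funext => w /=; rewrite tnth_mktuple.
Qed.

Lemma fdd_eq_ae (Y Z : G -> Omega -> R) : (forall t, measurable_fun setT (Y t)) ->
  (forall t, measurable_fun setT (Z t)) -> (forall t, {ae P, forall w, Y t w = Z t w}) ->
  fdd_eq P Y P Z.
Proof.
move=> mY mZ YZ k t B mB; rewrite /fdd_prob.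
have mT (V : G -> Omega -> R) : (forall t, measurable_fun setT (V t)) ->
    measurable [set w | B [tuple V (tnth t i) w | i < k]].
  by move=> mV; rewrite -[X in measurable X]setTI; exact: (measurable_field_tuple t mV).
have H : {ae P, forall w, forall i, i \in enum 'I_k -> Y (tnth t i) w = Z (tnth t i) w}.
  by apply: ae_all_seq => i _; exact: YZ.
apply/eqP; rewrite eq_le; apply/andP; split; apply: le_measure_ae; try exact: mT.
  by apply: filterS H => w {}H /=; congr B; apply: eq_mktuple => i; rewrite H// mem_enum.
by apply: filterS H => w {}H /=; congr B; apply: eq_mktuple => i; rewrite H// mem_enum.
Qed.
End fdd.

Lemma fdd_eq_trans {R : realType} {G : groupType} {d1 d2 d3}
    {O1 : measurableType d1} {O2 : measurableType d2} {O3 : measurableType d3}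
    (P1 : probability O1 R) (P2 : probability O2 R) (P3 : probability O3 R)
    (X1 : G -> O1 -> R) (X2 : G -> O2 -> R) (X3 : G -> O3 -> R) :
  fdd_eq P1 X1 P2 X2 -> fdd_eq P2 X2 P3 X3 -> fdd_eq P1 X1 P3 X3.
Proof. by move=> h12 h23 k t B mB; rewrite h12// h23. Qed.

(** * The kernels and their components on the two parts *)

Section kernel.
Context {R : realType} {G : groupType} {d} {S : measurableType d} (alpha : R).
Variables (m : {sigma_finite_measure set S -> \bar R}) (phi : G -> S -> S).
Variables (c : G -> S -> R) (f : S -> R).
Hypotheses (alpha_gt0 : 0 < alpha) (phi_act : is_action phi) (phi_ns : nonsingular m phi).
Hypotheses (c_coc : cocycle m phi c) (fL : f \in Lfun m alpha%:E).

Local Notation f_ := (field_kernel alpha m phi c f).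
Local Notation rn := (rn_deriv m phi).

Let mf : measurable_fun setT f. Proof. by case/(mem_LfunP m alpha_gt0): fL. Qed.

Lemma normr_cocycle t s : `|c t s| = 1.
Proof. by case: c_coc => _ /(_ t s) [] -> _; rewrite ?normrN1 ?normr1. Qed.

Lemma measurable_field_kernel t : measurable_fun setT (f_ t).
Proof.
apply: measurable_funM; last by apply: measurableT_comp => //; exact: action_measurable.
apply: measurable_funM; first by case: c_coc.
apply: (measurableT_comp (measurable_powR _)); exact: measurable_rn.
Qed.

Lemma field_kernel_absX t s : `|f_ t s| `^ alpha = rn t s * `|f (phi t s)| `^ alpha.
Proof.
rewrite /field_kernel !normrM normr_cocycle mul1r (ger0_norm (powR_ge0 _ _)).
rewrite powRM ?powR_ge0// -powRrM mulVf ?gt_eqF// powRr1// rn_ge0//.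
Qed.

Lemma powint_field_kernel t : powint m alpha (f_ t) = powint m alpha f.
Proof.
rewrite /powint; under eq_integral do rewrite field_kernel_absX.
by apply: integral_trans => //; exact: measurable_absX.
Qed.

Lemma field_kernel_Lfun t : f_ t \in Lfun m alpha%:E.
Proof.
apply/(mem_LfunP m alpha_gt0); split; first exact: measurable_field_kernel.
by rewrite powint_field_kernel; case/(mem_LfunP m alpha_gt0): fL.
Qed.

Context {dM} {Omega : measurableType dM} (P : probability Omega R).
Variables (M : set S -> {RV P >-> R}) (B : set S).
Hypotheses (MS : SaS_random_measure alpha m M) (mB : measurable B).

Local Notation I := (stable_integral alpha m M).
Let g1 t := f_ t \_ (~` B).
Let g2 t := f_ t \_ B.

Let g1L t : g1 t \in Lfun m alpha%:E.
Proof. by apply: (Lfun_restrict alpha_gt0); [exact: measurableC|exact: field_kernel_Lfun]. Qed.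

Let g2L t : g2 t \in Lfun m alpha%:E.
Proof. by apply: (Lfun_restrict alpha_gt0) => //; exact: field_kernel_Lfun. Qed.

Lemma stable_integral_split t : {ae P, forall w, I (f_ t) w =
  stable_integral_on alpha m M (~` B) (f_ t) w + stable_integral_on alpha m M B (f_ t) w}.
Proof.
have := stable_integral_lin alpha_gt0 MS 1 (g1L t) (g2L t).
rewrite (_ : (fun s => _) = f_ t).
  by apply: filterS => w; rewrite mul1r.
apply/funext => s; rewrite mul1r /g1 /g2 !patchE in_setC.
by case: (s \in B); rewrite /= ?add0r ?addr0.
Qed.

Let left_part (l : seq (R * (G + G))) : seq (R * G) :=
  pmap (fun p => if p.2 is inl t then Some (p.1, t) else None) l.
Let right_part (l : seq (R * (G + G))) : seq (R * G) :=
  pmap (fun p => if p.2 is inr t then Some (p.1, t) else None) l.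

Let linform_parts l (x : G + G -> R) : linform l x =
  linform (left_part l) (x \o inl) + linform (right_part l) (x \o inr).
Proof.
rewrite /linform; elim: l => [|[a [t|t]] l IH] /=; first by rewrite !big_nil addr0.
  by rewrite !big_cons /= IH addrA.
by rewrite !big_cons /= IH addrCA.
Qed.

(** The two families of kernels live on complementary sets, so at each [s] one of the linear forms
    vanishes and [|x + y|^alpha = |x|^alpha + |y|^alpha]. The cosine transform therefore factorizes
    as for independent copies. *)
Lemma independent_stable_integrals :
  independent_fields P (fun t => stable_integral_on alpha m M (~` B) (f_ t))
                       (fun t => stable_integral_on alpha m M B (f_ t)).
Proof.
set X1 := fun t => _; set X2 := fun t => stable_integral_on _ _ _ B _.
have mX1 t : measurable_fun setT (X1 t) by exact: measurable_stable_integral.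
have mX2 t : measurable_fun setT (X2 t) by exact: measurable_stable_integral.
apply: independent_of_cos => // l a.
pose g (j : G + G) := match j with inl t => g1 t | inr t => g2 t end.
have gL j : g j \in Lfun m alpha%:E by case: j.
have jE w : joint X1 X2 ^~ w = (fun j => I (g j) w) by apply/funext => -[].
under eq_Rintegral do rewrite jE.
rewrite (stable_integral_cos alpha_gt0 MS l a gL).
pose U w := linform (left_part l) (X1^~ w); pose V w := linform (right_part l) (X2^~ w).
have mU : measurable_fun setT U by exact: measurable_linform.
have mV : measurable_fun setT V by exact: measurable_linform.
have cE z : cos (linform l (joint_copy X1 X2 ^~ z) + a) = cos (U z.1 + V z.2 + a).
  by rewrite linform_parts.
under [RHS]eq_Rintegral do rewrite cE.
have mcos : measurable_fun setT (@cos R) by exact: (continuous_measurable_fun (@continuous_cos R)).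
rewrite (@product_prob_integral _ _ _ _ _ P P _ 1); first last.
- by move=> z; exact: cos_max.
- apply: (measurableT_comp mcos); apply: measurable_funD => //.
  by apply: measurable_funD; apply: measurableT_comp.
(* For a fixed first variable, [U x] only shifts the phase of the cosine in the second variable. *)
have inner x : \int[P]_y cos (U (x, y).1 + V (x, y).2 + a) =
    cos (U x + a) * expR (- fine (powint m alpha (fun s => linform (right_part l) (g2^~ s)))).
  under eq_Rintegral => y _ do rewrite /= -addrA (addrC (V y)) addrA (addrC _ (V y)).
  exact: (stable_integral_cos alpha_gt0 MS (right_part l) (U x + a) g2L).
under [RHS]eq_Rintegral do rewrite inner.
have icU : P.-integrable setT (EFin \o (fun x => cos (U x + a))).
  apply: (@bounded_integrable _ _ _ _ _ 1) => [|w]; last exact: cos_max.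
  by apply: (measurableT_comp mcos); exact: measurable_funD.
rewrite (RintegralZr _ measurableT icU).
rewrite (stable_integral_cos alpha_gt0 MS (left_part l) a g1L) -mulrA -expRD; congr (_ * expR _).
have L1 := Lfun_linform alpha_gt0 (left_part l) g1L.
have L2 := Lfun_linform alpha_gt0 (right_part l) g2L.
have [m1 _] := (mem_LfunP m alpha_gt0 _).1 L1.
have [m2 _] := (mem_LfunP m alpha_gt0 _).1 L2.
have fin h : h \in Lfun m alpha%:E -> powint m alpha h \is a fin_num.
  by move=> hL; rewrite -(Lfun_fineK alpha_gt0 hL).
rewrite -opprD -fineD; [|exact: fin L1|exact: fin L2].
congr (- fine _); rewrite /powint -ge0_integralD; first last.
- by apply/measurable_EFinP; exact: measurable_absX.
- by move=> s _; rewrite lee_fin powR_ge0.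
- by apply/measurable_EFinP; exact: measurable_absX.
- by move=> s _; rewrite lee_fin powR_ge0.
- exact: measurableT.
apply: eq_integral => s _; rewrite -EFinD; congr (_%:E).
have -> : linform l (g^~ s) = linform (left_part l) (g1^~ s) + linform (right_part l) (g2^~ s).
  exact: linform_parts.
have [Bs|nBs] := pselect (B s).
  have -> : linform (left_part l) (g1^~ s) = 0.
    by rewrite /linform big1// => p _; rewrite /g1 patchE memNset ?mulr0//= => /(_ Bs).
  by rewrite normr0 powR0 ?gt_eqF// !add0r.
have -> : linform (right_part l) (g2^~ s) = 0.
  by rewrite /linform big1// => p _; rewrite /g2 patchE memNset ?mulr0.
by rewrite normr0 powR0 ?gt_eqF// !addr0.
Qed.

Lemma stable_integral_on_eq0 t :
  {ae P, forall w, stable_integral_on alpha m M (~` B) (f_ t) w = 0} <->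
  {ae m, forall s, ~ B s -> f_ t s = 0}.
Proof.
rewrite -(stable_integral_eq0 alpha_gt0 MS (g1L t)).
rewrite (powint_eq0 _ alpha_gt0); last by case/(mem_LfunP m alpha_gt0): (g1L t).
split; apply: filterS => s; rewrite /g1 patchE in_setC => h.
  by move=> nB; move: h; rewrite memNset.
by case: ifP => // /negP; rewrite inE => /h.
Qed.

(** The identity of the group is enough: there the derivative is 1 almost everywhere and the kernel
    is [f] up to sign. *)
Lemma zero_component_support :
  (forall t, {ae P, forall w, stable_integral_on alpha m M (~` B) (f_ t) w = 0}) ->
  ae_subset m [set s | f s != 0] B.
Proof.
move=> /(_ 1%g)/stable_integral_on_eq0 h.
have : {ae m, forall s, f s != 0 -> B s}.
  apply: filterS2 h (rn1 phi_act phi_ns) => s h rs fs; apply: contrapT => /h /eqP.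
  rewrite /field_kernel rs powR1 mulr1 (action1 phi_act) mulf_eq0 (negbTE fs) orbF.
  by rewrite -normr_eq0 normr_cocycle oner_eq0.
by apply: negligibleS => s [/= fs nB] /(_ fs).
Qed.

(** Contrapositive: if [f] vanishes almost everywhere off [B], then [f o phi_t] does too, because
    [phi_t] preserves null sets and the complement of [B] is invariant. *)
Lemma nonzero_component_support :
  (forall t, m.-negligible (B `\` phi t @^-1` B) /\ m.-negligible (phi t @^-1` B `\` B)) ->
  ~ (forall t, {ae P, forall w, stable_integral_on alpha m M (~` B) (f_ t) w = 0}) ->
  (0 < m ([set s | f s != 0%R] `&` ~` B))%E.
Proof.
move=> Binv nz; rewrite lt_neqAle measure_ge0 andbT; apply/eqP => m0; apply: nz => t.
apply/stable_integral_on_eq0.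
have mZ : measurable ([set s | f s != 0] `&` ~` B).
  apply: measurableI; last exact: measurableC.
  rewrite (_ : [set s | _] = ~` (f @^-1` [set 0])).
    by apply: measurableC; have := mf measurableT (measurable_set1 0); rewrite setTI.
  by apply/seteqP; split => s /=; [move/eqP|move=> h; apply/eqP].
have h1 : {ae m, forall s, ~ ([set s | f s != 0] `&` ~` B) (phi t s)}.
  have h0 : {ae m, forall s, ~ ([set s | f s != 0] `&` ~` B) s}.
    by exists ([set s | f s != 0] `&` ~` B); split => // s /= /contrapT.
  exact: (ae_action phi_act phi_ns t h0).
have h2 : {ae m, forall s, B (phi t s) -> B s}.
  by case: (Binv t) => _; apply: negligibleS => s /= /not_implyP.
apply: filterS2 h1 h2 => s h1 h2 nB; apply/eqP; apply: contraT => fs; exfalso; apply: h1; split => /=.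
  by apply: contra fs => /eqP h; rewrite /field_kernel h mulr0.
by move=> /h2.
Qed.
End kernel.

Section weighted_probability.
Context {R : realType} {d} {S : measurableType d} (m : {measure set S -> \bar R}).
Variables (w : S -> R) (mw : measurable_fun setT w) (w0 : forall s, 0 <= w s).

Definition weighted_prob of (\int[m]_s (w s)%:E = 1)%E := weighted m mw w0.

Hypothesis w1 : (\int[m]_s (w s)%:E = 1)%E.

HB.instance Definition _ := Measure.on (weighted_prob w1).

Let weighted_prob_setT : weighted_prob w1 setT = 1%E. Proof. exact: w1. Qed.

HB.instance Definition _ :=
  Measure_isProbability.Build _ _ _ (weighted_prob w1) weighted_prob_setT.

Lemma weighted_prob_integral (F : S -> \bar R) : measurable_fun setT F ->
  (forall s, 0 <= F s)%E ->
  (\int[weighted_prob w1]_s F s = \int[m]_s (F s * (w s)%:E))%E.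
Proof. exact: ge0_integral_density (weighted_density m mw w0). Qed.
End weighted_probability.

(** * Bounds for maxima of stable integrals under an envelope *)

Section stable_max_bounds.
Context {R : realType} {d} {S : measurableType d} {d'} {Omega : measurableType d'}.
Variables (alpha : R) (m : {measure set S -> \bar R}) (P : probability Omega R).
Variable M : set S -> {RV P >-> R}.
Hypotheses (alpha_gt0 : 0 < alpha) (alpha_lt2 : alpha < 2).
Hypothesis MS : SaS_random_measure alpha m M.
Variables (k : nat) (F : 'I_k -> S -> R) (h : S -> R) (C0 q : R).
Hypotheses (k0 : (0 < k)%N) (FL : forall i, F i \in Lfun m alpha%:E)
  (FC : forall i, (powint m alpha (F i) <= C0%:E)%E) (mh : measurable_fun setT h)
  (h0 : forall s, 0 <= h s) (Fh : forall i s, `|F i s| `^ alpha <= h s)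
  (hF : forall s, h s != 0 -> exists i, `|F i s| `^ alpha = h s)
  (hq : (\int[m]_s (h s)%:E = q%:E)%E).

Local Notation I := (stable_integral alpha m M).
Local Notation lc := (levy_cos alpha).
Local Notation prob y := (fine (P [set w | forall i, `|I (F i) w| <= y])).

Let lc0 : 0 < lc. Proof. exact: levy_cos_gt0. Qed.
Let q0 : 0 <= q. Proof. by rewrite -lee_fin -hq integral_ge0// => s _; rewrite lee_fin. Qed.
Let C00 : 0 <= C0.
Proof. by have := le_trans (powint_ge0 m alpha _) (FC (Ordinal k0)); rewrite lee_fin. Qed.
Let mF i : measurable_fun setT (F i). Proof. by case/(mem_LfunP m alpha_gt0): (FL i). Qed.
Let C := C0 / lc.

Let bad_ge0 e delta : 0 <= bad_bound alpha k C e delta.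
Proof.
rewrite /bad_bound mulr_ge0// addr_ge0 ?sqr_ge0// divr_ge0 ?sqr_ge0//.
rewrite mulr_ge0 ?divr_ge0 ?(ltW lc0)// mulr_ge0 ?powR_ge0// fine_ge0//.
by apply: integral_ge0 => v _; rewrite lee_fin sqr_upto_ge0.
Qed.

Let prob_q0 y : 0 <= y -> q = 0 -> prob y = 1.
Proof.
move=> y0 qE; have hae : {ae m, forall s, h s = 0}.
  have : (\int[m]_s `|(h s)%:E| = 0)%E.
    by under eq_integral do rewrite abse_EFin ger0_norm//; rewrite hq qE.
  have mhE : measurable_fun setT (EFin \o h) by exact/measurable_EFinP.
  move=> /(ae_eq_integral_abs m measurableT mhE); apply: filterS => s /(_ Logic.I).
  by case.
have I0 i : {ae P, forall w, I (F i) w = 0}.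
  apply/(stable_integral_eq0 alpha_gt0 MS (FL i)); apply/(powint_eq0 _ alpha_gt0 (mF i)).
  apply: filterS hae => s hs; apply/eqP; rewrite -normr_eq0; apply/eqP.
  by apply: (powR_eq0_eq0 (p := alpha)); apply/eqP; rewrite eq_le powR_ge0 -{1}hs Fh.
have mE : measurable [set w | forall i, `|I (F i) w| <= y].
  rewrite (_ : [set w | _] = \bigcap_(i in [set: 'I_k]) [set w | `|I (F i) w| <= y]).
    apply: fin_bigcap_measurable => // i _; apply: measurable_ler_set.
    by apply: measurableT_comp => //; exact: measurable_stable_integral.
  by apply/seteqP; split => w /= H i => [_|]; apply: H.
have H : {ae P, forall w, forall i, i \in enum 'I_k -> I (F i) w = 0} by apply: ae_all_seq => i _.
have : (P setT <= P [set w | (forall i, `|I (F i) w| <= y)%R])%E.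
  apply: le_measure_ae => //; apply: filterS H => w H _ i.
  by rewrite H ?mem_enum// normr0.
rewrite [X in (X <= _)%E](probability_setT P) => h1; apply/eqP; rewrite eq_le.
by rewrite -!lee_fin fine_probE// h1 probability_le1.
Qed.

Section positive.
Hypothesis qpos : 0 < q.
(** The scale at which [levy_cos] times the [alpha]-integral of the new kernels under [rho] equals
    the [alpha]-integral of the original ones under [m]. *)
Let b := (q / lc) `^ alpha^-1.
Let b0 : 0 < b. Proof. by rewrite powR_gt0// divr_gt0. Qed.
Let bX : b `^ alpha = q / lc.
Proof. by rewrite -powRrM mulVf ?gt_eqF// powRr1// divr_ge0// ltW. Qed.

Let w s := h s / q.
Let mw : measurable_fun setT w. Proof. exact: measurable_funM. Qed.
Let w0 s : 0 <= w s. Proof. by rewrite divr_ge0. Qed.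
Let w1 : (\int[m]_s (w s)%:E = 1)%E.
Proof.
rewrite /w; under eq_integral do rewrite mulrC EFinM.
rewrite ge0_integralZl//; first last.
- by rewrite lee_fin invr_ge0 ltW.
- by move=> s _; rewrite lee_fin.
- exact/measurable_EFinP.
by rewrite hq -EFinM mulVf// gt_eqF.
Qed.
Let rho := weighted_prob mw w0 w1.

(** Where [h = 0] all [F i] vanish and [rho] has no mass; the value [b] is put there so that the
    largest modulus over [i] is [b] at every point. *)
Let g i s := if h s == 0 then b else b * (h s `^ (- alpha^-1) * F i s).

Let mg i : measurable_fun setT (g i).
Proof.
apply: measurable_fun_ifT => //; first exact: measurable_fun_eqr.
apply: measurable_funM => //; apply: measurable_funM => //.
exact: (measurableT_comp (measurable_powR _)).
Qed.

Let hX s : h s != 0 -> (h s `^ (- alpha^-1)) `^ alpha = (h s)^-1.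
Proof. by move=> hs; rewrite -powRrM mulNr mulVf ?gt_eqF// powR_inv1. Qed.

Let gE i s : h s != 0 -> `|g i s| `^ alpha = q / lc * ((h s)^-1 * `|F i s| `^ alpha).
Proof.
move=> hs; rewrite /g (negbTE hs) !normrM (gtr0_norm b0) (ger0_norm (powR_ge0 _ _)).
by rewrite powRM ?mulr_ge0 ?powR_ge0 ?(ltW b0)// powRM ?powR_ge0// bX hX.
Qed.

Let powR_le_inv (x y : R) : 0 <= x -> 0 <= y -> x `^ alpha <= y `^ alpha -> x <= y.
Proof.
move=> x0 y0 xy; rewrite leNgt; apply/negP => yx.
have := gt0_ltr_powR alpha_gt0 _ _ yx; rewrite !nnegrE => /(_ y0 x0).
by rewrite ltNge xy.
Qed.

Let gb i s : `|g i s| <= b.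
Proof.
have [hs|hs] := eqVneq (h s) 0; first by rewrite /g hs eqxx gtr0_norm.
apply: powR_le_inv; rewrite ?(ltW b0)//.
have hp : 0 < h s by rewrite lt_neqAle eq_sym hs h0.
rewrite gE// bX ler_piMr ?divr_ge0 ?(ltW lc0)//.
by rewrite mulrC ler_pdivrMr// mul1r Fh.
Qed.

Let gmax s : exists i, `|g i s| = b.
Proof.
have [hs|hs] := eqVneq (h s) 0.
  by exists (Ordinal k0); rewrite /g hs eqxx gtr0_norm.
have [i Fi] := hF hs; exists i; apply/eqP; rewrite eq_le gb/=.
by apply: powR_le_inv; rewrite ?(ltW b0)// gE// bX Fi mulVf// mulr1.
Qed.

Let mabs i : measurable_fun setT (fun s => (`|g i s| `^ alpha)%:E).
Proof. by apply/measurable_EFinP; exact: measurable_absX. Qed.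

Let gC i : (\int[rho]_s (`|g i s| `^ alpha)%:E <= C%:E)%E.
Proof.
rewrite weighted_prob_integral//; apply: (@le_trans _ _ (\int[m]_s ((lc^-1)%:E * (`|F i s| `^ alpha)%:E))%E).
  apply: ge0_le_integral => //.
  - by move=> s _; rewrite mule_ge0 ?lee_fin ?powR_ge0.
  - by apply: emeasurable_funM => //; exact/measurable_EFinP.
  - by apply: emeasurable_funM => //; apply/measurable_EFinP; exact: measurable_absX.
  - move=> s _; rewrite -!EFinM lee_fin.
    have [hs|hs] := eqVneq (h s) 0.
      by rewrite /w hs mul0r mulr0 mulr_ge0 ?powR_ge0 ?invr_ge0 ?(ltW lc0).
    rewrite gE// /w le_eqVlt; apply/orP; left; apply/eqP; field.
    by rewrite hs !gt_eqF.
rewrite ge0_integralZl//; first last.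
- by rewrite lee_fin invr_ge0 ltW.
- by apply/measurable_EFinP; exact: measurable_absX.
by rewrite /C mulrC EFinM lee_pmul2l ?lte_fin ?invr_gt0// FC.
Qed.

Let mI i : measurable_fun setT (I (F i)). Proof. exact: measurable_stable_integral. Qed.

Let cosI (l : seq (R * 'I_k)) c : \int[P]_w cos (linform l (fun i => I (F i) w) + c) = cos c *
  expR (- (lc * fine (\int[rho]_s (`|linform l (g ^~ s)| `^ alpha)%:E)%E)).
Proof.
rewrite (stable_integral_cos alpha_gt0 MS l c FL); congr (_ * expR (- _)).
have LL := Lfun_linform alpha_gt0 l FL.
have mg' : measurable_fun setT (fun s => (`|linform l (g ^~ s)| `^ alpha)%:E).
  by apply/measurable_EFinP/measurable_absX; exact: measurable_linform.
rewrite weighted_prob_integral//.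
have -> : (\int[m]_s ((`|linform l (g^~ s)| `^ alpha)%:E * (w s)%:E) =
    (lc^-1)%:E * powint m alpha (fun s => linform l (F^~ s)))%E.
  rewrite /powint -ge0_integralZl//; first last.
  - by rewrite lee_fin invr_ge0 ltW.
  - by apply/measurable_EFinP/measurable_absX; case/(mem_LfunP m alpha_gt0): LL.
  apply: eq_integral => s _; rewrite -!EFinM; congr (_%:E).
  have [hs|hs] := eqVneq (h s) 0.
    rewrite /w hs mul0r mulr0 (_ : linform l _ = 0) ?normr0 ?powR0 ?mulr0 ?gt_eqF//.
    rewrite /linform big1// => p _; rewrite (_ : F p.2 s = 0) ?mulr0//.
    apply/eqP; rewrite -normr_eq0; apply/eqP; apply: (powR_eq0_eq0 (p := alpha)).
    by apply/eqP; rewrite eq_le powR_ge0 -{1}hs Fh.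
  have -> : linform l (g^~ s) = b * (h s `^ (- alpha^-1) * linform l (F^~ s)).
    rewrite /linform !mulr_sumr; apply: eq_bigr => p _; rewrite /g (negbTE hs); ring.
  rewrite !normrM (gtr0_norm b0) (ger0_norm (powR_ge0 _ _)).
  rewrite powRM ?mulr_ge0 ?powR_ge0 ?(ltW b0)// powRM ?powR_ge0// bX hX// /w.
  field; by rewrite hs !gt_eqF.
rewrite -(Lfun_fineK alpha_gt0 LL) -EFinM /= mulrA mulfV ?mul1r// gt_eqF// levy_cos_gt0.
Qed.

Lemma stable_max_bounds_pos e delta y : 0 < e -> 0 < delta ->
  (delta < y -> expR (- (2 * (q / lc) * (y - delta) `^ (- alpha))) -
    bad_bound alpha k C e (delta / 2) <= prob y) /\
  (0 <= y -> e <= y + delta -> prob y <= expR (- (2 * (q / lc) * (y + delta) `^ (- alpha))) +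
    bad_bound alpha k C e (delta / 2)).
Proof.
move=> e0 d0; split => [dy|y0 ey].
  have := @prob_stable_max_ge _ _ _ rho alpha alpha_gt0 alpha_lt2 k g b C mg b0 gb gC
    _ _ P (fun i => I (F i)) mI cosI e delta y e0.
  by rewrite d0 dy => /(_ isT); rewrite bX.
have := @prob_stable_max_le _ _ _ rho alpha alpha_gt0 alpha_lt2 k g b C mg b0 gb gC
    _ _ P (fun i => I (F i)) mI cosI gmax e delta y d0 y0.
by rewrite e0 ey => /(_ isT); rewrite bX.
Qed.
End positive.

(** For [q = 0] no normalization is possible, but then all the integrals vanish almost surely and
    the probability is 1. *)
Lemma stable_max_bounds e delta y : 0 < e -> 0 < delta ->
  (delta < y -> expR (- (2 * (q / lc) * (y - delta) `^ (- alpha))) -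
    bad_bound alpha k C e (delta / 2) <= prob y) /\
  (0 <= y -> e <= y + delta -> prob y <= expR (- (2 * (q / lc) * (y + delta) `^ (- alpha))) +
    bad_bound alpha k C e (delta / 2)).
Proof.
move=> e0 d0; have [qE|q_neq0] := eqVneq q 0; last first.
  by apply: stable_max_bounds_pos => //; rewrite lt_neqAle eq_sym q_neq0 q0.
split => [dy|y0 ey]; rewrite qE mul0r mulr0 mul0r oppr0 expR0.
  by rewrite prob_q0 ?gerBl ?bad_ge0// ltW// (lt_trans d0).
by rewrite prob_q0// lerDl bad_ge0.
Qed.
End stable_max_bounds.

(** * Asymptotics of distribution functions from two-sided bounds *)

Section maxima_asymptotics.
Context {R : realType}.
Variables (alpha c1 c2 gmax : R) (k gam : nat -> R) (F : nat -> R -> R).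
Hypotheses (alpha0 : 0 < alpha) (alpha2 : alpha < 2) (c10 : 0 <= c1) (c20 : 0 <= c2).
Hypotheses (k1 : forall n, 1 <= k n) (kinf : forall N, \forall n \near \oo, N <= k n).
Hypotheses (gam0 : forall n, 0 <= gam n) (gamle : forall n, gam n <= gmax).

Let bad e delta n := c1 * (e `^ (- alpha)) ^+ 2 / k n + c2 * e `^ (2 - alpha) / delta ^+ 2.

Hypothesis F_ge : forall n e delta x, 0 < e -> 0 < delta -> delta < x ->
  expR (- (gam n * (x - delta) `^ (- alpha))) - bad e delta n <= F n x.
Hypothesis F_le : forall n e delta x, 0 < e -> 0 < delta -> 0 <= x -> e <= x + delta ->
  F n x <= expR (- (gam n * (x + delta) `^ (- alpha))) + bad e delta n.

Let k0 n : 0 < k n. Proof. exact: lt_le_trans (k1 n). Qed.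

Let dist_squeeze (p p1 p2 a1 a2 b z e : R) : `|p - p1| <= e -> `|p - p2| <= e ->
  `|p1 - a1| <= e -> `|p2 - a2| <= e -> b <= e -> a1 - b <= z -> z <= a2 + b ->
  `|p - z| <= e * 3.
Proof.
rewrite !ler_norml => /andP[_ h1] /andP[h2 _] /andP[_ h3] /andP[h4 _] h5 h6 h7.
by apply/andP; split; lra.
Qed.

Let powR_small (tau p x : R) : 0 < tau -> 0 < p -> 0 < x ->
  exists e, [/\ 0 < e, e <= x & e `^ p <= tau].
Proof.
move=> t0 p0 x0; exists (Num.min (tau `^ p^-1) x); split.
- by rewrite lt_min powR_gt0.
- by rewrite ge_min lexx orbT.
- apply: (@le_trans _ _ ((tau `^ p^-1) `^ p)).
    apply: ge0_ler_powR; rewrite ?nnegrE ?powR_ge0 ?(ltW p0)//.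
    + by rewrite le_min powR_ge0 ltW.
    + by rewrite ge_min lexx.
  by rewrite -powRrM mulVf ?gt_eqF// powRr1// ltW.
Qed.

Let powRN_small (tau p : R) : 0 < tau -> 0 < p ->
  exists2 y0, 0 < y0 & forall y, y0 <= y -> y `^ (- p) <= tau.
Proof.
move=> t0 p0; exists (tau `^ (- p^-1)); first exact: powR_gt0.
move=> y yy; have y0 : 0 < y by apply: lt_le_trans yy; exact: powR_gt0.
rewrite powRN -[leRHS]invrK lef_pV2 ?posrE ?invr_gt0 ?powR_gt0//.
have -> : tau^-1 = (tau `^ (- p^-1)) `^ p.
  by rewrite -powRrM mulNr mulVf ?gt_eqF// powR_inv1// ltW.
by apply: ge0_ler_powR; rewrite ?nnegrE ?powR_ge0 ?(ltW p0) ?(ltW y0).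
Qed.

(** Order of choices: with [delta] fixed, a small [e] controls the second term for all [n] since
    [2 - alpha > 0]; only then does [k n -> oo] remove the first term, large though its factor in
    [e] may be. *)
Let bad_small delta x eta : 0 < delta -> 0 < x -> 0 < eta ->
  exists e, [/\ 0 < e, e <= x & \forall n \near \oo, bad e delta n <= eta].
Proof.
move=> d0 x0 eta0; have c2' : 0 < c2 + 1 by rewrite ltr_wpDl.
have t0 : 0 < eta / 2 * delta ^+ 2 / (c2 + 1) by rewrite !mulr_gt0 ?invr_gt0 ?exprn_gt0.
have p0 : 0 < 2 - alpha by rewrite subr_gt0.
have [e [e0 ex ep]] := powR_small t0 p0 x0; exists e; split => //.
have N0 := kinf (c1 * (e `^ (- alpha)) ^+ 2 / (eta / 2)).
apply: filterS N0 => n; rewrite ler_pdivrMr ?divr_gt0// => kn.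
rewrite /bad [leRHS](splitr eta); apply: lerD.
  by rewrite ler_pdivrMr// [leRHS]mulrC.
rewrite ler_pdivrMr ?exprn_gt0//; apply: le_trans (_ : c2 * (eta / 2 * delta ^+ 2 / (c2 + 1)) <= _).
  by rewrite ler_wpM2l.
rewrite mulrA ler_pdivrMr// [leRHS]mulrC ler_wpM2r ?lerDl//.
by rewrite mulr_ge0 ?sqr_ge0// divr_ge0// ltW.
Qed.

Lemma maxima_vanish x : 0 < x -> gam n @[n --> \oo] --> 0 ->
  forall eta, 0 < eta -> \forall n \near \oo, 1 - eta <= F n x.
Proof.
move=> x0 gc eta eta0; have x2 : 0 < x / 2 by rewrite divr_gt0.
have e2 : 0 < eta / 2 by rewrite divr_gt0.
have [e [e0 _ be]] := bad_small x2 x0 e2.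
have X0 : 0 < (x / 2) `^ (- alpha) by rewrite powR_gt0.
have e3 : 0 < eta / 2 / (x / 2) `^ (- alpha) by rewrite divr_gt0.
have /cvgr0Pnorm_le/(_ _ e3) gn := gc.
apply: filterS2 be gn => n bn gn.
have x2x : x / 2 < x by rewrite ltr_pdivrMr// ltr_pMr// ltr1n.
apply: le_trans (F_ge n e0 x2 x2x).
have -> : x - x / 2 = x / 2 by rewrite [X in X - _]splitr addrK.
move: gn; rewrite (ger0_norm (gam0 n)) ler_pdivlMr// => gn.
have := expR_ge1Dx (- (gam n * (x / 2) `^ (- alpha))).
lra.
Qed.

(** The bound has to hold for every [n], so only [k n >= 1] can be used: the first error term is
    made small by a large [e], and the exponent and the second error term by a still freely chosen
    large [delta = y]. *)
Lemma maxima_tight eta : 0 < eta -> exists2 x, 0 < x & forall n, 1 - eta <= F n x.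
Proof.
move=> eta0; have g0 : 0 <= gmax by apply: le_trans (gamle 0%N).
have t1 : 0 < eta / 3 / (c1 + 1) by rewrite !divr_gt0// ltr_wpDl.
have p2 : 0 < alpha * 2 by rewrite mulr_gt0.
have [e e0 /(_ e (lexx _)) he] := powRN_small t1 p2.
have t2 : 0 < eta / 3 / (gmax + 1) by rewrite !divr_gt0// ltr_wpDl.
have [y1 y10 hy1] := powRN_small t2 alpha0.
have E0 : 0 <= c2 * e `^ (2 - alpha) by rewrite mulr_ge0 ?powR_ge0.
have t3 : 0 < eta / 3 / (c2 * e `^ (2 - alpha) + 1) by rewrite !divr_gt0// ltr_wpDl.
have [y2 y20 hy2] := powRN_small t3 (ltr0n R 2).
pose y := Num.max y1 y2; have y0 : 0 < y by rewrite lt_max y10.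
have l1 : y1 <= y by rewrite le_max lexx.
have l2 : y2 <= y by rewrite le_max lexx orbT.
have yx : y < y + y by rewrite ltrDl.
exists (y + y); first by rewrite addr_gt0.
move=> n; apply: le_trans (F_ge n e0 y0 yx); rewrite addrK /bad.
have h1 : gam n * y `^ (- alpha) <= eta / 3.
  apply: (@le_trans _ _ ((gmax + 1) * (eta / 3 / (gmax + 1)))).
    rewrite ler_pM ?powR_ge0 ?hy1// (le_trans (gamle n))// lerDl//.
  by rewrite mulrC divfK// gt_eqF// ltr_wpDl.
have h2 : c1 * (e `^ (- alpha)) ^+ 2 / k n <= eta / 3.
  apply: (@le_trans _ _ (c1 * (e `^ (- alpha)) ^+ 2)).
    by rewrite ler_pdivrMr// ler_peMr// mulr_ge0// sqr_ge0.
  apply: (@le_trans _ _ ((c1 + 1) * (eta / 3 / (c1 + 1)))).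
    rewrite ler_pM ?sqr_ge0 ?lerDl// -powR_mulrn ?powR_ge0// -powRrM mulNr//.
  by rewrite mulrC divfK// gt_eqF// ltr_wpDl.
have h3 : c2 * e `^ (2 - alpha) / y ^+ 2 <= eta / 3.
  rewrite -[y ^+ 2](powR_mulrn 2 (ltW y0)) -powRN.
  apply: (@le_trans _ _ ((c2 * e `^ (2 - alpha) + 1) * (eta / 3 / (c2 * e `^ (2 - alpha) + 1)))).
    by rewrite ler_pM ?powR_ge0 ?hy2 ?lerDl.
  by rewrite mulrC divfK// gt_eqF// ltr_wpDl.
have := expR_ge1Dx (- (gam n * y `^ (- alpha))).
lra.
Qed.

Variables (n_ : nat -> nat) (g : R).
Hypotheses (n_incr : {homo n_ : i j / (i < j)%N}) (g0 : 0 < g)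
  (gcvg : gam (n_ j) @[j --> \oo] --> g).

Let phi y := expR (- (g * y `^ (- alpha))).

Let n_ge j : (j <= n_ j)%N.
Proof. by elim: j => // j IH; rewrite (leq_ltn_trans IH)//; exact: n_incr. Qed.

Let near_n_ (Q : nat -> Prop) : (\forall n \near \oo, Q n) -> \forall j \near \oo, Q (n_ j).
Proof. by move=> [N _ HN]; exists N => // j /= Nj; apply: HN; exact: leq_trans (n_ge j). Qed.

Let phi_continuous x : 0 < x -> {for x, continuous phi}.
Proof.
move=> x0; apply: (@continuous_comp _ _ _ (fun y => - (g * y `^ (- alpha))) expR); last exact: continuous_expR.
apply: continuousN; apply: continuousM; first exact: cvg_cst.
apply: differentiable_continuous; apply/derivable1_diffP; apply: derivable_powR.
by rewrite in_itv/= andbT.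
Qed.

Let phi_gam_cvg y : expR (- (gam (n_ j) * y `^ (- alpha))) @[j --> \oo] --> phi y.
Proof.
apply: (@cvg_comp _ _ _ (fun j => - (gam (n_ j) * y `^ (- alpha))) expR); last exact: continuous_expR.
by apply: cvgN; apply: cvgM => //; exact: cvg_cst.
Qed.

(** Continuity of the limit at [x] fixes [delta], then [e] is chosen, and finally [j] is large
    enough for the exponentials at [x - delta] and [x + delta] to be near their limits. *)
Lemma maxima_cvg x : 0 < x -> F (n_ j) x @[j --> \oo] --> phi x.
Proof.
move=> x0; apply/cvgrPdist_le => eta eta0.
have e3 : 0 < eta / 3 by rewrite divr_gt0.
have /cvgrPdist_le/(_ _ e3) /= := phi_continuous x0.
move=> /nbhs_ballP[r /= r0 hr].
pose delta := Num.min (r / 2) (x / 2).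
have d0 : 0 < delta by rewrite lt_min !divr_gt0.
have dx : delta < x by rewrite gt_min [X in _ || X](_ : _ = true) ?orbT// ltr_pdivrMr// ltr_pMr// ltr1n.
have dr : delta < r by rewrite gt_min ltr_pdivrMr// ltr_pMr// ltr1n.
have h1 : `|phi x - phi (x - delta)| <= eta / 3.
  by apply: hr; rewrite /ball/= opprB addrCA subrr addr0 gtr0_norm.
have h2 : `|phi x - phi (x + delta)| <= eta / 3.
  by apply: hr; rewrite /ball/= opprD addrA subrr add0r normrN gtr0_norm.
have [e [e0 ex be]] := bad_small d0 x0 e3.
have /cvgrPdist_le/(_ _ e3) c1' := @phi_gam_cvg (x - delta).
have /cvgrPdist_le/(_ _ e3) c2' := @phi_gam_cvg (x + delta).
apply: filterS3 (near_n_ be) c1' c2' => j bj u1 u2.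
have l1 := F_ge (n_ j) e0 d0 dx.
have exd : e <= x + delta by rewrite (le_trans ex)// lerDl ltW.
have l2 := F_le (n_ j) e0 d0 (ltW x0) exd.
rewrite -[eta](@divfK _ 3) ?pnatr_eq0//.
exact: (dist_squeeze h1 h2 u1 u2 bj l1 l2).
Qed.

(** The limit law has no mass near 0: [x] is chosen so that the exponent is [2 / eta], whence the
    limit is at most [eta / 2]. By monotonicity this also settles nonpositive arguments. *)
Lemma maxima_cvg0 eta : 0 < eta -> exists2 x, 0 < x &
  \forall j \near \oo, F (n_ j) x <= eta.
Proof.
move=> eta0; have e2 : 0 < eta / 2 by rewrite divr_gt0.
pose x := (2 / (eta * g)) `^ (- alpha^-1).
have t0 : 0 < 2 / (eta * g) by rewrite divr_gt0// mulr_gt0.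
have x0 : 0 < x by exact: powR_gt0.
exists x => //; have xX : g * x `^ (- alpha) = 2 / eta.
  rewrite /x -powRrM mulrNN mulVf ?gt_eqF// powRr1 ?(ltW t0)//.
  by field; rewrite !gt_eqF.
have px : phi x <= eta / 2.
  rewrite /phi xX expRN -[leRHS]invrK invf_div lef_pV2 ?posrE ?expR_gt0 ?divr_gt0//.
  by rewrite (le_trans _ (expR_ge1Dx _))// lerDr.
have /cvgrPdist_le/(_ _ e2) := maxima_cvg x0.
by apply: filterS => j; rewrite ler_norml => /andP[h _]; move: h px; lra.
Qed.
End maxima_asymptotics.

Section subsequence.
Context {R : realType}.

Lemma bounded_not_cvg0_subsequence (u : nat -> R) (C : R) : (forall n, 0 <= u n <= C) ->
  ~ (u n @[n --> \oo] --> 0) ->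
  exists (n_ : nat -> nat) (g : R), [/\ {homo n_ : i j / (i < j)%N}, 0 < g &
    u (n_ j) @[j --> \oo] --> g].
Proof.
move=> uC nc.
have [eta eta0 freq] : exists2 eta : R, 0 < eta & forall N, exists2 n, (N <= n)%N & eta < u n.
  apply: contrapT => h; apply: nc; apply/cvgr0Pnorm_le => e e0.
  apply: contrapT => ne; apply: h; exists e => // N; apply: contrapT => hN; apply: ne.
  exists N => // n /= Nn; have /andP[u0 _] := uC n; rewrite ger0_norm// leNgt.
  by apply/negP => eu; apply: hN; exists n.
(* The filter of tails along the frequent indices with [u n > eta]. It lives in the compact
   [[eta, C]], so its cluster point is positive, and it is a cluster point of the whole sequence. *)
pose Fil : set_system R := [set A | exists N, forall n, (N <= n)%N -> eta < u n -> A (u n)].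
have FF : ProperFilter Fil.
  split.
    by move=> [N HN]; have [n Nn en] := freq N; exact: HN n Nn en.
  split; first by exists 0%N.
    move=> A A' [N HN] [N' HN']; exists (maxn N N') => n; rewrite geq_max => /andP[n1 n2] en.
    by split; [exact: HN|exact: HN'].
  by move=> A A' AA' [N HN]; exists N => n Nn en; apply: AA'; exact: HN.
have : compact `[eta, C] by exact: segment_compact.
move=> /(_ Fil FF) [|g [gI gc]].
  exists 0%N => n _ en; rewrite /= in_itv/= (ltW en)/=; by case/andP: (uC n).
have /cluster_eventually_cvg[n_ incr cvg] : cluster (u @ \oo) g.
  move=> A A' [N _ HN] gA'; apply: (gc A A' _ gA').
  by exists N => n Nn _; exact: HN.
exists n_, g; split => //.
  by move=> i j ij; have /leqW_mono -> := incr.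
by move: gI; rewrite /= in_itv/= => /andP[+ _]; exact: lt_le_trans.
Qed.
End subsequence.

(** * Normalized maxima of the stable field *)

Section stable_field_maxima.
Context {R : realType} (alpha : R).
Hypotheses (alpha_gt0 : 0 < alpha) (alpha_lt2 : alpha < 2).
Context {G : groupType} (D : {fset G}).
Hypothesis infinite_G : infinite_set [set: G].
Hypothesis D_sym : forall t, t \in D -> (t^-1)%g \in D.
Hypothesis D_gen : generates D.
Context {d} {S : measurableType d} (m : {sigma_finite_measure set S -> \bar R}).
Variable phi : G -> S -> S.
Hypotheses (phi_act : is_action phi) (phi_ns : nonsingular m phi).
Context {dX} {OmegaX : measurableType dX} (PX : probability OmegaX R).
Variable X : G -> {RV PX >-> R}.
Context {dM} {OmegaM : measurableType dM} (PM : probability OmegaM R).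
Variables (M : set S -> {RV PM >-> R}) (f : S -> R) (c : G -> S -> R).
Hypothesis MS : SaS_random_measure alpha m M.
Hypothesis fL : f \in Lfun m alpha%:E.
Hypothesis c_coc : cocycle m phi c.
Local Notation f_ := (field_kernel alpha m phi c f).
Local Notation I := (stable_integral alpha m M).
Hypothesis X_law : fdd_eq PX X PM (fun t => I (f_ t)).

Local Notation k_ n := ((ball_size D n)%:R : R).
Local Notation lc := (levy_cos alpha).
Let lc0 : 0 < lc. Proof. exact: levy_cos_gt0. Qed.

Let ratio (n : nat) (w : OmegaX) :=
  ball_max D (fun t => `|X t w|) n / ball_norming alpha D n.
Let cdf n x := fine (PX [set w | ratio n w <= x]).
Let pf s := `|f s| `^ alpha.
Let q n := fine (max_integral D phi m n pf).
Let C0 := fine (powint m alpha f).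
(** Exponent of the Frechet law of the largest jump: the [2] counts both signs of a jump, division
    by [levy_cos] is the normalization of the Levy measure, and division by the ball size comes from
    the norming. *)
Let gam n := 2 * (q n / lc) / k_ n.

Let apf : admissible m pf. Proof. exact: Lfun_admissible. Qed.
Let mpf : measurable_fun setT pf. Proof. by case: apf. Qed.

Let C0E : (\int[m]_s (pf s)%:E = C0%:E)%E.
Proof. by rewrite (Lfun_fineK alpha_gt0 fL). Qed.

Let k_gt0 n : 0 < k_ n. Proof. exact: k_gt0. Qed.

Let q_le n : (max_integral D phi m n pf <= (k_ n * C0)%:E)%E.
Proof. by rewrite EFinM -C0E max_integral_le// => s; exact: powR_ge0. Qed.

Let qE n : max_integral D phi m n pf = (q n)%:E.
Proof. by rewrite fineK// ge0_fin_numE ?max_integral_ge0// (le_lt_trans (q_le n))// ltry. Qed.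

Let gam_ge0 n : 0 <= gam n.
Proof. by rewrite !mulr_ge0 ?invr_ge0 ?(ltW (k_gt0 n)) ?(ltW lc0)// fine_ge0// max_integral_ge0. Qed.

Let gam_le n : gam n <= 2 * (C0 / lc).
Proof.
rewrite ler_pdivrMr// -mulrA ler_pM2l// mulrAC ler_pM2r ?invr_gt0//.
by have := q_le n; rewrite qE lee_fin mulrC.
Qed.

Let norming0 n : 0 < ball_norming alpha D n.
Proof. by rewrite ball_normingE powR_gt0. Qed.

Let ratio_ge0 n w : 0 <= ratio n w.
Proof. by rewrite divr_ge0 ?ball_max_ge0 ?ltW. Qed.

Let measurable_ratio n : measurable_fun setT (ratio n).
Proof.
apply: measurable_funM => //; apply: measurable_ball_max => t.
by apply: measurableT_comp.
Qed.

Let measurable_ratio_le n x : measurable [set w | ratio n w <= x].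
Proof. exact: measurable_ler_set. Qed.

Let ts n : (ball_size D n).-tuple G := in_tuple (enum_fset (fset_set (word_ball D n))).

Let tsP n t : word_ball D n t <-> exists i, t = tnth (ts n) i.
Proof.
split => [tn|/tnthP]; first by apply/tnthP; exact: word_ball_enum.
by rewrite -[t \in _]/(t \in fset_set (word_ball D n)) mem_ball// inE.
Qed.

Let cdfE n x : 0 <= x -> cdf n x = fine (PM [set w |
  forall i, `|I (f_ (tnth (ts n) i)) w| <= x * ball_norming alpha D n]).
Proof.
move=> x0; set y := x * _; have y0 : 0 <= y by rewrite mulr_ge0// ltW.
pose B := [set z : (ball_size D n).-tuple R | forall i, `|tnth z i| <= y].
have mB : measurable B.
  rewrite (_ : B = \bigcap_(i in [set: 'I_(ball_size D n)])
      [set z : (ball_size D n).-tuple R | `|tnth z i| <= y]).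
    apply: fin_bigcap_measurable => // i _; apply: measurable_ler_set.
    by apply: measurableT_comp => //; exact: measurable_tnth.
  by apply/seteqP; split => z /= H i => [_|]; apply: H.
have := X_law (ts n) mB; rewrite /fdd_prob /cdf.
rewrite (_ : [set w | B _] = [set w | ratio n w <= x]).
  move=> ->; congr (fine (PM _)); apply/seteqP; split => w /= H i.
    by have := H i; rewrite tnth_mktuple.
  by rewrite tnth_mktuple.
apply/seteqP; split => w /=; rewrite ler_pdivrMr// -/y.
  move=> H; apply: ball_max_le => // t /tsP[i ->].
  by have := H i; rewrite tnth_mktuple.
move=> H i; rewrite tnth_mktuple; apply: le_trans H.
by apply: (le_ball_max D_sym D_gen (fun t => `|X t w|)); apply/tsP; exists i.
Qed.

Let c1 := 4 * (C0 / lc) ^+ 2.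
Let c2 := 4 * (C0 / lc) * levy_sqr alpha.

(** With [K^alpha = k] the union bound balances: [k (K^(-alpha))^2 = 1 / k] and
    [k K^(2 - alpha) / K^2 = 1]. The factors 4 in [c1] and [c2] are the square of the 2 in the tail
    and that of the halved [delta]. *)
Let badE n e delta : 0 < e -> 0 < delta ->
  bad_bound alpha (ball_size D n) (C0 / lc) (e * ball_norming alpha D n)
    (delta * ball_norming alpha D n / 2) =
  c1 * (e `^ (- alpha)) ^+ 2 / k_ n + c2 * e `^ (2 - alpha) / delta ^+ 2.
Proof.
move=> e0 d0; have K0 := norming0 n; set K := ball_norming alpha D n in K0 *.
have KX : K `^ alpha = k_ n.
  by rewrite /K ball_normingE -powRrM mulVf ?gt_eqF// powRr1.
rewrite /bad_bound !powRM ?(ltW e0) ?(ltW K0)//.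
have -> : K `^ (- alpha) = (k_ n)^-1 by rewrite powRN KX.
have -> : K `^ (2 - alpha) = K ^+ 2 / k_ n.
  rewrite powRD; last by rewrite (gt_eqF K0) implybT.
  by rewrite powRN KX powR_mulrn// ltW.
rewrite /c1 /c2; field.
by rewrite !gt_eqF.
Qed.

Let pow_norming n x : 0 <= x -> (x * ball_norming alpha D n) `^ (- alpha) = x `^ (- alpha) / k_ n.
Proof.
move=> x0; rewrite powRM// ?(ltW (norming0 n))//; congr (_ * _).
by rewrite ball_normingE powRN -powRrM mulVf ?gt_eqF// powRr1.
Qed.

Let bounds n e delta x : 0 < e -> 0 < delta ->
  (delta < x -> expR (- (gam n * (x - delta) `^ (- alpha))) -
    (c1 * (e `^ (- alpha)) ^+ 2 / k_ n + c2 * e `^ (2 - alpha) / delta ^+ 2) <= cdf n x) /\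
  (0 <= x -> e <= x + delta -> cdf n x <= expR (- (gam n * (x + delta) `^ (- alpha))) +
    (c1 * (e `^ (- alpha)) ^+ 2 / k_ n + c2 * e `^ (2 - alpha) / delta ^+ 2)).
Proof.
move=> e0 d0; have K0 := norming0 n; set K := ball_norming alpha D n in K0 *.
pose F i := f_ (tnth (ts n) i).
pose h s := ball_max D (fun t => rn_deriv m phi t s * pf (phi t s)) n.
have FL i : F i \in Lfun m alpha%:E by exact: field_kernel_Lfun.
have FC i : (powint m alpha (F i) <= C0%:E)%E.
  by rewrite /F (powint_field_kernel alpha_gt0 phi_act phi_ns c_coc fL) -C0E.
have mh : measurable_fun setT h by apply: measurable_ball_max => t; exact: measurable_trans.
have h0 s : 0 <= h s by exact: ball_max_ge0.
have Fh i s : `|F i s| `^ alpha <= h s.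
  rewrite /F (field_kernel_absX f alpha_gt0 phi_act phi_ns c_coc).
  by apply: (le_ball_max D_sym D_gen (fun t => rn_deriv m phi t s * pf (phi t s))); apply/tsP; exists i.
have hF s : h s != 0 -> exists i, `|F i s| `^ alpha = h s.
  move=> _; have [t /tsP[i ->] ht] := ball_max_attained D_sym D_gen n
    (fun t => trans_ge0 phi_act phi_ns t s (fun s => powR_ge0 `|f s| alpha)).
  by exists i; rewrite /F (field_kernel_absX f alpha_gt0 phi_act phi_ns c_coc) /h ht.
have k0 : (0 < ball_size D n)%N by exact: ball_size_gt0.
have [H1 H2] := @stable_max_bounds _ _ _ _ _ alpha m PM M alpha_gt0 alpha_lt2 MS _ F h C0 (q n)
  k0 FL FC mh h0 Fh hF (qE n) (e * K) (delta * K) (x * K) (mulr_gt0 e0 K0) (mulr_gt0 d0 K0).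
have gE z : 0 <= z -> 2 * (q n / lc) * (z * K) `^ (- alpha) = gam n * z `^ (- alpha).
  by move=> z0; rewrite pow_norming// /gam mulrA mulrAC.
rewrite badE// in H1 H2; split.
  move=> dx; rewrite cdfE; last by rewrite ltW// (lt_trans d0).
  have := H1; rewrite ltr_pM2r// -mulrBl gE ?subr_ge0 ?(ltW dx)//; exact.
move=> x0 ex; rewrite cdfE//.
have := H2; rewrite -mulrDl ler_pM2r// gE ?addr_ge0 ?(ltW d0)//; apply => //.
by rewrite mulr_ge0// ltW.
Qed.

Let C00 : 0 <= C0. Proof. by rewrite fine_ge0// powint_ge0. Qed.
Let c10 : 0 <= c1. Proof. by rewrite mulr_ge0// sqr_ge0. Qed.
Let c20 : 0 <= c2.
Proof.
rewrite !mulr_ge0 ?invr_ge0 ?(ltW lc0)// fine_ge0//.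
by apply: integral_ge0 => v _; rewrite lee_fin sqr_upto_ge0.
Qed.
Let k1 n : 1 <= k_ n.
Proof. by rewrite ler1n (ball_size_gt0 D_sym D_gen). Qed.
Let kinf (N : R) : \forall n \near \oo, N <= k_ n.
Proof.
have [n Hn] := ball_size_unbounded D_sym D_gen infinite_G (Num.bound `|N|).
exists n => // k /= /Hn h; rewrite (le_trans (ler_norm N))// (le_trans (ltW (archi_boundP _)))//.
by rewrite ler_nat.
Qed.

Let F_ge n e delta x : 0 < e -> 0 < delta -> delta < x ->
  expR (- (gam n * (x - delta) `^ (- alpha))) -
    (c1 * (e `^ (- alpha)) ^+ 2 / k_ n + c2 * e `^ (2 - alpha) / delta ^+ 2) <= cdf n x.
Proof. by move=> e0 d0; case: (bounds n x e0 d0). Qed.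

Let F_le n e delta x : 0 < e -> 0 < delta -> 0 <= x -> e <= x + delta ->
  cdf n x <= expR (- (gam n * (x + delta) `^ (- alpha))) +
    (c1 * (e `^ (- alpha)) ^+ 2 / k_ n + c2 * e `^ (2 - alpha) / delta ^+ 2).
Proof. by move=> e0 d0; case: (bounds n x e0 d0). Qed.

Let exceed n x : 0 <= x -> PX [set w | x < `|ratio n w|] = (1 - cdf n x)%:E.
Proof.
move=> x0; rewrite -fine_probC ?fine_probE//; last exact: measurableC.
congr (PX _); apply/seteqP; split => w /=.
  by rewrite ger0_norm// => h /(lt_le_trans h); rewrite ltxx.
by rewrite ger0_norm// => /negP; rewrite -ltNge.
Qed.

Lemma maxima_cvg_in_probability : sublinear D phi m pf ->
  cvg_in_probability PX ratio (cst 0).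
Proof.
move=> sl; have gc : gam n @[n --> \oo] --> 0.
  apply/cvgr0Pnorm_le => e e0; have e1 : 0 < e / (2 / lc) by rewrite !divr_gt0.
  apply: filterS (sl _ e1) => n; rewrite qE lee_fin => h.
  by rewrite ger0_norm// ler_pdivrMr//; move: h; rewrite mulrAC ler_pdivlMr ?divr_gt0//; lra.
apply/cvg_in_probabilityP => e e0 r r0.
apply: filterS (maxima_vanish alpha_lt2 c20 k1 kinf gam_ge0 F_ge e0 gc r0) => n h.
rewrite (_ : [set w | _] = [set w | e < `|ratio n w|]); last first.
  by apply/seteqP; split => w /=; rewrite subr0.
by rewrite exceed ?(ltW e0)// lee_fin; lra.
Qed.

Lemma maxima_tight_ratio : tight PX ratio.
Proof.
move=> e e0; have [x x0 hx] := maxima_tight alpha_gt0 c10 c20 k1 gam_ge0 gam_le F_ge e0.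
exists x => n; have := hx n; rewrite -/(cdf n x) => h.
by rewrite exceed ?(ltW x0)// lee_fin; lra.
Qed.

Lemma maxima_frechet : ~ sublinear D phi m pf ->
  exists (n_ : nat -> nat) (kappa : R), [/\ {homo n_ : i j / (i < j)%N}, 0 < kappa &
    cvg_in_distribution PX (fun j => ratio (n_ j)) (fun x => frechet_cdf alpha (x / kappa))].
Proof.
move=> nsl; have gB n : 0 <= gam n <= 2 * (C0 / lc) by rewrite gam_ge0 gam_le.
have [|n_ [g [incr g0 gc]]] := bounded_not_cvg0_subsequence gB.
  move=> /cvgr0Pnorm_le gc; apply: nsl => e e0.
  have e1 : 0 < e * (2 / lc) by rewrite mulr_gt0// divr_gt0.
  apply: filterS (gc _ e1) => n; rewrite ger0_norm// qE lee_fin ler_pdivrMr// => h.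
  have l2 : 0 < 2 / lc by rewrite divr_gt0.
  by rewrite -(ler_pM2l l2); move: h; lra.
exists n_, (g `^ alpha^-1); have kap0 : 0 < g `^ alpha^-1 by exact: powR_gt0.
split => // x _; have mR n y : measurable [set w | ratio n w <= y] by [].
have cdfP n y : PX [set w | ratio n w <= y] = (cdf n y)%:E by rewrite fine_probE.
under eq_fun do rewrite cdfP.
apply: cvg_EFin; first exact: nearW.
rewrite /frechet_cdf pmulr_lgt0 ?invr_gt0//.
have [x0|x0] := ltP 0 x.
  have -> : (x / g `^ alpha^-1) `^ (- alpha) = g * x `^ (- alpha).
    rewrite powRM ?invr_ge0 ?(ltW x0) ?(ltW kap0)// mulrC; congr (_ * _).
    rewrite -[(g `^ _)^-1]powR_inv1 ?(ltW kap0)// -powRrM mulrNN mul1r -powRrM.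
    by rewrite mulVf ?gt_eqF// powRr1 ?ltW.
  exact: (maxima_cvg alpha_lt2 c20 k1 kinf F_ge F_le incr gc x0).
(* For [x <= 0] the limit is 0: the distribution function at [x] is at most its value at a small
   [y > 0]. *)
apply/cvgr0Pnorm_le => eta eta0.
have [y y0 hy] := maxima_cvg0 alpha_gt0 alpha_lt2 c20 k1 kinf F_ge F_le incr g0 gc eta0.
apply: filterS hy => j; apply: le_trans; rewrite ger0_norm /=; last exact: fine_ge0.
by apply: le_fine_prob => // w /= /le_trans; apply; exact: (le_trans x0 (ltW y0)).
Qed.
End stable_field_maxima.

Theorem theorem3p1 (R : realType) (alpha : R) (alpha_gt0 : 0 < alpha)
    (alpha_lt2 : alpha < 2)
    (G : groupType) (countable_G : countable [set: G])
    (infinite_G : infinite_set [set: G])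
    (D : {fset G}) (D_sym : forall t, t \in D -> (t^-1)%g \in D)
    (D_1 : (1%g : G) \notin D) (D_gen : generates D)
    (d : measure_display) (S : measurableType d) (S_std : standard_borel R S)
    (m : {sigma_finite_measure set S -> \bar R})
    (phi : G -> S -> S) (phi_act : is_action phi) (phi_ns : nonsingular m phi) :
  exists A B : set S,
  [/\ unique_ab_decomposition alpha D m phi A B,
      (forall m' : {sigma_finite_measure set S -> \bar R},
         equivalent_measures m' m ->
         unique_ab_decomposition alpha D m' phi A B),
      (forall C Di, hopf_decomposition m phi C Di -> ae_subset m Di A),
      (forall Po N, neveu_decomposition m phi Po N -> ae_subset m Po B) &
      forall (dX : measure_display) (OmegaX : measurableType dX)
        (PX : probability OmegaX R) (X : G -> {RV PX >-> R})
        (dM : measure_display) (OmegaM : measurableType dM)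
        (PM : probability OmegaM R) (M : set S -> {RV PM >-> R})
        (f : S -> R) (c : G -> S -> R),
      SaS_field PX alpha X -> left_stationary PX X ->
      SaS_random_measure alpha m M ->
      f \in Lfun m alpha%:E -> cocycle m phi c ->
      let f_ := field_kernel alpha m phi c f in
      fdd_eq PX X PM (fun t => stable_integral alpha m M (f_ t)) ->
      let XA := fun t => stable_integral_on alpha m M A (f_ t) in
      let XB := fun t => stable_integral_on alpha m M B (f_ t) in
      let XA_zero := forall t, {ae PM, forall w, XA t w = 0} in
      let ratio := fun (n : nat) (w : OmegaX) =>
        ball_max D (fun t => `|X t w|) n / ball_norming alpha D n in
      [/\ fdd_eq PX X PM (fun t w => XA t w + XB t w),
          independent_fields PM XA XB,
          XA_zero -> cvg_in_probability PX ratio (cst 0) &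
          ~ XA_zero ->
            tight PX ratio /\
            exists (n_ : nat -> nat) (kappa : R),
              [/\ {homo n_ : i j / (i < j)%N}, 0 < kappa &
                  cvg_in_distribution PX (fun k => ratio (n_ k))
                    (fun x => frechet_cdf alpha (x / kappa))]]].
Proof.
have [B Bsub Bmax] := @sublinear_set_maximal R G D d S phi D_sym D_gen phi_act m phi_ns.
have Bm : maximal_sublinear D phi m B by split.
have abB := ab_of_maximal alpha_gt0 D_sym D_gen phi_act phi_ns Bm.
have [[_ [mB invB] _ _] clB] := abB.
exists (~` B), B; split.
- by split => // A' B'; exact: ab_unique.
- move=> m' m'm.
  have ns' := nonsingular_equivalent phi_act m'm phi_ns.
  have Bm' := maximal_sublinear_equivalent D_sym D_gen phi_act phi_ns m'm Bm.
  split; first exact: ab_of_maximal.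
  by move=> A' B'; exact: ab_unique.
- by move=> C Di; exact: (dissipative_subset D_sym D_gen phi_act phi_ns Bm).
- by move=> Po N; exact: (positive_subset D_sym D_gen infinite_G phi_act phi_ns Bm).
move=> dX OmegaX PX X dM OmegaM PM M f c _ _ MS fL c_coc f_ X_law XA XB XA_zero ratio.
have [clB0 clA] := clB f fL.
split.
- apply: (fdd_eq_trans X_law); apply: fdd_eq_ae => t.
  + exact: measurable_stable_integral.
  + by apply: measurable_funD; exact: measurable_stable_integral.
  + exact: (stable_integral_split alpha_gt0 phi_act phi_ns c_coc fL MS mB).
- exact: (independent_stable_integrals alpha_gt0 phi_act phi_ns c_coc fL MS mB).
- move=> XA0; apply: maxima_cvg_in_probability X_law _ => //.
  apply/b_ratio_cvg0P => //; apply: clB0.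
  exact: (zero_component_support alpha_gt0 phi_act phi_ns c_coc fL MS mB).
- move=> XA1; split; first exact: maxima_tight_ratio X_law.
  (* Were [|f|^alpha] sublinear, the ratios would tend to 0, contradicting the positive upper limit
     which (b) gives when [f] charges the complement of [B]. *)
  apply: maxima_frechet X_law _ => // /(b_ratio_cvg0P _ alpha_gt0 D_sym D_gen) b0.
  have /clA : (0 < m ([set s | (f s != 0)%R] `&` ~` B))%E.
    apply: (nonzero_component_support alpha_gt0 phi_act phi_ns c_coc fL MS mB) XA1 => t.
    by have [h1 h2] := invB t; split.
  by rewrite is_cvg_limn_esupE ?(cvg_lim _ b0) ?ltxx//; apply/cvg_ex; exists 0%E.
Qed.
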